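(* Let $A\subset C$ be a purely inseparable ring extension and let $B$ be an intermediate subring, $A\subset B\subset C$. Assume that (1) $A\subset B$ and $B\subset C$ are $\mathcal F$-extensions, and (2) for $1\leq e<\exp(C/B)$, each of the extensions $A\subset B[C^{p^e}]$ is an $\mathcal F$-extension. Then $A\subset B\subset C$ is a purely inseparable tower.
   Context: All rings are commutative with identity $1\neq 0$ and of characteristic $p$, for a fixed prime $p$. A ring extension $A\subset C$ is finite if $C$ is a finitely generated $A$-module. It has finite exponent if there is an integer $e\ge 0$ with $x^{p^e}\in A$ for all $x\in C$; the minimal such $e$ is $\exp(C/A)$. For a subring $R\subset C$, $R[C^{p^e}]$ is the $R$-subalgebra of $C$ generated by all $x^{p^e}$, $x\in C$. Purely inseparable: $A\subset C$ is purely inseparable if (i) it has finite exponent; (ii) $C$ is a finite projective $A$-module; (iii) for each prime ideal $\mathfrak p\subset A$ there is a faithfully flat ring homomorphism $A_{\mathfrak p}\to A'$ such that $C_{\mathfrak p}\otimes_{A_{\mathfrak p}}A'$ is isomorphic to an $A'$-algebra of the form $A'[X_1,\ldots,X_n]/\langle X_1^{p^{e_1}},\ldots,X_n^{p^{e_n}}\rangle$ for some $n\ge 0$ and $e_i>0$. $\mathcal F$-extension: a finite ring extension $A\subset C$ of finite exponent is an $\mathcal F$-extension if $C$ is a projective $A[C^{p^e}]$-module for all $e\geq 0$. A tower of rings $A\subset B\subset C$ is a purely inseparable tower if $A\subset C$, $A\subset B$ and $B\subset C$ are all purely inseparable. *)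

(* Defs.v *)
From HB Require Import structures.
From mathcomp Require Import all_boot all_algebra.
From mathcomp Require Import boolp ring.
From mathcomp Require Import freeg mpoly.

Set Implicit Arguments.
Unset Strict Implicit.
Unset Printing Implicit Defensive.

Import GRing.Theory.

Local Open Scope ring_scope.
Local Open Scope quotient_scope.

(* Rings are [comNzRingType]; a ring extension A < C is an injective ring     *)
(* homomorphism f : A -> C.  Localizations and tensor products are only known *)
(* to be [comPzRingType] (the zero ring is allowed a priori).                 *)

(* S regarded as an R-module through f : R -> S. *)
Definition restr_scalars (R S : comPzRingType) (f : {rmorphism R -> S}) : Type :=
  S.

Section RestrScalars.
Variables (R S : comPzRingType) (f : {rmorphism R -> S}).
Local Notation Sf := (restr_scalars f).

HB.instance Definition _ := GRing.ComPzRing.on Sf.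

Definition restr_scale (a : R) (x : Sf) : Sf := f a * x.

Lemma restr_scaleA a b x :
  restr_scale a (restr_scale b x) = restr_scale (a * b) x.
Proof. by rewrite /restr_scale rmorphM mulrA. Qed.

Lemma restr_scale1 : left_id 1 restr_scale.
Proof. by move=> x; rewrite /restr_scale rmorph1 mul1r. Qed.

Lemma restr_scaleDr : right_distributive restr_scale +%R.
Proof. by move=> a x y; rewrite /restr_scale mulrDr. Qed.

Lemma restr_scaleDl x : {morph restr_scale^~ x : a b / a + b}.
Proof. by move=> a b; rewrite /restr_scale rmorphD mulrDl. Qed.

HB.instance Definition _ := GRing.Zmodule_isLmodule.Build R Sf
  restr_scaleA restr_scale1 restr_scaleDr restr_scaleDl.

End RestrScalars.

Definition fin_generated (R : comPzRingType) (M : lmodType R) : Prop :=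
  exists (n : nat) (g : 'I_n -> M),
    forall x, exists a : 'I_n -> R, x = \sum_(i < n) a i *: g i.

Definition projective (R : comPzRingType) (P : lmodType R) : Prop :=
  forall (M N : lmodType R) (g : {linear M -> N}) (h : {linear P -> N}),
    (forall y, exists x, g x = y) ->
    exists k : {linear P -> M}, forall x, g (k x) = h x.

(* M (x)_R N: the free abelian group on M * N modulo the subgroup generated   *)
(* by the bilinearity and balancing relations.                                *)
Section Tensor.
Variables (R : comPzRingType) (M N : lmodType R).
Local Notation F := {freeg (M * N)%type / int}.

Inductive tensor_gen : F -> Prop :=
| TensorGenDl m1 m2 n :
    tensor_gen (<< (m1 + m2, n) >> - (<< (m1, n) >> + << (m2, n) >>))
| TensorGenDr m n1 n2 :
    tensor_gen (<< (m, n1 + n2) >> - (<< (m, n1) >> + << (m, n2) >>))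
| TensorGenZ a m n :
    tensor_gen (<< (a *: m, n) >> - << (m, a *: n) >>).

Definition tensor_rel : {pred F} := fun z =>
  `[< forall S : {pred F}, zmod_closed S ->
        (forall g, tensor_gen g -> g \in S) -> z \in S >].

Lemma tensor_relP z :
  reflect (forall S : {pred F}, zmod_closed S ->
             (forall g, tensor_gen g -> g \in S) -> z \in S)
          (z \in tensor_rel).
Proof. exact: asboolP. Qed.

Lemma tensor_rel_gen g : tensor_gen g -> g \in tensor_rel.
Proof. by move=> gen_g; apply/tensor_relP => S _; apply. Qed.

Lemma tensor_rel_zmod_closed : zmod_closed tensor_rel.
Proof.
split=> [|x y /tensor_relP xP /tensor_relP yP]; apply/tensor_relP => S clS genS.
  by case: clS.
by case: (clS) => _; apply; [apply: xP | apply: yP].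
Qed.

HB.instance Definition _ := GRing.isZmodClosed.Build F tensor_rel
  tensor_rel_zmod_closed.

Definition tensor : Type := Quotient.quot tensor_rel.
HB.instance Definition _ := GRing.Zmodule.on tensor.

Definition tens (m : M) (n : N) : tensor :=
  \pi_(Quotient.quot tensor_rel) << (m, n) >>.

Definition balanced (V : zmodType) (b : M -> N -> V) : Prop :=
  [/\ forall n, {morph b^~ n : m1 m2 / m1 + m2},
      forall m, {morph b m : n1 n2 / n1 + n2}
    & forall a m n, b (a *: m) n = b m (a *: n)].

Lemma tensDl n : {morph tens^~ n : m1 m2 / m1 + m2}.
Proof.
move=> m1 m2; rewrite /tens -[RHS]raddfD; apply/eqP.
by rewrite -Quotient.idealrBE tensor_rel_gen //; exact: TensorGenDl.
Qed.

Lemma tensDr m : {morph tens m : n1 n2 / n1 + n2}.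
Proof.
move=> n1 n2; rewrite /tens -[RHS]raddfD; apply/eqP.
by rewrite -Quotient.idealrBE tensor_rel_gen //; exact: TensorGenDr.
Qed.

Lemma tensZ a m n : tens (a *: m) n = tens m (a *: n).
Proof.
apply/eqP; rewrite -Quotient.idealrBE tensor_rel_gen //; exact: TensorGenZ.
Qed.

Lemma tens_balanced : balanced tens.
Proof. by split; [exact: tensDl | exact: tensDr | exact: tensZ]. Qed.

Lemma tensorW (P : tensor -> Prop) :
  (forall m n, P (tens m n)) -> (forall x y, P x -> P y -> P (x - y)) ->
  forall x, P x.
Proof.
move=> Pt PB; have P0 : P 0 by rewrite -(subrr (tens 0 0)); apply: PB.
have PN x : P x -> P (- x) by move=> Px; rewrite -sub0r; apply: PB.
have PD x y : P x -> P y -> P (x + y).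
  by move=> Px Py; rewrite -[y]opprK; apply/PB/PN.
have PM x n : P x -> P (x *+ n).
  by move=> Px; elim: n => // n IHn; rewrite mulrS; apply: PD.
have PZ x k : P x -> P (x *~ k).
  by case: k => n Px; rewrite ?NegzE ?mulrNz; [|apply: PN]; apply: PM.
move=> x; rewrite -[x]reprK.
elim/freeg_ind_dom0: (repr x) => [|k [m n] D _ _ IHD]; first by rewrite raddf0.
rewrite raddfD; apply: PD => //.
rewrite -[k]intz -freegU_mulz raddfMz; exact/PZ/Pt.
Qed.

(* The additive map induced by b; meaningful when b is balanced. *)
Definition tensor_lift (V : zmodType) (b : M -> N -> V) (x : tensor) : V :=
  fglift (fun mn => b mn.1 mn.2 : zmodule V) (repr (x : Quotient.quot tensor_rel)).

Section Lift.
Variables (V : zmodType) (b : M -> N -> V).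
Hypothesis bal_b : balanced b.
Let phi : F -> zmodule V := fglift (fun mn => b mn.1 mn.2 : zmodule V).

Let phiE m n : phi << (m, n) >> = b m n.
Proof. by rewrite /phi liftU scale1r. Qed.

Let phiB x y : phi (x - y) = phi x - phi y.
Proof. exact: lift_is_additive. Qed.

Let phi0 : phi 0 = 0.
Proof. by rewrite -(subrr 0) phiB subrr. Qed.

Let phiD x y : phi (x + y) = phi x + phi y.
Proof. by rewrite -[y in LHS]opprK phiB -[- y]sub0r phiB phi0 sub0r opprK. Qed.

Let phi_rel z : z \in tensor_rel -> phi z = 0.
Proof.
case: bal_b => bDl bDr bZ.
move=> /tensor_relP /(_ [pred z | phi z == 0]) zP; apply/eqP/zP.
  split=> [|x y]; first by rewrite inE phi0.
  by rewrite !inE phiB => /eqP -> /eqP ->; rewrite subrr.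
by move=> _ [m1 m2 n|m n1 n2|a m n];
   rewrite inE phiB ?phiD !phiE ?bDl ?bDr ?bZ subrr.
Qed.

Let lift_pi z :
  tensor_lift b (\pi_(Quotient.quot tensor_rel) z) = phi z.
Proof.
apply/eqP; rewrite -subr_eq0 /tensor_lift -/phi -phiB phi_rel //.
by rewrite Quotient.idealrBE reprK.
Qed.

Lemma tensor_liftE m n : tensor_lift b (tens m n) = b m n.
Proof. by rewrite lift_pi phiE. Qed.

Lemma tensor_liftB : {morph tensor_lift b : x y / x - y}.
Proof.
move=> x y; rewrite -[x]reprK -[y]reprK -[in LHS]raddfB /=.
by rewrite !lift_pi phiB.
Qed.

Lemma tensor_liftD : {morph tensor_lift b : x y / x + y}.
Proof.
move=> x y; rewrite -[x]reprK -[y]reprK -[in LHS]raddfD /=.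
by rewrite !lift_pi phiD.
Qed.

End Lift.

End Tensor.

Arguments tens {R M N} m n.

(* id (x) g : M (x) N1 -> M (x) N2 *)
Definition tensor_map (R : comPzRingType) (M N1 N2 : lmodType R)
    (g : {linear N1 -> N2}) : tensor M N1 -> tensor M N2 :=
  tensor_lift (fun m n => tens m (g n)).

Definition exact_seq (U V W : zmodType) (g : U -> V) (h : V -> W) : Prop :=
  forall y, h y = 0 <-> exists x, g x = y.

Definition faithfully_flat (R S : comPzRingType) (f : {rmorphism R -> S}) : Prop :=
  forall (N1 N2 N3 : lmodType R) (g : {linear N1 -> N2}) (h : {linear N2 -> N3}),
    exact_seq g h <->
    exact_seq (tensor_map (M := restr_scalars f) g)
              (tensor_map (M := restr_scalars f) h).

(* The ring S1 (x)_R S2, with (a (x) b) * (c (x) d) = (a c) (x) (b d). *)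
Definition tensor_ring (R S1 S2 : comPzRingType)
    (f1 : {rmorphism R -> S1}) (f2 : {rmorphism R -> S2}) : Type :=
  tensor (restr_scalars f1) (restr_scalars f2).

Section TensorRing.
Variables (R S1 S2 : comPzRingType).
Variables (f1 : {rmorphism R -> S1}) (f2 : {rmorphism R -> S2}).
Local Notation M := (restr_scalars f1).
Local Notation N := (restr_scalars f2).
Local Notation T := (tensor_ring f1 f2).

HB.instance Definition _ := GRing.Zmodule.on T.

Definition tensor_one : T := tens (1 : M) (1 : N).

Definition tensor_mul (x y : T) : T :=
  tensor_lift (fun (a : M) (b : N) =>
    tensor_lift (fun (c : M) (d : N) => tens (a * c : M) (b * d : N)) y) x.

Let in_balanced (a : M) (b : N) :
  balanced (fun (c : M) (d : N) => tens (a * c : M) (b * d : N)).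
Proof.
split=> [n m1 m2|m n1 n2|r m n]; first by rewrite mulrDr tensDl.
  by rewrite mulrDr tensDr.
have -> : a * (r *: m) = r *: (a * m) :> M by rewrite /GRing.scale /= /restr_scale mulrCA.
have -> : b * (r *: n) = r *: (b * n) :> N by rewrite /GRing.scale /= /restr_scale mulrCA.
exact: tensZ.
Qed.

Let out_balanced (y : T) : balanced (fun (a : M) (b : N) =>
  tensor_lift (fun (c : M) (d : N) => tens (a * c : M) (b * d : N)) y).
Proof.
split=> [n m1 m2|m n1 n2|r m n]; elim/tensorW: y => [c d|x y IHx IHy].
- by rewrite !tensor_liftE // mulrDl tensDl.
- by rewrite !tensor_liftB // IHx IHy addrACA opprD.
- by rewrite !tensor_liftE // mulrDl tensDr.
- by rewrite !tensor_liftB // IHx IHy addrACA opprD.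
- rewrite !tensor_liftE //.
  have -> : (r *: m) * c = r *: (m * c) :> M by rewrite /GRing.scale /= /restr_scale mulrA.
  have -> : (r *: n) * d = r *: (n * d) :> N by rewrite /GRing.scale /= /restr_scale mulrA.
  exact: tensZ.
- by rewrite !tensor_liftB // IHx IHy.
Qed.

Lemma tensor_mulE (a c : M) (b d : N) :
  tensor_mul (tens a b) (tens c d) = tens (a * c : M) (b * d : N).
Proof. by rewrite /tensor_mul tensor_liftE // tensor_liftE. Qed.

Lemma tensor_mulBl : left_distributive tensor_mul (fun x y => x - y).
Proof. by move=> x y z; rewrite /tensor_mul tensor_liftB. Qed.

Lemma tensor_mulDl : left_distributive tensor_mul +%R.
Proof. by move=> x y z; rewrite /tensor_mul tensor_liftD. Qed.

Lemma tensor_mulBr : right_distributive tensor_mul (fun x y => x - y).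
Proof.
move=> x y z; elim/tensorW: x => [a b|x1 x2 IH1 IH2].
  by rewrite /tensor_mul !tensor_liftE // tensor_liftB.
by rewrite !tensor_mulBl IH1 IH2 !opprD addrACA.
Qed.

Lemma tensor_mulC : commutative tensor_mul.
Proof.
move=> x y; elim/tensorW: x => [a b|x1 x2 IH1 IH2]; last first.
  by rewrite tensor_mulBl tensor_mulBr IH1 IH2.
elim/tensorW: y => [c d|y1 y2 IH1 IH2]; last first.
  by rewrite tensor_mulBl tensor_mulBr IH1 IH2.
by rewrite !tensor_mulE mulrC [b * d]mulrC.
Qed.

Lemma tensor_mulA : associative tensor_mul.
Proof.
move=> x y z; elim/tensorW: x => [a b|x1 x2 IH1 IH2]; last first.
  by rewrite !tensor_mulBl IH1 IH2.
elim/tensorW: y => [c d|y1 y2 IH1 IH2]; last first.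
  by rewrite !(tensor_mulBl, tensor_mulBr) IH1 IH2.
elim/tensorW: z => [u v|z1 z2 IH1 IH2]; last first.
  by rewrite !tensor_mulBr IH1 IH2.
by rewrite !tensor_mulE !mulrA.
Qed.

Lemma tensor_mul1 : left_id tensor_one tensor_mul.
Proof.
elim/tensorW => [a b|x y IHx IHy]; last by rewrite tensor_mulBr IHx IHy.
by rewrite tensor_mulE !mul1r.
Qed.

HB.instance Definition _ := GRing.Zmodule_isComPzRing.Build T
  tensor_mulA tensor_mulC tensor_mul1 tensor_mulDl.

Definition tensor_inr (b : S2) : T := tens (1 : M) (b : N).

End TensorRing.

(* The ring C_P = (A \ P)^-1 C for a prime ideal P of A and f : A -> C; the    *)
(* pair (c, s) stands for c / f s.  For f = id this is A_P.                   *)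
Section Localization.
Variables (A C : comNzRingType) (f : {rmorphism A -> C}) (P : prime_idealr A).
Local Notation I := (P : {pred A}).

Definition frac : Type := (C * {s : A | s \notin I})%type.
HB.instance Definition _ := Choice.on frac.

Definition frac_eq (x y : frac) : bool :=
  `[< exists2 u : A, u \notin I &
        f u * (x.1 * f (val y.2)) = f u * (y.1 * f (val x.2)) >].

Lemma frac_eqP x y :
  reflect (exists2 u : A, u \notin I &
             f u * (x.1 * f (val y.2)) = f u * (y.1 * f (val x.2)))
          (frac_eq x y).
Proof. exact: asboolP. Qed.

Lemma prime_notinM (s t : A) : s \notin I -> t \notin I -> s * t \notin I.
Proof. by move=> sI tI; rewrite prime_idealrM negb_or sI. Qed.

Lemma prime_notin1 : 1 \notin I. Proof. by rewrite idealr1. Qed.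

Lemma frac_eq_equiv : equiv_class_of frac_eq.
Proof.
split=> [x|x y|y x z].
- by apply/frac_eqP; exists 1 => //; exact: prime_notin1.
- by apply/frac_eqP/frac_eqP => -[u uI H]; exists u.
- move=> /frac_eqP[u uI Hu] /frac_eqP[v vI Hv]; apply/frac_eqP.
  exists (u * v * val y.2); first by rewrite !prime_notinM // (valP y.2).
  transitivity (f v * f (val z.2) * (f u * (x.1 * f (val y.2)))); first by ring.
  rewrite Hu.
  transitivity (f u * f (val x.2) * (f v * (y.1 * f (val z.2)))); first by ring.
  by rewrite Hv; ring.
Qed.

Canonical frac_eq_equivRel := EquivRelPack frac_eq_equiv.
Canonical frac_eq_encModRel := defaultEncModRel frac_eq.

Definition localization : Type := {eq_quot frac_eq}.
HB.instance Definition _ : EqQuotient frac frac_eq localization :=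
  EqQuotient.on localization.
HB.instance Definition _ := Choice.on localization.

Definition mk_frac (c : C) (s : A) (sI : s \notin I) : localization :=
  \pi_localization (c, exist _ s sI).

Lemma mk_frac_eq (u : A) (uI : u \notin I) (c c' : C) (s s' : A)
    (sI : s \notin I) (s'I : s' \notin I) :
  f u * (c * f s') = f u * (c' * f s) -> mk_frac c sI = mk_frac c' s'I.
Proof. by move=> H; apply/eqmodP/frac_eqP; exists u. Qed.

Lemma mk_fracP (x : localization) :
  exists c s (sI : s \notin I), x = mk_frac c sI.
Proof.
by rewrite -[x]reprK; case: (repr x) => c [s sI]; exists c, s, sI.
Qed.

Lemma mk_frac_inj (c c' : C) (s s' : A) (sI : s \notin I) (s'I : s' \notin I) :
  mk_frac c sI = mk_frac c' s'I ->
  exists2 u : A, u \notin I & f u * (c * f s') = f u * (c' * f s).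
Proof. by move=> /eqmodP/frac_eqP. Qed.

Definition loc_add (x y : localization) : localization :=
  let: (c, s) := repr x in let: (d, t) := repr y in
  mk_frac (c * f (val t) + d * f (val s)) (prime_notinM (valP s) (valP t)).

Definition loc_mul (x y : localization) : localization :=
  let: (c, s) := repr x in let: (d, t) := repr y in
  mk_frac (c * d) (prime_notinM (valP s) (valP t)).

Definition loc_opp (x : localization) : localization :=
  let: (c, s) := repr x in mk_frac (- c) (valP s).

Definition loc_zero : localization := mk_frac 0 prime_notin1.
Definition loc_one : localization := mk_frac 1 prime_notin1.

Lemma repr_mk_frac (c : C) (s : A) (sI : s \notin I) :
  exists2 u : A, u \notin I &
    f u * ((repr (mk_frac c sI)).1 * f s) =
    f u * (c * f (val (repr (mk_frac c sI)).2)).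
Proof.
have : \pi_localization (repr (mk_frac c sI)) = mk_frac c sI by rewrite reprK.
by case: (repr (mk_frac c sI)) => d [t tI] H; exact: mk_frac_inj H.
Qed.

Lemma loc_addE (c d : C) (s t : A) (sI : s \notin I) (tI : t \notin I) :
  loc_add (mk_frac c sI) (mk_frac d tI) =
  mk_frac (c * f t + d * f s) (prime_notinM sI tI).
Proof.
rewrite /loc_add.
have [] := repr_mk_frac c sI; have [] := repr_mk_frac d tI.
case: (repr _) => d' [t' t'I]; case: (repr _) => c' [s' s'I] /= v vI Hv u uI Hu.
apply: (mk_frac_eq (prime_notinM uI vI)).
transitivity (f u * (c' * f s) * (f v * f t * f t') +
              f v * (d' * f t) * (f u * f s * f s')); first by ring.
by rewrite Hu Hv; ring.
Qed.

Lemma loc_mulE (c d : C) (s t : A) (sI : s \notin I) (tI : t \notin I) :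
  loc_mul (mk_frac c sI) (mk_frac d tI) = mk_frac (c * d) (prime_notinM sI tI).
Proof.
rewrite /loc_mul.
have [] := repr_mk_frac c sI; have [] := repr_mk_frac d tI.
case: (repr _) => d' [t' t'I]; case: (repr _) => c' [s' s'I] /= v vI Hv u uI Hu.
apply: (mk_frac_eq (prime_notinM uI vI)).
transitivity (f u * (c' * f s) * (f v * (d' * f t))); first by ring.
by rewrite Hu Hv; ring.
Qed.

Lemma loc_oppE (c : C) (s : A) (sI : s \notin I) :
  loc_opp (mk_frac c sI) = mk_frac (- c) sI.
Proof.
rewrite /loc_opp; have [] := repr_mk_frac c sI.
case: (repr _) => c' [s' s'I] /= u uI Hu; apply: (mk_frac_eq uI).
by transitivity (- (f u * (c' * f s))); [|rewrite Hu]; ring.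
Qed.

Lemma loc_eq (c c' : C) (s s' : A) (sI : s \notin I) (s'I : s' \notin I) :
  c * f s' = c' * f s -> mk_frac c sI = mk_frac c' s'I.
Proof. by move=> H; apply: (mk_frac_eq prime_notin1); rewrite H. Qed.

Lemma loc_addA : associative loc_add.
Proof.
move=> x y z; have [c [s [sI ->]]] := mk_fracP x.
have [d [t [tI ->]]] := mk_fracP y; have [e [r [rI ->]]] := mk_fracP z.
by rewrite !loc_addE; apply: loc_eq; ring.
Qed.

Lemma loc_addC : commutative loc_add.
Proof.
move=> x y; have [c [s [sI ->]]] := mk_fracP x; have [d [t [tI ->]]] := mk_fracP y.
by rewrite !loc_addE; apply: loc_eq; ring.
Qed.

Lemma loc_add0 : left_id loc_zero loc_add.
Proof.
by move=> x; have [c [s [sI ->]]] := mk_fracP x; rewrite loc_addE; apply: loc_eq; ring.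
Qed.

Lemma loc_addN : left_inverse loc_zero loc_opp loc_add.
Proof.
move=> x; have [c [s [sI ->]]] := mk_fracP x.
by rewrite loc_oppE loc_addE; apply: loc_eq; ring.
Qed.

HB.instance Definition _ := GRing.isZmodule.Build localization
  loc_addA loc_addC loc_add0 loc_addN.

Lemma loc_mulA : associative loc_mul.
Proof.
move=> x y z; have [c [s [sI ->]]] := mk_fracP x.
have [d [t [tI ->]]] := mk_fracP y; have [e [r [rI ->]]] := mk_fracP z.
by rewrite !loc_mulE; apply: loc_eq; ring.
Qed.

Lemma loc_mulC : commutative loc_mul.
Proof.
move=> x y; have [c [s [sI ->]]] := mk_fracP x; have [d [t [tI ->]]] := mk_fracP y.
by rewrite !loc_mulE; apply: loc_eq; ring.
Qed.

Lemma loc_mul1 : left_id loc_one loc_mul.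
Proof.
by move=> x; have [c [s [sI ->]]] := mk_fracP x; rewrite loc_mulE; apply: loc_eq; ring.
Qed.

Lemma loc_mulDl : left_distributive loc_mul +%R.
Proof.
move=> x y z; have [c [s [sI ->]]] := mk_fracP x.
have [d [t [tI ->]]] := mk_fracP y; have [e [r [rI ->]]] := mk_fracP z.
by rewrite -![_ + _]/(loc_add _ _) loc_addE !loc_mulE loc_addE; apply: loc_eq; ring.
Qed.

HB.instance Definition _ := GRing.Zmodule_isComPzRing.Build localization
  loc_mulA loc_mulC loc_mul1 loc_mulDl.

End Localization.

(* The map A_P -> C_P, a / s |-> f a / s. *)
Section LocMap.
Variables (A C : comNzRingType) (f : {rmorphism A -> C}) (P : prime_idealr A).
Local Notation AP := (localization (idfun : {rmorphism A -> A}) P).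
Local Notation CP := (localization f P).

Definition loc_map (x : AP) : CP :=
  let: (a, s) := repr x in mk_frac f (f a) (valP s).

Lemma loc_mapE (a s : A) (sI : s \notin (P : {pred A})) :
  loc_map (mk_frac idfun a sI) = mk_frac f (f a) sI.
Proof.
rewrite /loc_map; have [] := repr_mk_frac idfun a sI.
case: (repr _) => a' [s' s'I] /= u uI Hu; apply: (mk_frac_eq uI).
by rewrite -!rmorphM Hu.
Qed.

Lemma loc_map_zmod_morphism : zmod_morphism loc_map.
Proof.
move=> x y; have [a [s [sI ->]]] := mk_fracP x; have [b [t [tI ->]]] := mk_fracP y.
rewrite -[- mk_frac _ b tI]/(loc_opp _) loc_oppE.
rewrite -[mk_frac _ a sI + _]/(loc_add _ _) loc_addE !loc_mapE.
rewrite -[- mk_frac _ _ tI]/(loc_opp _) loc_oppE.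
rewrite -[RHS]/(loc_add _ _) loc_addE.
by apply: loc_eq; rewrite /= rmorphD !rmorphM rmorphN.
Qed.

Lemma loc_map_monoid_morphism : monoid_morphism loc_map.
Proof.
split=> [|x y].
  by rewrite -[1]/(loc_one _ P) loc_mapE; apply: loc_eq; rewrite rmorph1.
have [a [s [sI ->]]] := mk_fracP x; have [b [t [tI ->]]] := mk_fracP y.
rewrite -[X in loc_map X]/(loc_mul _ _) loc_mulE !loc_mapE.
by rewrite -[RHS]/(loc_mul _ _) loc_mulE; apply: loc_eq; rewrite /= rmorphM.
Qed.

HB.instance Definition _ := GRing.isZmodMorphism.Build AP CP loc_map
  loc_map_zmod_morphism.
HB.instance Definition _ := GRing.isMonoidMorphism.Build AP CP loc_map
  loc_map_monoid_morphism.

End LocMap.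

Arguments loc_map {A C} f P x.

(* R[X_1, ..., X_n] / <X_1 ^ d_1, ..., X_n ^ d_n>, all d_i > 0. *)
Section TruncatedPolynomials.
Variables (R : comNzRingType) (n : nat) (d : 'I_n -> nat).
Hypothesis d_gt0 : forall i, (0 < d i)%N.

(* The proof is an argument because {ideal_quot _} needs a proper ideal. *)
Definition trunc_ideal of (forall i, (0 < d i)%N) : {pred {mpoly R[n]}} :=
  fun q => `[< exists c : 'I_n -> {mpoly R[n]}, q = \sum_(i < n) c i * 'X_i ^+ d i >].

Lemma trunc_idealP q :
  reflect (exists c : 'I_n -> {mpoly R[n]}, q = \sum_(i < n) c i * 'X_i ^+ d i)
          (q \in trunc_ideal d_gt0).
Proof. exact: asboolP. Qed.

Lemma trunc_ideal_closed : idealr_closed (trunc_ideal d_gt0).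
Proof.
split.
- by apply/trunc_idealP; exists (fun=> 0); rewrite big1 // => i _; rewrite mul0r.
- apply/trunc_idealP => -[c /(congr1 (mcoeff 0%MM))].
  rewrite mcoeff1 eqxx raddf_sum /= big1 => [|i _].
    by move/eqP; rewrite oner_eq0.
  rewrite (rmorphM (mcoeff 0%MM)) (rmorphXn (mcoeff 0%MM)) /= mcoeffX.
  by rewrite mnm1_eq0 expr0n gtn_eqF ?mulr0.
- move=> a _ _ /trunc_idealP[c ->] /trunc_idealP[e ->]; apply/trunc_idealP.
  exists (fun i => a * c i + e i); rewrite mulr_sumr -big_split /=.
  by apply: eq_bigr => i _; rewrite mulrDl mulrA.
Qed.

HB.instance Definition _ := isIdealr.Build {mpoly R[n]} (trunc_ideal d_gt0)
  trunc_ideal_closed.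

Definition trunc_mpoly : Type := {ideal_quot (trunc_ideal d_gt0)}.
HB.instance Definition _ := GRing.ComNzRing.on trunc_mpoly.

Definition trunc_const (a : R) : trunc_mpoly :=
  \pi_{ideal_quot (trunc_ideal d_gt0)} a%:MP.

End TruncatedPolynomials.

(* R[C^{p^e}] for f : R -> C, as a subring of C. *)
Section FrobeniusSubalgebra.
Variables (R C : comNzRingType) (f : {rmorphism R -> C}) (p e : nat).

Definition frob_pred : {pred C} := fun x =>
  `[< forall S : {pred C}, GRing.subring_closed S -> (forall a, f a \in S) ->
        (forall y, y ^+ (p ^ e) \in S) -> x \in S >].

Lemma frob_predP x :
  reflect (forall S : {pred C}, GRing.subring_closed S -> (forall a, f a \in S) ->
             (forall y, y ^+ (p ^ e) \in S) -> x \in S) (x \in frob_pred).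
Proof. exact: asboolP. Qed.

Lemma frob_pred_subring_closed : GRing.subring_closed frob_pred.
Proof.
split=> [|x y /frob_predP xP /frob_predP yP|x y /frob_predP xP /frob_predP yP];
  apply/frob_predP => S clS fS pS; case: (clS) => S1 SB SM //.
- by apply: SB; [exact: xP | exact: yP].
- by apply: SM; [exact: xP | exact: yP].
Qed.

HB.instance Definition _ := GRing.isSubringClosed.Build C frob_pred
  frob_pred_subring_closed.

Record frob_alg : Type := FrobAlg { frob_val : C; _ : frob_val \in frob_pred }.

HB.instance Definition _ := [isSub for frob_val].
HB.instance Definition _ := [Choice of frob_alg by <:].
HB.instance Definition _ := [SubChoice_isSubComNzRing of frob_alg by <:].

Definition frob_incl : {rmorphism frob_alg -> C} := val.

Lemma frob_pred_base a : f a \in frob_pred.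
Proof. by apply/frob_predP. Qed.

(* The structure map R -> R[C^{p^e}]. *)
Definition frob_base (a : R) : frob_alg := FrobAlg (frob_pred_base a).

Lemma frob_base_zmod_morphism : zmod_morphism frob_base.
Proof. by move=> a b; apply: val_inj; rewrite /= rmorphB. Qed.

Lemma frob_base_monoid_morphism : monoid_morphism frob_base.
Proof. by split=> [|a b]; apply: val_inj; rewrite /= ?rmorph1 ?rmorphM. Qed.

HB.instance Definition _ := GRing.isZmodMorphism.Build R frob_alg frob_base
  frob_base_zmod_morphism.
HB.instance Definition _ := GRing.isMonoidMorphism.Build R frob_alg frob_base
  frob_base_monoid_morphism.

End FrobeniusSubalgebra.

Lemma prime_exp_gt0 (p : nat) (p_pr : prime p) (e : nat) : (0 < p ^ e)%N.
Proof. by rewrite expn_gt0 prime_gt0. Qed.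

Section Extensions.
Variables (p : nat) (p_pr : prime p).
Variables (A C : comNzRingType) (f : {rmorphism A -> C}).

Definition finite_ext : Prop := fin_generated (restr_scalars f).

Definition has_exponent (e : nat) : Prop :=
  forall x : C, exists a : A, f a = x ^+ (p ^ e).

Definition finite_exponent : Prop := exists e, has_exponent e.

(* exp(C/A); the value is 0 when the exponent is not finite. *)
Definition ext_exponent : nat :=
  if pselect (exists e, `[< has_exponent e >]) is left ex then ex_minn ex else 0%N.

Lemma ext_exponentP : finite_exponent ->
  has_exponent ext_exponent /\ (forall e, has_exponent e -> (ext_exponent <= e)%N).
Proof.
rewrite /ext_exponent => -[e0 he0]; case: pselect => [ex|[]]; last first.
  by exists e0; apply/asboolP.
case: ex_minnP => m /asboolP hm min_m; split=> // e he.
by apply: min_m; apply/asboolP.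
Qed.

Definition F_extension : Prop :=
  [/\ injective f, finite_ext, finite_exponent
    & forall e, projective (restr_scalars (frob_incl f p e))].

(* C_P (x)_{A_P} A' is isomorphic, as an A'-algebra, to some                  *)
(* A'[X_1, ..., X_n] / <X_1 ^ p ^ e_1, ..., X_n ^ p ^ e_n> with all e_i > 0.  *)
Definition truncated_over (P : prime_idealr A) (A' : comNzRingType)
    (phi : {rmorphism localization (idfun : {rmorphism A -> A}) P -> A'}) : Prop :=
  exists (n : nat) (e : 'I_n -> nat)
         (psi : {rmorphism tensor_ring (loc_map f P) phi ->
                           trunc_mpoly A' (fun i => prime_exp_gt0 p_pr (e i))}),
    [/\ forall i, (0 < e i)%N, bijective psi
      & forall a, psi (tensor_inr (loc_map f P) phi a) = trunc_const _ a].

Definition purely_inseparable : Prop :=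
  [/\ injective f,
      finite_exponent,
      finite_ext /\ projective (restr_scalars f)
    & forall P : prime_idealr A,
        exists (A' : comNzRingType)
               (phi : {rmorphism localization (idfun : {rmorphism A -> A}) P -> A'}),
          faithfully_flat phi /\ truncated_over phi].

End Extensions.

Definition purely_inseparable_tower (p : nat) (p_pr : prime p)
    (A B C : comNzRingType)
    (iAB : {rmorphism A -> B}) (iBC : {rmorphism B -> C}) : Prop :=
  [/\ purely_inseparable p_pr (iBC \o iAB),
      purely_inseparable p_pr iAB
    & purely_inseparable p_pr iBC].

(* Main.v *)
(* At a prime P of A, reducing A' modulo a maximal ideal turns the faithfully   *)
(* flat splitting of A < C into a field K, a truncated polynomial algebra W     *)
(* over K and a map C -> W that identifies W with the fibre of C at P over K.   *)
(* Inside W, write B' for the image of B and D_e = B'[W^(p^e)].  The            *)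
(* hypotheses say that W is projective over every D_e and every D_e over its    *)
(* own Frobenius subalgebras K[D_e^(p^j)].  Since D_(e+1) contains D_e^p,       *)
(* everything reduces to extensions S < D < T of exponent one in which T has a  *)
(* p-basis over S and is projective over D: by Lech's lemma on independent      *)
(* sequences an element of D replaces a member of the p-basis, so D has a       *)
(* p-basis over S and T one over D.  Iterating, both K < B' and B' < W admit    *)
(* monomial bases in the images x_i of elements of B, resp. C, in which each    *)
(* x_i^(p^e_i) is a combination of monomials that are p^e_i-th powers.          *)
(* These coordinates descend to the localizations by a Nakayama argument, in    *)
(* which the projectivity of C supplies linear functionals, and a determinant   *)
(* trick.  Finally one adjoins the p^e_i-th roots of the coefficients in the    *)
(* formula for x_i^(p^e_i), a finite free extension, and subtracts the roots    *)
(* from x_i to obtain variables with x_i^(p^e_i) = 0.                           *)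

Require Import Defs.
From HB Require Import structures.
From mathcomp Require Import all_boot all_algebra.
From mathcomp Require Import boolp ring.
From mathcomp Require classical_sets.
From mathcomp Require Import freeg mpoly.

Set Implicit Arguments.
Unset Strict Implicit.
Unset Printing Implicit Defensive.

Import GRing.Theory.
Local Open Scope ring_scope.
Local Open Scope quotient_scope.

(** * Independent sequences *)

(** Suppose that, near a prime, an extension has elements x_i whose monomials with exponents below
    p^e_i form a basis, and that each x_i^(p^e_i) is a combination of p^e_i-th powers of such
    monomials. Adjoining the p^e_i-th roots of the coefficients allows each x_i to be corrected to a
    variable with p^e_i-th power zero, which is the required splitting ([splitting_extension],
    [local_splitting]). So the theorem amounts to finding such coordinates, called [normal_form],
    for A < B and for B < C.

    They are found in the fibre W = C (x)_A K at a prime of A ([fibre_exists]), a local K-algebra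
    with nilpotent maximal ideal m. The core is the case of exponent one: S < D < T with T^p in S, T
    having a p-basis over S and T projective over D. If D is not S, projectivity yields an
    S-derivation of D with value 1 at some y in m ([unit_derivation]), and this makes T / m_S T free
    over K[y]/(y^p). Now T / m_S T is K[X]/(X_i^p), and Lech's lemma on independent sequences
    excludes that y has order two or more there ([lech_order_two], [lech_pbasis]). Hence y can
    replace a member of the p-basis ([pbasis_replace]), and an induction gives p-bases of S < D and
    D < T ([exponent_one_intermediate]).

    Higher exponents reduce to this case because Frobenius filtrations interlace: K[T^(p^(e+1))] <
    K[D^(p^e)] < K[T^(p^e)] as soon as T^p lies in D ([frob_pbases_descend]). Walking down D_e =
    B'[W^(p^e)], where B' is the image of B, reaches B' itself ([frob_tower_pbases]); this is where
    the hypotheses on B[C^(p^e)] enter. Choosing the p-bases of successive levels among p-th powers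
    of the preceding ones gives the coordinates in the fibre ([tower_coordinates]). Generation and
    freeness are lifted to A_P by [local_descent] and [local_independence]. *)

Section Independence.
Variables (R : comNzRingType) (I : finType).

Definition in_ideal (f : I -> R) (a : R) : Prop :=
  exists c : I -> R, a = \sum_i c i * f i.

(** Independence in the sense of Lech: with I the ideal generated by the f_i, the classes of the f_i
    form a basis of I/I^2 over R/I. *)
Definition independent (f : I -> R) : Prop :=
  forall a : I -> R, \sum_i a i * f i = 0 -> forall i, in_ideal f (a i).

Lemma in_idealD f a b : in_ideal f a -> in_ideal f b -> in_ideal f (a + b).
Proof.
move=> [c ->] [d ->]; exists (fun i => c i + d i).
by rewrite -big_split; apply: eq_bigr => i _; rewrite mulrDl.
Qed.

Lemma in_idealMl f a b : in_ideal f b -> in_ideal f (a * b).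
Proof.
move=> [c ->]; exists (fun i => a * c i); rewrite mulr_sumr.
by apply: eq_bigr => i _; rewrite mulrA.
Qed.

Lemma in_ideal0 f : in_ideal f 0.
Proof. by exists (fun=> 0); rewrite big1 // => i _; rewrite mul0r. Qed.

Lemma in_ideal_sum f (J : Type) (r : seq J) (Q : pred J) (F : J -> R) :
  (forall j, Q j -> in_ideal f (F j)) -> in_ideal f (\sum_(j <- r | Q j) F j).
Proof.
move=> FQ; elim/big_ind: _ => //; first exact: in_ideal0.
exact: in_idealD.
Qed.

Lemma in_ideal_gen f i : in_ideal f (f i).
Proof.
exists (fun j => (j == i)%:R).
rewrite (bigD1 i) //= eqxx mul1r big1 ?addr0 // => j /negPf ->.
by rewrite mul0r.
Qed.

Lemma in_ideal_trans f g a :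
  (forall i, in_ideal g (f i)) -> in_ideal f a -> in_ideal g a.
Proof.
by move=> fg [c ->]; apply: in_ideal_sum => i _; apply: in_idealMl.
Qed.

Lemma eq_independent f g : f =1 g -> independent f -> independent g.
Proof.
move=> fg indf a; under eq_bigr => i _ do rewrite -fg.
move=> /indf H i; have [c ->] := H i; exists c.
by apply: eq_bigr => j _; rewrite fg.
Qed.

(** Lech's lemma. Multiplying a relation of the new family by h gives a relation of the old one, so
    the coefficient of g lies in (f). Substituting its expression back gives a second relation of
    the old family, from which the other coefficients are read off. *)
Lemma independent_factor (f : I -> R) (i0 : I) (g h : R) :
  independent f -> f i0 = g * h ->
  independent (fun i => if i == i0 then g else f i).
Proof.
set f' := fun i => _; move=> indf fi0 a a0.
have ff' i : in_ideal f' (f i).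
  have [->|ne] := eqVneq i i0.
    rewrite fi0 mulrC; apply: in_idealMl.
    by have := in_ideal_gen f' i0; rewrite /f' eqxx.
  by have := in_ideal_gen f' i; rewrite /f' (negPf ne).
have ind_f' b : in_ideal f b -> in_ideal f' b by apply: in_ideal_trans.
have a0' : a i0 * g + \sum_(i | i != i0) a i * f i = 0.
  rewrite -[RHS]a0 [in RHS](bigD1 i0) //= /f' eqxx; congr (_ + _).
  by apply: eq_bigr => i /negPf ->.
pose b i := if i == i0 then a i0 else h * a i.
have b0 : \sum_i b i * f i = 0.
  transitivity (h * (a i0 * g + \sum_(i | i != i0) a i * f i)).
    rewrite (bigD1 i0) //= /b eqxx fi0 mulrDr; congr (_ + _); first by ring.
    by rewrite mulr_sumr; apply: eq_bigr => i /negPf ->; ring.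
  by rewrite a0' mulr0.
have [c cE] : in_ideal f (a i0) by have := indf _ b0 i0; rewrite /b eqxx.
(* Coefficients of the second relation: the part c_i f_i g of the expanded term at i0 is absorbed in
   the i-th term. *)
pose d i := if i == i0 then c i0 * g else a i + c i * g.
have d0 : \sum_i d i * f i = 0.
  rewrite -[RHS]a0' cE (bigD1 i0) //= [in RHS](bigD1 i0) //= /d eqxx.
  rewrite mulrDl mulr_suml -addrA -big_split /=; congr (_ + _); first by ring.
  by apply: eq_bigr => i /negPf ->; ring.
move=> i; have [->|ne] := eqVneq i i0.
  by apply: ind_f'; exists c.
have := ind_f' _ (indf _ d0 i); rewrite /d (negPf ne) => H.
rewrite -[a i](addrK (c i * g)); apply: in_idealD => //.
rewrite -mulNr; apply: in_idealMl.
by have := in_ideal_gen f' i0; rewrite /f' eqxx.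
Qed.

End Independence.

(** * Polynomials modulo powers of the variables *)

Lemma mcoeffMX_eq0 (R : comNzRingType) n (g : {mpoly R[n]}) (m k : 'X_{1..n}) :
  ~~ (m <= k)%MM -> (g * 'X_[m])@_k = 0.
Proof.
move=> nle; apply: memN_msupp_eq0; rewrite (perm_mem (msuppMX g m)).
by apply: contra nle => /mapP[k' _ ->]; exact: lem_addr.
Qed.

Section TruncIdeal.
Variables (R : comNzRingType) (n : nat) (d : 'I_n -> nat).

Definition reduced (m : 'X_{1..n}) : bool := [forall i, (m i < d i)%N].

Lemma reducedP (m : 'X_{1..n}) : reflect (forall i, (m i < d i)%N) (reduced m).
Proof. exact: forallP. Qed.

(** The ideal is generated by monomials, so membership is decided monomial by monomial. *)
Lemma in_ideal_truncP (g : {mpoly R[n]}) :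
  in_ideal (fun i => 'X_i ^+ d i) g <-> (forall m : 'X_{1..n}, reduced m -> g@_m = 0).
Proof.
split=> [[c ->] m /reducedP redm|g0].
  rewrite raddf_sum /= big1 // => i _; rewrite mpolyXn mcoeffMX_eq0 //.
  apply/mnm_lepP => /(_ i).
  by rewrite mulmnE mnm1E eqxx mul1n leqNgt redm.
rewrite [g]mpolyE big_seq; apply: in_ideal_sum => m; rewrite mcoeff_msupp.
have [redm|] := boolP (reduced m); first by rewrite g0 ?eqxx.
rewrite negb_forall => /existsP[i]; rewrite -leqNgt => di _.
have lem : (U_(i) *+ d i <= m)%MM.
  apply/mnm_lepP => j; rewrite mulmnE mnm1E.
  by case: eqVneq => [<-|]; rewrite ?mul1n ?mul0n.
rewrite -(submK lem) mpolyXD -mpolyXn scalerAl; apply: in_idealMl.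
exact: in_ideal_gen.
Qed.

End TruncIdeal.

(** * Lech's argument for elements of order at least two *)

Section LechPolynomial.
Variables (p : nat) (K : fieldType) (n : nat).
Hypothesis charK : p \in [pchar K].

Let p_pr : prime p. Proof. exact: pcharf_prime charK. Qed.
Let p_gt0 : (0 < p)%N. Proof. exact: prime_gt0. Qed.

Local Notation P := {mpoly K[n]}.
Let Xp (i : 'I_n) : P := 'X_i ^+ p.

Lemma pchar_mpoly : p \in [pchar P].
Proof.
exact: (rmorph_pchar (@mpolyC n K : {rmorphism K -> P}) charK).
Qed.

Lemma mpoly_pexp (y : P) :
  y ^+ p = \sum_(m <- msupp y) y@_m ^+ p *: 'X_[m *+ p].
Proof.
rewrite -(pFrobenius_autE pchar_mpoly) {1}[y]mpolyE rmorph_sum /=.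
by apply: eq_bigr => m _; rewrite pFrobenius_autE exprZn mpolyXn.
Qed.

(** For m reduced, the monomial X_i^p m is divisible by no other X_j^p, so its coefficient in the
    relation is that of m in a_i. *)
Lemma reduced_pexp_independent (a : 'I_n -> P) :
  \sum_i a i * Xp i = 0 -> forall i, in_ideal Xp (a i).
Proof.
move=> a0 i; apply/in_ideal_truncP => m redm.
move/(congr1 (mcoeff (U_(i) *+ p + m)%MM)): a0.
rewrite raddf_sum /= mcoeff0 (bigD1 i) //= /Xp mpolyXn mcoeffMX.
rewrite big1 ?addr0 // => j ne_ji; rewrite mpolyXn mcoeffMX_eq0 //.
apply/mnm_lepP => /(_ j); rewrite mnmDE !mulmnE !mnm1E eqxx mul1n.
rewrite eq_sym (negPf ne_ji) mul0n add0n leqNgt.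
by have /reducedP -> := redm.
Qed.

(** Frobenius is additive, and every monomial of y is divisible by some X_i X_j, so its p-th power
    is X_i^p times a multiple of X_j^p. *)
Lemma pexp_decomposition (y : P) :
  (forall m : 'X_{1..n}, (mdeg m <= 1)%N -> y@_m = 0) ->
  exists h : 'I_n -> P,
    y ^+ p = \sum_i h i * Xp i /\ forall i, in_ideal Xp (h i).
Proof.
move=> y0; rewrite mpoly_pexp big_seq.
apply: (big_ind (fun z => exists h : 'I_n -> P,
    z = \sum_i h i * Xp i /\ forall i, in_ideal Xp (h i))).
- exists (fun=> 0); split=> [|i]; last exact: in_ideal0.
  by rewrite big1 // => i _; rewrite mul0r.
- move=> _ _ [h [-> Hh]] [k [-> Hk]]; exists (fun i => h i + k i); split.
    by rewrite -big_split; apply: eq_bigr => i _; rewrite mulrDl.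
  by move=> i; apply: in_idealD.
move=> m; rewrite mcoeff_msupp => ym.
have deg_m : (1 < mdeg m)%N by rewrite ltnNge; apply: contra ym => /y0 ->.
have [i mi] : exists i, m i != 0%N.
  apply/existsP; rewrite -negb_forall; apply: contraTN deg_m => /forallP m0.
  by rewrite mdegE big1 // => i _; apply/eqP.
have [j mj] : exists j, (m - U_(i))%MM j != 0%N.
  apply/existsP; rewrite -negb_forall; apply: contraTN deg_m => /forallP m0.
  rewrite -(@submK _ U_(i) m) ?lep1mP // mdegD mdeg1 -leqNgt addn1 ltnS.
  by rewrite mdegE big1 // => j _; apply/eqP.
have lemXp (k : 'I_n) (m' : 'X_{1..n}) : m' k != 0%N ->
    'X_[m' *+ p] = 'X_[(m' - U_(k)) *+ p] * Xp k :> P.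
  move=> m'k; rewrite /Xp mpolyXn -mpolyXD; congr 'X_[_].
  by apply/mnmP => l; rewrite mnmDE !mulmnE -mulnDl -mnmDE submK // lep1mP.
exists (fun l => if l == i then y@_m ^+ p *: 'X_[(m - U_(i)) *+ p] else 0).
split=> [|l].
  rewrite (bigD1 i) //= eqxx -scalerAl -lemXp // big1 ?addr0 // => l /negPf ->.
  by rewrite mul0r.
case: eqP => _; last exact: in_ideal0.
rewrite (lemXp j) // scalerAl; apply: in_idealMl; exact: in_ideal_gen.
Qed.

(* Freeness over K[y] modulo the X_i^p makes (X_1^p, ..., X_n^p, y)           *)
(* independent, hence (X_1, ..., X_n, y) independent; but y lies in (X_i).    *)
Lemma lech_order_two (y : P) :
  (forall m : 'X_{1..n}, (mdeg m <= 1)%N -> y@_m = 0) ->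
  ~ (forall g, in_ideal Xp (g * y) ->
       exists t, in_ideal Xp (g - y ^+ p.-1 * t)).
Proof.
move=> y0 freey.
have [h [yE hX]] := pexp_decomposition y0.
(* Interpolates between (X_1^p, ..., X_n^p, y) for D empty and (X_1, ..., X_n, y) for D full;
   [independent_factor] moves one index at a time into D. *)
pose f (D : {set 'I_n}) (o : option 'I_n) : P :=
  if o is Some i then (if i \in D then 'X_i else Xp i) else y.
have Xf D i : in_ideal (f D) (Xp i).
  have H : in_ideal (f D) (if i \in D then 'X_i else Xp i).
    exact: in_ideal_gen (f D) (Some i).
  case: ifP H => // _ H.
  have -> : Xp i = 'X_i ^+ p.-1 * 'X_i by rewrite -exprSr prednK.
  exact: in_idealMl.
have sumo D (a : option 'I_n -> P) :
    \sum_o a o * f D o = a None * y + \sum_i a (Some i) * f D (Some i).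
  rewrite (bigD1 None) //=; congr (_ + _).
  rewrite (reindex_omap Some id) => [|[]//].
  by apply: eq_bigl => i; rewrite eqxx.
have idXf g : in_ideal Xp g -> in_ideal (f set0) g.
  case=> c ->; apply: in_ideal_sum => i _; apply: in_idealMl; exact: Xf.
(* In a relation the coefficient of y annihilates y modulo (X_i^p), so it is y^(p-1) t modulo that
   ideal. Since y^p is itself a combination of the X_i^p with coefficients in the ideal, the
   independence of the X_i^p settles what remains. *)
have ind0 : independent (f set0).
  move=> a a0; move: (a0); rewrite sumo => a0'.
  have aX : in_ideal Xp (a None * y).
    move/eqP: a0'; rewrite addr_eq0 => /eqP ->.
    exists (fun i => - a (Some i)); rewrite -sumrN.
    by apply: eq_bigr => i _; rewrite /f inE mulNr.
  have [t [c tE]] := freey _ aX.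
  have aN : a None = y ^+ p.-1 * t + \sum_i c i * Xp i by rewrite -tE addrC subrK.
  have a1 : \sum_i (a (Some i) + t * h i + c i * y) * Xp i = 0.
    rewrite -[RHS]a0' aN mulrDl -[y ^+ _ * t]mulrC -mulrA -exprSr prednK // yE.
    rewrite mulr_sumr mulr_suml -!big_split /=; apply: eq_bigr => i _.
    by rewrite /f inE; ring.
  have aS i : in_ideal (f set0) (a (Some i)).
    have := idXf _ (reduced_pexp_independent a1 i) => H.
    have -> : a (Some i) = (a (Some i) + t * h i + c i * y) +
                           ((- t) * h i + (- c i) * y) by ring.
    apply: in_idealD => //; apply: in_idealD; apply: in_idealMl.
      exact: idXf.
    exact: in_ideal_gen (f set0) None.
  case=> [i|] //; rewrite aN; apply: in_idealD.
    rewrite mulrC; apply: in_idealMl; rewrite -(prednK (n := p.-1)).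
      rewrite exprSr; apply: in_idealMl; exact: in_ideal_gen (f set0) None.
    by rewrite -subn1 subn_gt0 prime_gt1.
  by apply: in_ideal_sum => i _; apply: in_idealMl; exact: Xf.
have indD (s : seq 'I_n) : independent (f [set i in s]).
  elim: s => [|i s IHs].
    by apply: eq_independent ind0 => -[i|] //; rewrite /f !inE.
  have [is_s|nis] := boolP (i \in s).
    apply: eq_independent IHs => -[j|] //; rewrite /f !inE.
    by have [->|//] := eqVneq j i; rewrite is_s.
  have fi : f [set j in s] (Some i) = 'X_i * 'X_i ^+ p.-1.
    by rewrite /f inE (negPf nis) -exprS prednK.
  apply: eq_independent (independent_factor IHs fi) => -[j|] //.
  rewrite /f !inE (inj_eq (@Some_inj _)).
  by case: eqVneq => [->|].
have := indD (enum 'I_n).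
set g := f _ => indg.
have gS i : g (Some i) = 'X_i by rewrite /g /f inE mem_enum.
have g0 o : (g o)@_0%MM = 0.
  case: o => [i|]; last by rewrite y0 ?mdeg0.
  by rewrite gS mcoeffX; case: eqP => // /(congr1 mdeg); rewrite mdeg1 mdeg0.
have [c cE] : exists c : 'I_n -> P, y = \sum_i c i * 'X_i.
  have : in_ideal (fun i : 'I_n => 'X_i ^+ 1 : P) y.
    apply/in_ideal_truncP => m /reducedP m0; apply: y0.
    rewrite mdegE big1 // => i _; apply/eqP.
    by rewrite -leqn0 -ltnS.
  by case=> c ->; exists c.
(* The relation y - sum_i c_i X_i = 0 has a coefficient 1, which would have to lie in an ideal of
   polynomials without constant term. *)
pose a o : P := if o is Some i then - c i else 1.
have a0 : \sum_o a o * g o = 0.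
  rewrite sumo -/g; under eq_bigr => i _ do rewrite gS /a mulNr.
  by rewrite sumrN -cE /a mul1r subrr.
have [e /(congr1 (mcoeff 0%MM))] := indg _ a0 None.
rewrite mcoeff1 eqxx raddf_sum /= big1 => [/eqP|o _]; first by rewrite oner_eq0.
by rewrite (rmorphM (mcoeff 0%MM)) /= g0 mulr0.
Qed.

End LechPolynomial.

(** * Fibre algebras *)

Lemma pexpD_pchar (R : comNzRingType) p e (x y : R) : p \in [pchar R] ->
  (x + y) ^+ (p ^ e) = x ^+ (p ^ e) + y ^+ (p ^ e).
Proof.
move=> chR; elim: e => [|e IHe] //; rewrite expnSr !exprM IHe.
by rewrite -!(pFrobenius_autE chR) rmorphD.
Qed.

Lemma pexp_sum_pchar (R : comNzRingType) p e (J : Type) (r : seq J) (Q : pred J)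
    (E : J -> R) : p \in [pchar R] ->
  (\sum_(j <- r | Q j) E j) ^+ (p ^ e) = \sum_(j <- r | Q j) E j ^+ (p ^ e).
Proof.
move=> chR; elim/big_rec2: _ => [|j x y _ <-]; last by rewrite pexpD_pchar.
by rewrite expr0n gtn_eqF // expn_gt0 prime_gt0 ?(pcharf_prime chR).
Qed.

Section AdditiveClosure.
Variable V : zmodType.
Implicit Types (G H : V -> Prop) (u v : V).

(** Spans are encoded throughout as additive closures of products of a coefficient and an element,
    so that statements about them are proved by induction. Closure under opposites is left to the
    generators. *)
Inductive addcl G : V -> Prop :=
| addcl0 : addcl G 0
| addclS u v : G u -> addcl G v -> addcl G (u + v).

Lemma addcl_gen G u : G u -> addcl G u.
Proof. by move=> Gu; rewrite -[u]addr0; apply: addclS => //; exact: addcl0. Qed.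

Lemma addclD G u v : addcl G u -> addcl G v -> addcl G (u + v).
Proof.
by move=> + Hv; elim=> [|x y Gx _ IH]; rewrite ?add0r // -addrA; apply: addclS.
Qed.

Lemma addcl_sum G (J : Type) (r : seq J) (Q : pred J) (E : J -> V) :
  (forall j, Q j -> addcl G (E j)) -> addcl G (\sum_(j <- r | Q j) E j).
Proof.
by move=> GE; elim/big_ind: _ => //; [exact: addcl0 | exact: addclD].
Qed.

Lemma addcl_least G H u :
  H 0 -> (forall x y, H x -> H y -> H (x + y)) -> (forall x, G x -> H x) ->
  addcl G u -> H u.
Proof. by move=> H0 HD GH; elim=> // x y /GH Hx _; exact: HD. Qed.

Lemma addcl_mono G H u : (forall x, G x -> H x) -> addcl G u -> addcl H u.
Proof.
move=> GH; apply: addcl_least; [exact: addcl0 | exact: addclD |].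
by move=> x /GH; exact: addcl_gen.
Qed.

End AdditiveClosure.

Lemma addcl_map (U V : zmodType) (G : U -> Prop) (H : V -> Prop) (f : U -> V) u :
  f 0 = 0 -> (forall x y, addcl G x -> addcl G y -> f (x + y) = f x + f y) ->
  (forall x, G x -> addcl H (f x)) -> addcl G u -> addcl H (f u).
Proof.
move=> f0 fD GH; elim=> [|x y Gx Hy IH]; first by rewrite f0; exact: addcl0.
rewrite fD //; last exact: addcl_gen.
by apply: addclD => //; exact: GH.
Qed.

(* Models the fibre K[X_1, ..., X_n] / <X_i ^ p ^ e_i> at a prime: only the      *)
(* augmentation eps and the nilpotence of its kernel matter.                   *)
Record fibre_alg (p : nat) := FibreAlg {
  fa_field : fieldType;
  fa_ring :> comNzRingType;
  iota : {rmorphism fa_field -> fa_ring};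
  eps : {rmorphism fa_ring -> fa_field};
  fa_char : p \in [pchar fa_field];
  iotaK : forall k, eps (iota k) = k;
  fa_nil : nat;
  fa_nilP : forall s : seq fa_ring, size s = fa_nil ->
    (forall w, w \in s -> eps w = 0) -> \prod_(w <- s) w = 0 }.

Section Subalgebras.
Variables (p : nat) (W : fibre_alg p).
Local Notation K := (fa_field W).
Local Notation iota := (iota W).
Local Notation eps := (eps W).

Lemma pchar_fa : p \in [pchar W].
Proof. exact: (rmorph_pchar iota (fa_char W)). Qed.

Lemma fa_prime : prime p.
Proof. exact: pcharf_prime (fa_char W). Qed.

(** Subalgebras are predicates on the fixed ring W rather than types, so that inclusions, p-th
    powers and derivations need no transport. *)
Record subalg := Subalg {
  sa :> W -> Prop;
  sa_iota : forall k, sa (iota k);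
  saD : forall x y, sa x -> sa y -> sa (x + y);
  saM : forall x y, sa x -> sa y -> sa (x * y) }.

Implicit Types (S T D U : subalg) (x y z w : W).

Definition sub_sa (P Q : W -> Prop) := forall w, P w -> Q w.

Lemma sa0 S : S 0. Proof. by rewrite -(rmorph0 iota); exact: sa_iota. Qed.
Lemma sa1 S : S 1. Proof. by rewrite -(rmorph1 iota); exact: sa_iota. Qed.

Lemma saN S x : S x -> S (- x).
Proof.
by move=> Sx; rewrite -mulN1r -(rmorphN1 iota); apply: saM => //; exact: sa_iota.
Qed.

Lemma saB S x y : S x -> S y -> S (x - y).
Proof. by move=> Sx Sy; apply: saD => //; exact: saN. Qed.

Lemma saX S x n : S x -> S (x ^+ n).
Proof.
by move=> Sx; elim: n => [|n IHn]; rewrite ?expr0 ?exprS; [exact: sa1 | exact: saM].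
Qed.

Lemma sa_nat S n : S n%:R.
Proof.
by elim: n => [|n IHn]; [exact: sa0 | rewrite -addn1 natrD; apply: saD => //; exact: sa1].
Qed.

Lemma sa_sum S (J : Type) (r : seq J) (Q : pred J) (E : J -> W) :
  (forall j, Q j -> S (E j)) -> S (\sum_(j <- r | Q j) E j).
Proof. by move=> SE; elim/big_ind: _ => //; [exact: sa0 | exact: saD]. Qed.

Lemma sa_prod S (J : Type) (r : seq J) (Q : pred J) (E : J -> W) :
  (forall j, Q j -> S (E j)) -> S (\prod_(j <- r | Q j) E j).
Proof. by move=> SE; elim/big_ind: _ => //; [exact: sa1 | exact: saM]. Qed.

Lemma eps_shift w : eps (w - iota (eps w)) = 0.
Proof. by rewrite rmorphB /= iotaK subrr. Qed.

Lemma sa_shift S w : S w -> S (w - iota (eps w)).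
Proof. by move=> Sw; apply: saB => //; exact: sa_iota. Qed.

Lemma nil_exp w : eps w = 0 -> w ^+ fa_nil W = 0.
Proof.
move=> w0; have := @fa_nilP _ W (nseq (fa_nil W) w); rewrite size_nseq => /(_ erefl).
rewrite big_nseq => <-; last by move=> v /nseqP[->].
by elim: (fa_nil W) => //= n <-; rewrite exprS.
Qed.

Lemma pexpD e x y : (x + y) ^+ (p ^ e) = x ^+ (p ^ e) + y ^+ (p ^ e).
Proof. exact: pexpD_pchar pchar_fa. Qed.

Lemma pexp_sum e (J : Type) (r : seq J) (Q : pred J) (E : J -> W) :
  (\sum_(j <- r | Q j) E j) ^+ (p ^ e) = \sum_(j <- r | Q j) E j ^+ (p ^ e).
Proof. exact: pexp_sum_pchar pchar_fa. Qed.

(** The nilpotency bound itself serves as e, since p^e > e makes the p^e-th power of w - eps w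
    vanish. *)
Lemma fa_exponent : exists e, forall w, w ^+ (p ^ e) = iota (eps w ^+ (p ^ e)).
Proof.
exists (fa_nil W) => w; rewrite -[w in LHS](subrK (iota (eps w))) pexpD.
rewrite rmorphXn /= -(subnKC (ltnW (ltn_expl (fa_nil W) (prime_gt1 fa_prime)))).
by rewrite exprD nil_exp ?eps_shift // mul0r add0r.
Qed.

(** Some power of u is a nonzero scalar, so the inverse of u is a scalar multiple of a power of u
    and stays in S. Thus every subalgebra is local. *)
Lemma sa_inv S u : S u -> eps u != 0 -> exists2 v, S v & u * v = 1.
Proof.
have [e eE] := fa_exponent; move=> Su u0.
exists (u ^+ (p ^ e).-1 * iota (eps u ^- (p ^ e))).
  by apply: saM; [exact: saX | exact: sa_iota].
rewrite mulrA -exprS prednK ?expn_gt0 ?prime_gt0 ?fa_prime // eE -rmorphM.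
by rewrite mulfV ?expf_neq0 // rmorph1.
Qed.

Section Adjunction.
Variables (S : subalg) (Z : W -> Prop).

Inductive adj : W -> Prop :=
| adj_base s : S s -> adj s
| adj_gen z : Z z -> adj z
| adjD x y : adj x -> adj y -> adj (x + y)
| adjM x y : adj x -> adj y -> adj (x * y).

Definition adj_sa : subalg :=
  Subalg (fun k => adj_base (sa_iota S k)) adjD adjM.

Lemma adj_least T : sub_sa S T -> sub_sa Z T -> sub_sa adj T.
Proof.
move=> ST ZT w; elim=> [s /ST|z /ZT|x y _ ? _ ?|x y _ ? _ ?] //.
  exact: saD.
exact: saM.
Qed.

End Adjunction.

(* m_S T *)
Definition mulid (S T : W -> Prop) : W -> Prop :=
  addcl (fun w => exists s t, [/\ S s, eps s = 0, T t & w = s * t]).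

Lemma mulid_gen (S T : W -> Prop) s t :
  S s -> eps s = 0 -> T t -> mulid S T (s * t).
Proof. by move=> Ss s0 Tt; apply: addcl_gen; exists s, t. Qed.

Lemma mulidMl S T t w : T t -> mulid S T w -> mulid S T (t * w).
Proof.
move=> Tt; elim=> [|_ v [s [t' [Ss s0 Tt' ->]]] _ IH].
  by rewrite mulr0; exact: addcl0.
rewrite mulrDr mulrCA; apply: addclD => //; apply: mulid_gen => //; exact: saM.
Qed.

Lemma mulid_sub S T : sub_sa S T -> sub_sa (mulid S T) T.
Proof.
move=> ST w; apply: addcl_least; first exact: sa0.
  exact: saD.
by move=> _ [s [t [Ss _ Tt ->]]]; apply: saM => //; exact: ST.
Qed.

Lemma mulid_eps (P Q : W -> Prop) w : mulid P Q w -> eps w = 0.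
Proof.
apply: (@addcl_least _ _ (fun w => eps w = 0)) => [|x y x0 y0|_ [s [t [_ s0 _ ->]]]].
- by rewrite rmorph0.
- by rewrite rmorphD /= x0 y0 addr0.
- by rewrite rmorphM /= s0 mul0r.
Qed.

Lemma mulidN S T w : mulid S T w -> mulid S T (- w).
Proof.
by move=> H; rewrite -mulN1r; apply: mulidMl => //; apply: saN; exact: sa1.
Qed.

Lemma mulidB S T v w : mulid S T v -> mulid S T w -> mulid S T (v - w).
Proof. by move=> Hv Hw; apply: addclD => //; exact: mulidN. Qed.

Lemma mulid_base S T s : S s -> eps s = 0 -> mulid S T s.
Proof. by move=> Ss s0; rewrite -[s]mulr1; apply: mulid_gen => //; exact: sa1. Qed.

(** Nakayama's lemma for a nilpotent ideal: iterating D = S + m_S D gives D = S + m_S^k D for all k,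
    and m_S^k = 0 for large k. *)
Lemma sub_of_mulid S D : sub_sa S D ->
  (forall d, D d -> exists2 s, S s & mulid S D (d - s)) -> sub_sa D S.
Proof.
move=> SD H.
pose pw k := addcl (fun w : W => exists (l : seq W) d,
  [/\ size l = k, forall x, x \in l -> S x /\ eps x = 0, D d
    & w = \prod_(x <- l) x * d]).
have step k w : pw k w -> exists2 s, S s & pw k.+1 (w - s).
  elim=> [|_ v [l [d [szl lS Dd ->]]] _ [s Ss Hs]].
    by exists 0; rewrite ?subr0; [exact: sa0 | exact: addcl0].
  have [s' Ss' Hs'] := H d Dd.
  exists (\prod_(x <- l) x * s' + s).
    apply: saD => //; apply: saM => //; rewrite big_seq.
    by apply: sa_prod => x /lS[].
  rewrite opprD addrACA -mulrBr; apply: addclD => //.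
  elim: Hs' => [|_ y [x [t [Sx x0 Dt ->]]] _ IH].
    by rewrite mulr0; exact: addcl0.
  rewrite mulrDr; apply: addclD => //; apply: addcl_gen.
  exists (x :: l), t; split=> //=; first by rewrite szl.
    by move=> z; rewrite inE => /orP[/eqP -> //|/lS].
  by rewrite big_cons; ring.
move=> d Dd.
have [s Ss] : exists2 s, S s & pw (fa_nil W) (d - s).
  elim: (fa_nil W) => [|k [s Ss /step[s' Ss' Hs']]].
    exists 0; first exact: sa0.
    rewrite subr0; apply: addcl_gen; exists [::], d; split=> //.
    by rewrite big_nil mul1r.
  by exists (s + s'); [exact: saD | rewrite opprD addrA].
move=> Hs; suff: d - s = 0 by move/eqP; rewrite subr_eq0 => /eqP ->.
elim: Hs => // _ v [l [t [szl lS _ ->]]] _ ->.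
rewrite (fa_nilP szl) ?mul0r ?addr0 // => x; by case/lS.
Qed.

(* m_T ^ k *)
Definition powid (T : subalg) (k : nat) : W -> Prop :=
  addcl (fun w => exists l : seq W,
    [/\ size l = k, forall x, x \in l -> T x /\ eps x = 0
      & w = \prod_(x <- l) x]).

Lemma powid_gen1 T x : T x -> eps x = 0 -> powid T 1 x.
Proof.
move=> Tx x0; apply: addcl_gen; exists [:: x]; split=> //.
  by move=> z; rewrite inE => /eqP ->.
by rewrite big_seq1.
Qed.

Lemma powidM T i j x y : powid T i x -> powid T j y -> powid T (i + j) (x * y).
Proof.
move=> + Hy; elim=> [|_ v [l [szl lT ->]] _ IH].
  by rewrite mul0r; exact: addcl0.
rewrite mulrDl; apply: addclD => //; elim: Hy => [|_ z [l' [szl' lT' ->]] _ IHz].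
  by rewrite mulr0; exact: addcl0.
rewrite mulrDr; apply: addclD => //; apply: addcl_gen; exists (l ++ l').
split; first by rewrite size_cat szl szl'.
  by move=> w; rewrite mem_cat => /orP[/lT|/lT'].
by rewrite big_cat.
Qed.

Lemma powid_gt0 T k x : (0 < k)%N -> powid T k x -> T x /\ eps x = 0.
Proof.
move=> k0; elim=> [|_ v [[|z l] [szl lT ->]] _ [Tv v0]].
- by rewrite rmorph0; split=> //; exact: sa0.
- by rewrite -szl in k0.
rewrite big_cons; have [Tz z0] := lT z (mem_head _ _).
split; last by rewrite rmorphD rmorphM /= z0 v0 mul0r addr0.
apply: saD => //; apply: saM => //; rewrite big_seq; apply: sa_prod => w wl.
by case: (lT w) => //; rewrite inE wl orbT.
Qed.

(** A subalgebra that maps onto m_T / m_T^2 maps onto every m_T^k / m_T^(k+1), and m_T is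
    nilpotent. *)
Lemma sub_of_powid T0 T : sub_sa T0 T ->
  (forall t, T t -> eps t = 0 -> exists2 t0, T0 t0 & powid T 2 (t - t0)) ->
  sub_sa T T0.
Proof.
move=> T0T H.
have prodP (l : seq W) : (0 < size l)%N ->
    (forall x, x \in l -> T x /\ eps x = 0) ->
    exists2 a, T0 a & powid T (size l).+1 (\prod_(x <- l) x - a).
  elim: l => // t [|t' l] IHl _ lT; have [Tt t0] := lT t (mem_head _ _).
    by rewrite big_seq1; apply: H.
  have [//|x xl|a' T0a' Hr'] := IHl; first by apply: lT; rewrite inE xl orbT.
  have [a T0a Hr] := H t Tt t0; exists (a * a'); first exact: saM.
  have [_ r0] := powid_gt0 (ltn0Sn 1) Hr.
  rewrite big_cons; set q := \prod_(_ <- _) _ in Hr' *.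
  have -> : t * q - a * a' = a * (q - a') + (t - a) * q by ring.
  apply: addclD.
    apply: (powidM (i := 1)) => //; apply: powid_gen1; first exact: T0T.
    by move: r0; rewrite rmorphB /= t0 sub0r => /eqP; rewrite oppr_eq0 => /eqP.
  apply: (powidM (i := 2)) => //; apply: addcl_gen; exists (t' :: l); split=> //.
  by move=> x xl; apply: lT; rewrite inE xl orbT.
have step k w : powid T k.+1 w -> exists2 a, T0 a & powid T k.+2 (w - a).
  elim=> [|_ v [l [szl lT ->]] _ [b T0b Hb]].
    by exists 0; rewrite ?subr0; [exact: sa0 | exact: addcl0].
  have [|a T0a Ha] := prodP l _ lT; first by rewrite szl.
  rewrite szl in Ha; exists (a + b); first exact: saD.
  by rewrite opprD addrACA; apply: addclD.
move=> t Tt; suff Tm u : T u -> eps u = 0 -> T0 u.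
  rewrite -[t](subrK (iota (eps t))); apply: saD; last exact: sa_iota.
  by apply: Tm; rewrite ?eps_shift //; exact: sa_shift.
move=> Tu u0.
have [a T0a] : exists2 a, T0 a & powid T (fa_nil W).+1 (u - a).
  elim: (fa_nil W) => [|k [a T0a /step[b T0b Hb]]].
    exists 0; first exact: sa0.
    by rewrite subr0; exact: powid_gen1.
  by exists (a + b); [exact: saD | rewrite opprD addrA].
move=> Ha; suff: u - a = 0 by move/eqP; rewrite subr_eq0 => /eqP ->.
elim: Ha => // _ v [[|z l] [szl lT ->]] _ -> //; rewrite addr0 big_cons.
have szl' : size l = fa_nil W by case: szl.
rewrite (fa_nilP szl') ?mulr0 // => x xl.
by case: (lT x) => //; rewrite inE xl orbT.
Qed.

End Subalgebras.

Arguments sub_sa {p W} P Q.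

(** * p-bases *)

Lemma mpoly_ring_ind (R : comNzRingType) n (Q : {mpoly R[n]} -> Prop) :
  (forall c, Q c%:MP) -> (forall i, Q 'X_i) ->
  (forall g h, Q g -> Q h -> Q (g + h)) -> (forall g h, Q g -> Q h -> Q (g * h)) ->
  forall g, Q g.
Proof.
move=> QC QX QD QM g; rewrite [g]mpolyE; 
  apply: (big_ind Q) => [||m _]; [by rewrite -mpolyC0|exact: QD|].
rewrite -mul_mpolyC; apply: (QM) => //; rewrite mpolyXE_id.
apply: (big_ind Q) => [||i _]; [by rewrite -mpolyC1|exact: QM|].
elim: (m i) => [|k IHk]; first by rewrite expr0 -mpolyC1; exact: QC.
by rewrite exprS; exact: QM.
Qed.

Lemma fact_natr_neq0 p (R : fieldType) k :
  p \in [pchar R] -> (k < p)%N -> (k`!)%:R != 0 :> R.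
Proof.
move=> chR; rewrite -(dvdn_pcharf chR); elim: k => [|k IHk] ltkp.
  by rewrite fact0 dvdn1 neq_ltn prime_gt1 ?orbT // (pcharf_prime chR).
rewrite factS Euclid_dvdM ?(pcharf_prime chR) // negb_or (IHk (ltnW ltkp)).
by rewrite gtnNdvd.
Qed.

Section PBases.
Variables (p : nat) (W : fibre_alg p).
Local Notation K := (fa_field W).
Local Notation iota := (iota W).
Local Notation eps := (eps W).
Local Notation subalg := (subalg W).
Implicit Types (S T D U : subalg) (x y z w : W).

(** The map d is a function on all of W, but it is constrained on T only. *)
Definition deriv (T : subalg) (d : W -> W) : Prop :=
  [/\ forall a, T a -> T (d a),
      forall a b, T a -> T b -> d (a + b) = d a + d b
    & forall a b, T a -> T b -> d (a * b) = d a * b + a * d b].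

Definition dual_deriv (S T : subalg) n (x : 'I_n -> W) (d : 'I_n -> W -> W) :=
  [/\ forall i, deriv T (d i), forall i s, S s -> d i s = 0
    & forall i j, d i (x j) = (i == j)%:R].

Definition family n (x : 'I_n -> W) : W -> Prop := fun w => exists i, w = x i.

(** The dual derivations take the place of the usual requirement that the monomials with exponents
    below p be linearly independent over S, which [pbasis_independent] recovers. Derivations are
    what the exchange arguments manipulate. *)
Definition pbasis (S T : subalg) n (x : 'I_n -> W) : Prop :=
  [/\ sub_sa S T, forall i, T (x i), forall t, T t -> S (t ^+ p),
      sub_sa T (adj S (family x)) & exists d, dual_deriv S T x d].

Section Derivations.
Variables (S T : subalg) (d : W -> W).
Hypotheses (dT : deriv T d) (dS : forall s, S s -> d s = 0).

Lemma deriv0 : d 0 = 0. Proof. by apply: dS; exact: sa0. Qed.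

Lemma derivN a : T a -> d (- a) = - d a.
Proof.
move=> Ta; have [_ dD _] := dT; apply/eqP; rewrite -addr_eq0 -dD ?addNr ?deriv0 //.
exact: saN.
Qed.

Lemma derivB a b : T a -> T b -> d (a - b) = d a - d b.
Proof.
by move=> Ta Tb; have [_ dD _] := dT; rewrite dD ?derivN //; exact: saN.
Qed.

Lemma derivZ s a : sub_sa S T -> S s -> T a -> d (s * a) = s * d a.
Proof.
move=> ST Ss Ta; have [_ _ dM] := dT.
by rewrite dM ?(dS Ss) ?mul0r ?add0r //; exact: ST.
Qed.

Lemma deriv_mulid U w : sub_sa S T -> sub_sa S U -> sub_sa U T ->
  (forall a, U a -> mulid U T (d a)) -> mulid U T w -> mulid U T (d w).
Proof.
move=> ST SU UT dU; have [Td dD dM] := dT.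
apply: addcl_map => [|a b Ha Hb|_ [s [t [Us s0 Tt ->]]]].
- exact: deriv0.
- by rewrite dD //; exact: (mulid_sub UT).
rewrite dM //; last exact: UT.
apply: addclD; last by apply: mulid_gen => //; exact: Td.
by rewrite mulrC; apply: mulidMl => //; exact: dU.
Qed.

Lemma deriv_mulid_base w : sub_sa S T -> mulid S T w -> mulid S T (d w).
Proof.
move=> ST; apply: deriv_mulid => // a Sa; rewrite dS //; exact: addcl0.
Qed.

End Derivations.

Section Coordinates.
Variables (S T : subalg) (n : nat) (x : 'I_n -> W) (d : 'I_n -> W -> W).
Hypotheses (ST : sub_sa S T) (Tx : forall i, T (x i)).
Hypothesis TpS : forall t, T t -> S (t ^+ p).
Hypothesis genT : sub_sa T (adj S (family x)).
Hypothesis dual_d : dual_deriv S T x d.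

Definition ev (g : {mpoly K[n]}) : W := mmap iota x g.

Let dT i : deriv T (d i). Proof. by case: dual_d. Qed.
Let dS i s : S s -> d i s = 0. Proof. by case: dual_d => _ H _; exact: H. Qed.

Lemma evD g h : ev (g + h) = ev g + ev h. Proof. exact: rmorphD. Qed.
Lemma evB g h : ev (g - h) = ev g - ev h. Proof. exact: rmorphB. Qed.
Lemma evM g h : ev (g * h) = ev g * ev h. Proof. exact: rmorphM. Qed.
Lemma evE g k : ev (g ^+ k) = ev g ^+ k. Proof. exact: rmorphXn. Qed.
Lemma evC c : ev c%:MP = iota c. Proof. by rewrite /ev mmapC. Qed.
Lemma evX i : ev 'X_i = x i. Proof. by rewrite /ev mmapX mmap1U. Qed.

Lemma ev_sa g : T (ev g).
Proof.
elim/mpoly_ring_ind: g => [c|i|g h Tg Th|g h Tg Th].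
- by rewrite evC; exact: sa_iota.
- by rewrite evX.
- by rewrite evD; exact: saD.
- by rewrite evM; exact: saM.
Qed.

Lemma deriv_ev i g : d i (ev g) = ev g^`M(i).
Proof.
have [_ dD dM] := dT i; case: dual_d => _ _ dx.
elim/mpoly_ring_ind: g => [c|j|g h IHg IHh|g h IHg IHh].
- by rewrite evC dS ?mderivC -?(mpolyC0 n K) ?evC ?rmorph0 //; exact: sa_iota.
- rewrite evX dx mderivX mnm1E eq_sym; case: eqP => [->|_].
    have -> : (U_(i) - U_(i))%MM = 0%MM :> 'X_{1..n}.
      by apply/mnmP => k; rewrite mnmBE subnn mnm0E.
    by rewrite scale1r mpolyX0 -(mpolyC1 n K) evC (rmorph1 iota).
  by rewrite scale0r -(mpolyC0 n K) evC (rmorph0 iota).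
- by rewrite evD mderivD evD -IHg -IHh dD //; exact: ev_sa.
- by rewrite evM mderivM evD !evM -IHg -IHh dM //; exact: ev_sa.
Qed.

(** Because T = S[x] and S = K + m_S, every element of T is a polynomial in x over K modulo m_S
    T. *)
Lemma ev_dense t : T t -> exists g, mulid S T (t - ev g).
Proof.
move=> Tt; have At := genT Tt; elim: At => {t Tt}[s Ss|_ [i ->]|t u At IHt Au IHu|t u At IHt Au IHu].
- exists (eps s)%:MP; rewrite evC; apply: mulid_base; last exact: eps_shift.
  exact: sa_shift.
- by exists 'X_i; rewrite evX subrr; exact: addcl0.
- have [[g Hg] [h Hh]] := (IHt, IHu); exists (g + h).
  by rewrite evD opprD addrACA; apply: addclD.
have [[g Hg] [h Hh]] := (IHt, IHu); exists (g * h); rewrite evM.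
have -> : t * u - ev g * ev h = ev h * (t - ev g) + t * (u - ev h) by ring.
apply: addclD; apply: mulidMl => //; first exact: ev_sa.
by apply: (adj_least ST) At => _ [i ->].
Qed.

Hypothesis x0 : forall i, eps (x i) = 0.

Lemma eps_ev g : eps (ev g) = g@_0%MM.
Proof.
elim/mpoly_ring_ind: g => [c|i|g h IHg IHh|g h IHg IHh].
- by rewrite evC iotaK mcoeffC eqxx mulr1.
- by rewrite evX x0 mcoeffX; case: eqP => // /(congr1 mdeg); rewrite mdeg1 mdeg0.
- by rewrite evD rmorphD /= IHg IHh mcoeffD.
- by rewrite evM rmorphM /= IHg IHh (rmorphM (mcoeff 0%MM)).
Qed.

(** Differentiating to the order m and taking the augmentation isolates m! g_m, and m! is invertible
    when all exponents are below p. *)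
Lemma stable_ev_coef (Q : W -> Prop) g :
  (forall i w, Q w -> Q (d i w)) -> (forall w, Q w -> eps w = 0) ->
  Q (ev g) -> forall m, reduced (fun=> p) m -> g@_m = 0.
Proof.
move=> Qd Q0 Qg m /reducedP redm.
have : Q (ev g^`M[m]).
  rewrite mderivm_foldr; elim: (flatten _) => //= i s IHs.
  by rewrite -deriv_ev; exact: Qd.
move/Q0; rewrite eps_ev mcoeff_mderivm addm0 -mulr_natr => /eqP.
rewrite mulf_eq0 => /orP[/eqP //|]; rewrite natr_prod => /prodf_eq0[i _].
by rewrite ffactnn (negPf (fact_natr_neq0 (fa_char W) (redm i))).
Qed.

Lemma mulid_ev_coef g :
  mulid S T (ev g) -> forall m, reduced (fun=> p) m -> g@_m = 0.
Proof.
apply: stable_ev_coef => [i w|w]; last exact: mulid_eps.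
exact: (deriv_mulid_base (dT i) (@dS i) ST).
Qed.

Lemma mulid_ev g : (forall m, reduced (fun=> p) m -> g@_m = 0) -> mulid S T (ev g).
Proof.
move=> /in_ideal_truncP[c ->]; rewrite /ev rmorph_sum /=.
apply: addcl_sum => i _; rewrite -/(ev _) evM evE evX.
apply: mulidMl; first exact: ev_sa.
apply: mulid_base; first exact: TpS.
by rewrite rmorphXn /= x0 expr0n (negPf (lt0n_neq0 (prime_gt0 (fa_prime W)))).
Qed.

(** With [ev_dense] this identifies T / m_S T with K[X] / (X_i^p). *)
Lemma mulid_evP g :
  mulid S T (ev g) <-> in_ideal (fun i => 'X_i ^+ p) g.
Proof.
split=> [/mulid_ev_coef H|/in_ideal_truncP]; last exact: mulid_ev.
exact/in_ideal_truncP.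
Qed.

Lemma eps_congr (t u : W) : mulid S T (t - u) -> eps t = eps u.
Proof. by move=> /mulid_eps/eqP; rewrite rmorphB /= subr_eq0 => /eqP. Qed.

(** The hypothesis on y expresses freeness of T / m_S T over K[y]/(y^p): the annihilator of y lies
    in y^(p-1) T. If no d_i y were a unit, y would be represented modulo m_S T by a polynomial
    without terms of degree at most one, against [lech_order_two]. *)
Lemma lech_pbasis y : T y -> eps y = 0 ->
  (forall t, T t -> mulid S T (y * t) ->
     exists2 t', T t' & mulid S T (t - y ^+ p.-1 * t')) ->
  exists i, eps (d i y) != 0.
Proof.
move=> Ty y0 freey; apply: contrapT => dy0.
have {}dy0 i : eps (d i y) = 0.
  by apply/eqP/negP => /negP H; apply: dy0; exists i.
have [g Hg] := ev_dense Ty.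
have Tg := ev_sa.
have g0 m : (mdeg m <= 1)%N -> g@_m = 0.
  rewrite leq_eqVlt ltnS leqn0 => /orP[/mdeg1P[i /eqP ->]|]; last first.
    by rewrite mdeg_eq0 => /eqP ->; rewrite -eps_ev -(eps_congr Hg).
  have : mulid S T (d i y - ev g^`M(i)).
    rewrite -deriv_ev -(derivB (dT i) (@dS i)) //.
    exact: (deriv_mulid_base (dT i) (@dS i)).
  move/eps_congr; rewrite dy0 eps_ev mcoeff_mderiv add0m mnm0E mulr1n.
  by move->.
apply: (@lech_order_two p K n (fa_char W) g g0) => h /mulid_evP.
rewrite evM => Hh.
have [|t' Tt' Ht'] := freey (ev h) (Tg h).
  rewrite mulrC -[y](subrK (ev g)) mulrDr; apply: addclD => //.
  by apply: mulidMl.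
have [k Hk] := ev_dense Tt'.
exists k; apply/mulid_evP; rewrite evB evM evE.
have -> : ev h - ev g ^+ p.-1 * ev k =
  (ev h - y ^+ p.-1 * t') + y ^+ p.-1 * (t' - ev k) +
  ev k * (y ^+ p.-1 - ev g ^+ p.-1) by ring.
apply: addclD; first apply: addclD => //.
  by apply: mulidMl => //; exact: saX.
apply: mulidMl => //; rewrite subrXX mulrC; apply: mulidMl => //.
by apply: sa_sum => i _; apply: saM; exact: saX.
Qed.

End Coordinates.
End PBases.

(* T is a finite projective S-module, by a dual basis. *)
Definition proj (R : comNzRingType) (S T : R -> Prop) : Prop :=
  exists (I : finType) (c : I -> R) (l : I -> R -> R),
  [/\ forall i, T (c i), forall i t, T t -> S (l i t),
      forall i a b, T a -> T b -> l i (a + b) = l i a + l i b,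
      forall i s t, S s -> T t -> l i (s * t) = s * l i t
    & forall t, T t -> t = \sum_i l i t * c i].

Lemma proj_comp (R : comNzRingType) (S T U : R -> Prop) :
  (forall x, S x -> T x) -> (forall x, T x -> U x) ->
  (forall x y, U x -> U y -> U (x * y)) ->
  proj S T -> proj T U -> proj S U.
Proof.
move=> ST TU UM [I [c [l [Tc Sl lD lM lE]]]] [J [e [k [Ue Tk kD kM kE]]]].
exists (I * J)%type, (fun ij => c ij.1 * e ij.2), (fun ij u => l ij.1 (k ij.2 u)).
split=> [[i j]|[i j] u Uu|[i j] a b Ua Ub|[i j] s u Ss Uu|u Uu] /=.
- by apply: UM => //; exact: TU.
- by apply: Sl; exact: Tk.
- by rewrite kD // lD //; exact: Tk.
- by rewrite kM ?lM //; [exact: Tk|exact: ST].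
rewrite -(pair_bigA _ (fun i j => l i (k j u) * (c i * e j))) exchange_big /=.
rewrite [LHS](kE u Uu).
apply: eq_bigr => j _; rewrite {1}(lE _ (Tk j u Uu)) mulr_suml.
by apply: eq_bigr => i _; rewrite mulrA.
Qed.

(** * Projectivity in exponent one: retractions and derivations *)

Section ExponentOne.
Variables (p : nat) (W : fibre_alg p).
Local Notation K := (fa_field W).
Local Notation iota := (iota W).
Local Notation eps := (eps W).
Local Notation subalg := (subalg W).
Implicit Types (S T D U : subalg) (x y z w : W).

Definition retract (S T : W -> Prop) (r : W -> W) : Prop :=
  [/\ forall t, T t -> S (r t),
      forall a b, T a -> T b -> r (a + b) = r a + r b,
      forall s t, S s -> T t -> r (s * t) = s * r t & r 1 = 1].

(** In 1 = sum_i l_i(1) c_i some l_i(1) has nonzero augmentation, hence is a unit of S; dividing l_i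
    by it gives the retraction. *)
Lemma proj_retract S T : proj S T -> exists r, retract S T r.
Proof.
move=> [I [c [l [Tc Sl lD lM lE]]]]; have T1 := sa1 T.
have [i ui] : exists i, eps (l i 1) != 0.
  apply: contrapT => H; have := congr1 eps (lE 1 T1).
  rewrite rmorph1 rmorph_sum /= big1 => [/eqP|i _]; first by rewrite oner_eq0.
  rewrite rmorphM /=; have [->|ne] := eqVneq (eps (l i 1)) 0.
    by rewrite mul0r.
  by case: H; exists i.
have [v Sv uv] := sa_inv (Sl i 1 T1) ui.
exists (fun t => v * l i t); split=> [t Tt|a b Ta Tb|s t Ss Tt|].
- by apply: saM => //; exact: Sl.
- by rewrite lD // mulrDr.
- by rewrite lM // mulrCA.
- by rewrite mulrC.
Qed.

Lemma retract_id S T r s : sub_sa S T -> retract S T r -> S s -> r s = s.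
Proof. by move=> _ [_ _ rM r1] Ss; rewrite -{1}[s]mulr1 rM ?r1 ?mulr1 //; exact: sa1. Qed.

Lemma additive_sum T (f : W -> W) (J : Type) (s : seq J) (E : J -> W) :
  (forall a b, T a -> T b -> f (a + b) = f a + f b) -> (forall j, T (E j)) ->
  f (\sum_(j <- s) E j) = \sum_(j <- s) f (E j).
Proof.
move=> fD TE; have f0 : f 0 = 0.
  have := fD 0 0 (sa0 T) (sa0 T); rewrite addr0 => /eqP.
  by rewrite -subr_eq0 opprD addNKr oppr_eq0 => /eqP.
elim: s => [|j s IHs]; first by rewrite !big_nil.
by rewrite !big_cons fD ?IHs //; apply: sa_sum.
Qed.

Lemma proj_trans S T U : sub_sa S T -> sub_sa T U ->
  proj S T -> proj T U -> proj S U.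
Proof. by move=> ST TU; apply: proj_comp => //; exact: saM. Qed.

(** The retraction of U onto T makes T a direct summand of U over S. *)
Lemma proj_summand S T U : sub_sa S T -> sub_sa T U ->
  proj S U -> proj T U -> proj S T.
Proof.
move=> ST TU [I [c [l [Uc Sl lD lM lE]]]] /proj_retract[r rP].
have [Tr rD rM r1] := rP.
exists I, (fun i => r (c i)), l; split=> [i|i t /TU|i a b /TU + /TU|i s t + /TU|t Tt].
- exact: Tr.
- exact: Sl.
- exact: lD.
- exact: lM.
have Ut := TU t Tt; rewrite -{1}(retract_id TU rP Tt) {1}(lE t Ut).
rewrite (additive_sum (T := U)) // => [|i]; last first.
  by apply: saM => //; apply: TU; apply: ST; exact: Sl.
by apply: eq_bigr => i _; rewrite rM //; apply: ST; exact: Sl.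
Qed.

Lemma retract_mulid S D T r w : sub_sa S D -> retract D T r ->
  sub_sa D T -> mulid S T w -> mulid S D (r w).
Proof.
move=> SD [Dr rD rM r1] DT; apply: addcl_map => [|a b Ha Hb|_ [s [t [Ss s0 Tt ->]]]].
- by rewrite -(mul0r 0) rM ?mul0r //; exact: sa0.
- rewrite rD //; apply: (mulid_sub _ (S := S)) => // s /SD; exact: DT.
by rewrite rM //; [apply: mulid_gen => //; exact: Dr | exact: SD].
Qed.

(* If no derivation l_j o d_i of D takes a unit value then m_D T is stable    *)
(* under the d_i and contains d_i D, so that D lies in K + m_S T.             *)
Lemma unit_derivation S D T n (x : 'I_n -> W) (d : 'I_n -> W -> W) :
  sub_sa S D -> sub_sa D T -> (forall i, T (x i)) ->
  (forall t, T t -> S (t ^+ p)) -> sub_sa T (adj S (family x)) ->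
  dual_deriv S T x d -> (forall i, eps (x i) = 0) -> proj D T ->
  ~ sub_sa D S ->
  exists y (dl : W -> W), [/\ D y, eps y = 0, deriv D dl,
    forall s, S s -> dl s = 0 & dl y = 1].
Proof.
move=> SD DT Tx TpS genT dual_d x0 projDT nDS.
have ST : sub_sa S T by move=> s /SD /DT.
have [dT dS dx] := dual_d.
have [r rP] := proj_retract projDT.
have [I [c [l [Tc Dl lD lM lE]]]] := projDT.
have [[i [j [y [Dy uy]]]]|noy] :=
  pselect (exists i j y, D y /\ eps (l j (d i y)) != 0); last first.
  case: nDS; apply: sub_of_mulid => // e De.
  have {}noy i j y : D y -> eps (l j (d i y)) = 0.
    by move=> Dy; apply/eqP/negP => /negP H; apply: noy; exists i, j, y.
  have dD i y : D y -> mulid D T (d i y).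
    move=> Dy; have [Td _ _] := dT i; have Tdy := Td _ (DT _ Dy).
    rewrite (lE _ Tdy); apply: addcl_sum => j _; apply: mulid_gen => //.
      exact: Dl.
    exact: noy.
  have [g Hg] := ev_dense ST Tx genT (DT _ De).
  (* Each derivative of g evaluates into m_D T, which is stable under the d_i and has augmentation
     zero, so no reduced coefficient of g other than the constant one survives. *)
  have g0 m : reduced (fun=> p) m -> m != 0%MM -> g@_m = 0.
    move=> /reducedP redm m0.
    have [i mi] : exists i, m i != 0%N.
      apply/existsP; rewrite -negb_forall; apply: contra m0 => /forallP m0.
      by apply/eqP/mnmP => i; rewrite mnm0E; apply/eqP.
    have mE : (U_(i) + (m - U_(i)))%MM = m by rewrite addmC submK // lep1mP.
    have Hgi : mulid D T (ev x g^`M(i)).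
      rewrite -(deriv_ev Tx dual_d).
      rewrite -[d i _](subKr (d i e)); apply: mulidB; first exact: dD.
      have : mulid S T (d i (e - ev x g)).
        exact: (deriv_mulid_base (dT i) (@dS i)).
      rewrite (derivB (dT i) (@dS i) (DT _ De) (ev_sa Tx g)).
      by apply: addcl_mono => _ [s [t [Ss s0 Tt ->]]]; exists s, t; split=> //; exact: SD.
    have redm' : reduced (fun=> p) (m - U_(i))%MM.
      by apply/reducedP => k; rewrite mnmBE (leq_ltn_trans (leq_subr _ _)).
    have := stable_ev_coef Tx dual_d x0 _ _ Hgi redm'.
    rewrite mcoeff_mderiv submK ?lep1mP // mnmBE mnm1E eqxx subn1 prednK ?lt0n //.
    move=> H; have /eqP : g@_m *+ m i = 0.
      apply: H => [k w|w]; last exact: mulid_eps.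
      by apply: (deriv_mulid (dT k) (@dS k)) => // a; exact: dD.
    rewrite -mulr_natr mulf_eq0 => /orP[/eqP //|].
    rewrite -(dvdn_pcharf (fa_char W)) gtnNdvd ?lt0n //; exact: redm.
  exists (iota g@_0%MM); first exact: sa_iota.
  have : mulid S T (e - iota g@_0%MM).
    rewrite -(subrK (ev x g) e) -addrA; apply: addclD => //.
    rewrite -(evC x) -evB; apply: mulid_ev => // m redm.
    rewrite mcoeffB mcoeffC; have [->|ne] := eqVneq m 0%MM.
      by rewrite ?eqxx mulr1 subrr.
    by rewrite g0 // mulr0 subrr.
  have Di : D (iota g@_0%MM) by exact: sa_iota.
  (* Retracting onto D turns the congruence modulo m_S T into one modulo m_S D, as [sub_of_mulid]
     requires. *)
  move/(retract_mulid SD rP DT); rewrite (retract_id DT rP) //.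
  exact: saB.
have [Td dD dM] := dT i; have Tdy := Td _ (DT _ Dy).
have [v Dv uv] := sa_inv (Dl j _ Tdy) uy.
have Tdi a : D a -> T (d i a) by move=> /DT; exact: Td.
(* On D the derivation d_i takes values in T; composing with the D-linear l_j gives a derivation of
   D, scaled here to take the value 1 at y. *)
pose dl w := v * l j (d i w).
have dlB : deriv D dl.
  split=> [a Da|a b Da Db|a b Da Db]; rewrite /dl.
  - by apply: saM => //; apply: Dl; exact: Tdi.
  - by rewrite dD ?lD ?mulrDr //; [exact: Tdi|exact: Tdi|exact: DT|exact: DT].
  rewrite dM ?lD; try exact: DT.
  - rewrite mulrC [d i a * b]mulrC !lM //; [by ring|exact: Tdi|exact: Tdi].
  - by apply: saM; [exact: Tdi|exact: DT].
  - by apply: saM; [exact: DT|exact: Tdi].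
have dl0 s : S s -> dl s = 0.
  move=> Ss; rewrite /dl dS // -(mul0r 0) lM ?mul0r ?mulr0 //; exact: sa0.
exists (y - iota (eps y)), dl; split=> //; first exact: sa_shift.
  exact: eps_shift.
rewrite (derivB dlB dl0) //; last exact: sa_iota.
by rewrite [dl (iota _)]dl0 ?subr0 /dl 1?mulrC //; exact: sa_iota.
Qed.

Lemma deriv_pow D dl y k : deriv D dl -> dl 1 = 0 -> D y -> dl y = 1 ->
  y * dl (y ^+ k) = y ^+ k *+ k.
Proof.
move=> [Dd dD dM] d1 Dy dy; elim: k => [|k IHk].
  by rewrite expr0 d1 mulr0 mulr0n.
rewrite exprS dM ?dy ?mul1r //; last exact: saX.
by rewrite mulrDr IHk mulrnAr -exprS -mulrS.
Qed.

(** This expresses freeness of D / m_S D over K[y]/(y^p). If z = y^k z' modulo m_S D, applying dl to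
    y z and y dl to z - y^k z' gives (k+1) z = - y^(k+1) dl z' modulo m_S D, and k+1 is invertible
    as long as k+1 < p. *)
Lemma unit_derivation_free S D dl y : sub_sa S D -> deriv D dl ->
  (forall s, S s -> dl s = 0) -> D y -> dl y = 1 ->
  forall z, D z -> mulid S D (y * z) ->
  exists2 z', D z' & mulid S D (z - y ^+ p.-1 * z').
Proof.
move=> SD dlD dl0 Dy dy z Dz yz.
have [Dd dD dM] := dlD.
suff H k : (k < p)%N -> exists2 z', D z' & mulid S D (z - y ^+ k * z').
  by apply: H; rewrite prednK // prime_gt0 // (fa_prime W).
elim: k => [|k IHk] ltkp.
  by exists z => //; rewrite expr0 mul1r subrr; exact: addcl0.
have [z' Dz' Hz'] := IHk (ltnW ltkp).
have Dyk : D (y ^+ k) by exact: saX.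
have Dyz : D (y ^+ k * z') by exact: saM.
have k1 : (k.+1)%:R != 0 :> K.
  by rewrite -(dvdn_pcharf (fa_char W)) gtnNdvd.
exists (- iota (k.+1)%:R^-1 * dl z').
  by apply: saM; [apply: saN; exact: sa_iota | exact: Dd].
have SS : sub_sa S S by [].
have d1 : mulid S D (z + y * dl z).
  have := deriv_mulid_base dlD dl0 SD yz.
  by rewrite dM // dy mul1r.
have d2 : mulid S D (y * dl z - (y ^+ k * z') *+ k - y ^+ k.+1 * dl z').
  have := mulidMl Dy (deriv_mulid_base dlD dl0 SD Hz').
  rewrite (derivB dlD dl0) // dM // mulrBr mulrDr mulrA.
  rewrite (deriv_pow k dlD (dl0 _ (sa1 S)) Dy dy) exprS.
  by rewrite opprD addrA mulrnAl !mulrA.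
have d3 : mulid S D (z *+ k - (y ^+ k * z') *+ k).
  rewrite -mulrnBl -mulr_natl; apply: mulidMl => //; exact: sa_nat.
have : mulid S D (z *+ k.+1 + y ^+ k.+1 * dl z').
  have -> : z *+ k.+1 + y ^+ k.+1 * dl z' =
     (z + y * dl z) - (y * dl z - (y ^+ k * z') *+ k - y ^+ k.+1 * dl z')
     + (z *+ k - (y ^+ k * z') *+ k) by rewrite mulrS; ring.
  by apply: addclD => //; apply: mulidB.
have ck : iota (k.+1)%:R^-1 *+ k.+1 = 1.
  by rewrite -(rmorphMn iota) /= -mulr_natr mulVf // rmorph1.
move/(mulidMl (sa_iota D (k.+1)%:R^-1)); rewrite mulrDr mulrnAr -mulrnAl ck.
by congr (mulid S D _); ring.
Qed.

End ExponentOne.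

(** * Exchange of members of a p-basis *)

Section Exchange.
Variables (p : nat) (W : fibre_alg p).
Local Notation K := (fa_field W).
Local Notation iota := (iota W).
Local Notation eps := (eps W).
Local Notation subalg := (subalg W).
Implicit Types (S T D U : subalg) (x y z w : W).

Lemma pbasis_shift S T n (x : 'I_n -> W) :
  pbasis S T x -> pbasis S T (fun i => x i - iota (eps (x i))).
Proof.
move=> [ST Tx TpS genT [d [dT dS dx]]]; split=> // [i|t Tt|].
- exact: sa_shift.
- apply: (@adj_least _ _ S (family x) (adj_sa S _)) (genT t Tt) => [s Ss|_ [i ->]].
    exact: adj_base.
  rewrite -[x i](subrK (iota (eps (x i)))); apply: adjD.
    by apply: adj_gen; exists i.
  by apply: adj_base; exact: sa_iota.
exists d; split=> // i j.
by rewrite (derivB (dT i) (@dS i)) ?dx ?(dS _ (iota _)) ?subr0 //; exact: sa_iota.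
Qed.

Lemma pbasis_eq S S' T T' n (x : 'I_n -> W) :
  (forall w, S w <-> S' w) -> (forall w, T w <-> T' w) ->
  pbasis S T x -> pbasis S' T' x.
Proof.
move=> SS' TT' [ST Tx TpS genT [d [dT dS dx]]]; split.
- by move=> w /SS' /ST /TT'.
- by move=> i; apply/TT'.
- by move=> t /TT' /TpS /SS'.
- move=> t /TT' /genT; apply: (@adj_least _ _ S _ (adj_sa S' _)) => [s /SS' Ss|z Zz].
    exact: adj_base.
  exact: adj_gen.
exists d; split=> // [i|i s /SS' Ss]; last exact: dS.
have [Td dD dM] := dT i; split=> [a /TT' Ta|a b /TT' Ta /TT' Tb|a b /TT' Ta /TT' Tb].
- by apply/TT'; exact: Td.
- exact: dD.
- exact: dM.
Qed.

Lemma powidMl T k t w : T t -> powid T k.+1 w -> powid T k.+1 (t * w).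
Proof.
move=> Tt; apply: addcl_map => [|u v _ _|_ [[|z l] [szl lT ->]]] //.
- by rewrite mulr0.
- by rewrite mulrDr.
apply: addcl_gen; exists (t * z :: l); split=> //.
  have [Tz z0] := lT z (mem_head _ _).
  move=> v; rewrite inE => /orP[/eqP ->|vl]; last by apply: lT; rewrite inE vl orbT.
  by split; [exact: saM | rewrite rmorphM /= z0 mulr0].
by rewrite !big_cons mulrA.
Qed.

Lemma powidD T k u v : powid T k u -> powid T k v -> powid T k (u + v).
Proof. exact: addclD. Qed.

Lemma powid_mul2 T u v : powid T 1 u -> powid T 1 v -> powid T 2 (u * v).
Proof. exact: powidM. Qed.

Section LinearPart.
Variables (S T : subalg) (n : nat) (x : 'I_n -> W) (d : 'I_n -> W -> W).
Hypotheses (ST : sub_sa S T) (Tx : forall i, T (x i)).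
Hypothesis genT : sub_sa T (adj S (family x)).
Hypothesis dual_d : dual_deriv S T x d.
Hypothesis x0 : forall i, eps (x i) = 0.

(** The scalars eps (d_i t) are the coordinates of t in the cotangent space of T relative to S: the
    formula is additive in t and compatible with products modulo m_T^2 by the Leibniz rule. *)
Lemma linear_part t : T t -> exists2 s, S s &
  powid T 2 (t - (s + \sum_i iota (eps (d i t)) * x i)).
Proof.
have [dT dS dx] := dual_d.
move=> /genT At.
have adjT u : adj S (family x) u -> T u by apply: adj_least => // _ [i ->].
elim: At => {t}[s Ss|_ [j ->]|t u At [s Ss Hs] Au [r Sr Hr]|t u At [s Ss Hs] Au [r Sr Hr]].
- exists s => //; rewrite big1 ?addr0 ?subrr => [|i _]; first exact: addcl0.
  by rewrite dS // !rmorph0 mul0r.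
- exists 0; first exact: sa0.
  rewrite add0r (bigD1 j) //= dx eqxx !rmorph1 mul1r big1 ?addr0 ?subrr.
    exact: addcl0.
  by move=> i /negPf ne; rewrite dx ne !rmorph0 mul0r.
- exists (s + r); first exact: saD.
  have -> : \sum_i iota (eps (d i (t + u))) * x i =
      \sum_i iota (eps (d i t)) * x i + \sum_i iota (eps (d i u)) * x i.
    rewrite -big_split /=; apply: eq_bigr => i _; have [_ dD _] := dT i.
    by rewrite (dD _ _ (adjT _ At) (adjT _ Au)) !rmorphD mulrDl.
  have := addclD Hs Hr; congr (powid T 2 _); ring.
exists (s * r); first exact: saM.
set L := \sum_i _ in Hs; set L' := \sum_i _ in Hr.
have Tt := adjT _ At; have Tu := adjT _ Au.
have TL v : T (\sum_i iota (eps (d i v)) * x i).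
  by apply: sa_sum => i _; apply: saM => //; exact: sa_iota.
have L0 v : eps (\sum_i iota (eps (d i v)) * x i) = 0.
  by rewrite rmorph_sum /= big1 // => i _; rewrite rmorphM /= x0 mulr0.
have epsE v q w : powid T 2 (v - (q + \sum_i iota (eps (d i w)) * x i)) ->
    eps v = eps q.
  move=> /(powid_gt0 (ltn0Sn 1))[_ /eqP].
  by rewrite !rmorphB /= rmorphD /= L0 addr0 subr_eq0 => /eqP.
have et := epsE _ _ _ Hs; have eu := epsE _ _ _ Hr.
rewrite [X in _ - (_ + X)](_ : _ = iota (eps r) * L + iota (eps s) * L').
  have -> : t * u - (s * r + (iota (eps r) * L + iota (eps s) * L')) =
    (s - iota (eps s)) * L' + (r - iota (eps r)) * L + L * L' +
    u * (t - (s + L)) + (s + L) * (u - (r + L')) by ring.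
  have Lm v : powid T 1 (\sum_i iota (eps (d i v)) * x i) by exact: powid_gen1.
  have Sm v : S v -> powid T 1 (v - iota (eps v)).
    move=> Sv; apply: powid_gen1; last exact: eps_shift.
    by apply: sa_shift; exact: ST.
  apply: powidD; last by apply: powidMl => //; apply: saD; [exact: ST|exact: TL].
  apply: powidD; last exact: powidMl.
  apply: powidD; last exact: powid_mul2 (Lm _) (Lm _).
  by apply: powidD; apply: powid_mul2; [exact: Sm|exact: Lm|exact: Sm|exact: Lm].
rewrite !mulr_sumr -big_split /=; apply: eq_bigr => i _; have [_ _ dM] := dT i.
by rewrite dM // rmorphD !rmorphM /= et eu !(rmorphD, rmorphM) /=; ring.
Qed.

End LinearPart.

Definition replace n (x : 'I_n -> W) (i0 : 'I_n) y : 'I_n -> W :=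
  fun i => if i == i0 then y else x i.

(** The dual system changes as under a change of basis: d_i0 is divided by the unit d_i0 y, and the
    other d_i are corrected so as to kill y. For generation, [linear_part] writes x_i0 modulo m_T^2
    through S, y and the other members, and [sub_of_powid] concludes. *)
Lemma pbasis_replace S T n (x : 'I_n -> W) (d : 'I_n -> W -> W) i0 y :
  sub_sa S T -> (forall i, T (x i)) -> (forall t, T t -> S (t ^+ p)) ->
  sub_sa T (adj S (family x)) -> dual_deriv S T x d ->
  T y -> eps (d i0 y) != 0 -> pbasis S T (replace x i0 y).
Proof.
move=> ST Tx TpS genT dual_d Ty uy.
have [dT dS dx] := dual_d; have [Td0 dD0 dM0] := dT i0.
have [v Tv uv] := sa_inv (Td0 y Ty) uy.
set x' := replace x i0 y.
have Tx' i : T (x' i) by rewrite /x' /replace; case: eqP.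
pose d0 w := v * d i0 w.
have d0T : deriv T d0.
  split=> [a Ta|a b Ta Tb|a b Ta Tb]; rewrite /d0.
  - by apply: saM => //; exact: Td0.
  - by rewrite dD0 // mulrDr.
  - by rewrite dM0 //; ring.
have d00 s : S s -> d0 s = 0 by move=> Ss; rewrite /d0 dS ?mulr0.
pose d' i w := if i == i0 then d0 w else d i w - d i y * d0 w.
have d'P : dual_deriv S T x' d'.
  have [Td00 dD00 dM00] := d0T.
  split=> [i|i s Ss|i j]; rewrite /d'.
  - case: eqP => // _; have [Td dD dM] := dT i.
    split=> [a Ta|a b Ta Tb|a b Ta Tb].
    + by apply: saB; [exact: Td | apply: saM; [exact: Td | exact: Td00]].
    + by rewrite dD // dD00 //; ring.
    + by rewrite dM // dM00 //; ring.
  - by rewrite (d00 _ Ss) (dS _ _ Ss) mulr0 subrr; case: eqP.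
  rewrite /x' /replace; have [->|ni] := eqVneq i i0.
    rewrite /d0; have [_|nj] := eqVneq j i0; first by rewrite mulrC uv.
    by rewrite dx eq_sym (negPf nj) mulr0.
  have [->|nj] := eqVneq j i0.
    by rewrite /d0 [v * _]mulrC uv mulr1 subrr (negPf ni).
  by rewrite /d0 !dx [i0 == j]eq_sym (negPf nj) mulr0 mulr0 subr0.
split=> //; last by exists d'.
have [Sh1 Sh2 Sh3 Sh4 _] := pbasis_shift (And5 ST Tx TpS genT (ex_intro _ d dual_d)).
set xs := fun i => _ in Sh2 Sh4.
have dual_s : dual_deriv S T xs d.
  split=> // i j; rewrite (derivB (dT i) (@dS i)) ?dx ?(dS _ (iota _)) ?subr0 //;
    exact: sa_iota.
have xs0 i : eps (xs i) = 0 by exact: eps_shift.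
have lin := linear_part ST Sh2 Sh4 dual_s xs0.
have sub0 : sub_sa (adj_sa S (family x')) T.
  by apply: adj_least => // _ [i ->].
have As s : S s -> adj_sa S (family x') s by exact: adj_base.
have Axs i : i != i0 -> adj_sa S (family x') (xs i).
  move=> ne; apply: saB; last exact: sa_iota.
  by apply: adj_gen; exists i; rewrite /x' /replace (negPf ne).
have [s0 Ss0] := lin y Ty; rewrite (bigD1 i0) //= => Hy.
have Hx0 : exists2 a, adj_sa S (family x') a & powid T 2 (xs i0 - a).
  exists (iota (eps (d i0 y))^-1 *
     (y - (s0 + \sum_(i | i != i0) iota (eps (d i y)) * xs i))).
    apply: saM; first exact: sa_iota.
    apply: saB; first by apply: adj_gen; exists i0; rewrite /x' /replace eqxx.
    apply: saD; first exact: As.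
    by apply: sa_sum => i ni; apply: saM; [exact: sa_iota | exact: Axs].
  have := powidMl (saN (sa_iota T (eps (d i0 y))^-1)) Hy.
  congr (powid T 2 _).
  have ck : iota (eps (d i0 y))^-1 * iota (eps (d i0 y)) = 1.
    by rewrite -rmorphM mulVf // rmorph1.
  rewrite -/(xs i0) -[X in _ = X - _]mul1r -[X in _ = X * _ - _]ck; ring.
apply: (sub_of_powid sub0) => t Tt _.
set A := adj_sa S (family x') in sub0 As Axs Hx0 *.
have [s Ss] := lin t Tt; rewrite (bigD1 i0) //= => Ht.
have [a Aa Ha] := Hx0.
exists (s + (iota (eps (d i0 t)) * a +
     \sum_(i | i != i0) iota (eps (d i t)) * xs i)).
  change (A (s + (iota (eps (d i0 t)) * a +
     \sum_(i | i != i0) iota (eps (d i t)) * xs i))).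
  apply: saD; first exact: As.
  apply: saD; first by apply: saM => //; exact: sa_iota.
  by apply: sa_sum => i ni; apply: saM; [exact: sa_iota | exact: Axs].
have := powidD Ht (powidMl (sa_iota T (eps (d i0 t))) Ha).
by rewrite -/(xs i0); congr (powid T 2 _); ring.
Qed.

Lemma pbasis_refl S D : sub_sa S D -> sub_sa D S ->
  exists m (z : 'I_m -> W), pbasis S D z.
Proof.
move=> SD DS; exists 0%N, (fun=> 0); split=> //.
- by case.
- by move=> t /DS St; exact: saX.
- by move=> t /DS; exact: adj_base.
- by exists (fun _ _ => 0); split; case.
Qed.

(** The D-linear coordinates on T reduce the claim to D, where it is [unit_derivation_free]. *)
Lemma free_over_projective S D T dl y : sub_sa S D -> sub_sa D T -> proj D T ->
  deriv D dl -> (forall s, S s -> dl s = 0) -> D y -> dl y = 1 ->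
  forall t, T t -> mulid S T (y * t) ->
  exists2 t', T t' & mulid S T (t - y ^+ p.-1 * t').
Proof.
move=> SD DT [I [c [l [Tc Dl lD lM lE]]]] dlD dl0 Dy dly t Tt yt.
have Ts s : S s -> T s by move=> /SD /DT.
rewrite (lE t Tt); apply: (big_ind (fun u => exists2 t', T t' &
  mulid S T (u - y ^+ p.-1 * t'))) => [|a b [a' Ta Ha] [b' Tb Hb]|i _].
- by exists 0; [exact: sa0 | rewrite mulr0 subrr; exact: addcl0].
- exists (a' + b'); first exact: saD.
  have := addclD Ha Hb; congr (mulid S T _); ring.
have ylt : mulid S D (y * l i t).
  rewrite -lM //; move: yt; apply: addcl_map.
  - by have := lM i 0 0 (sa0 D) (sa0 T); rewrite !mul0r.
  - move=> a b Ha Hb; rewrite lD //; exact: (mulid_sub (S := S) (T := T)).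
  move=> _ [s [u [Ss s0 Tu ->]]]; rewrite lM //; last exact: SD.
  by apply: mulid_gen => //; exact: Dl.
have [z' Dz' Hz'] := unit_derivation_free SD dlD dl0 Dy dly (Dl i t Tt) ylt.
exists (z' * c i); first by apply: saM => //; exact: DT.
rewrite mulrA -mulrBl mulrC; apply: mulidMl => //.
by apply: addcl_mono Hz' => _ [s [u [Ss s0 /DT Tu ->]]]; exists s, u.
Qed.

(* unit_derivation gives y in D with dl y = 1 for a derivation dl of D over S;   *)
(* by lech_pbasis this y may replace one of the x_i; then induct over S[y].      *)
Theorem exponent_one_intermediate n S D T (x : 'I_n -> W) :
  sub_sa S D -> sub_sa D T -> proj D T -> pbasis S T x ->
  (exists m (z : 'I_m -> W), pbasis S D z) /\
  (exists m (z : 'I_m -> W), pbasis D T z).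
Proof.
elim: n S x => [|n IHn] S x SD DT projDT /pbasis_shift[].
all: set xs := fun i => _; move=> ST Tx TpS genT [d dual_d];
  have xs0 i : eps (xs i) = 0 by [exact: eps_shift].
all: have [DS|nDS] := pselect (sub_sa D S).
- split; first exact: pbasis_refl.
  apply: (@pbasis_refl D T) => // t /genT; elim=> [s|_ [[]]|u v _ Du _ Dv|u v _ Du _ Dv] //.
  + exact: SD.
  + exact: saD.
  + exact: saM.
- have [y [dl [Dy y0 dlD dl0 dly]]] :=
    unit_derivation SD DT Tx TpS genT dual_d xs0 projDT nDS.
  have [] : exists i : 'I_0, eps (d i y) != 0; last by case.
  apply: (lech_pbasis ST Tx TpS genT dual_d xs0 (DT _ Dy) y0) => t Tt.
  exact: (free_over_projective SD DT projDT dlD dl0 Dy dly).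
- split; first exact: pbasis_refl.
  exists n.+1, xs; apply: (@pbasis_eq S D T T) => // [w|].
    by split=> [/SD|/DS].
  by split=> //; exists d.
have [y [dl [Dy y0 dlD dl0 dly]]] :=
  unit_derivation SD DT Tx TpS genT dual_d xs0 projDT nDS.
have [i0 ui0] : exists i, eps (d i y) != 0.
  apply: (lech_pbasis ST Tx TpS genT dual_d xs0 (DT _ Dy) y0) => t Tt.
  exact: (free_over_projective SD DT projDT dlD dl0 Dy dly).
have [_ Tx' _ genT' [d' [d'T d'S d'x]]] :=
  pbasis_replace ST Tx TpS genT dual_d (DT _ Dy) ui0.
set x' := replace xs i0 y in Tx' genT' d'x.
have x'i0 : x' i0 = y by rewrite /x' /replace eqxx.
(* As y now belongs to the p-basis of T over S, the n other members form a p-basis of T over S[y],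
   and the induction hypothesis applies to S[y] < D < T. *)
pose S1 := adj_sa S (eq y).
have SS1 : sub_sa S S1 by move=> s; exact: adj_base.
have S1D : sub_sa S1 D by apply: adj_least => // _ <-.
have S1T : sub_sa S1 T by move=> s /S1D /DT.
have S1y : S1 y by exact: adj_gen.
have kills dd : deriv T dd -> (forall s, S s -> dd s = 0) -> dd y = 0 ->
    forall s, S1 s -> dd s = 0.
  move=> [_ ddD ddM] ddS ddy s; elim=> [r|_ <-|a b Sa IHa Sb IHb|a b Sa IHa Sb IHb] //.
  - exact: ddS.
  - by rewrite ddD ?IHa ?IHb ?addr0 //; apply: S1T.
  - by rewrite ddM ?IHa ?IHb ?mul0r ?mulr0 ?addr0 //; apply: S1T.
have pb1 : pbasis S1 T (fun j : 'I_n => x' (fintype.lift i0 j)).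
  split=> // [t Tt|t /genT'|].
  - by apply: SS1; exact: TpS.
  - apply: (@adj_least _ _ S (family x') (adj_sa S1 _)) => [s Ss|_ [i ->]].
      by apply: adj_base; exact: SS1.
    have [j ->|->] := unliftP i0 i; first by apply: adj_gen; exists j.
    by rewrite x'i0; exact: adj_base.
  exists (fun j : 'I_n => d' (fintype.lift i0 j)); split=> // [j s|j k].
    by apply: kills => //; [exact: d'S | rewrite -x'i0 d'x eq_sym (negPf (neq_lift _ _))].
  by rewrite d'x (inj_eq (@lift_inj _ _)).
have [[m [z [_ Dz DpS1 genD [dz [dzD dzS1 dzz]]]]] DTpb] := IHn _ _ S1D DT projDT pb1.
split=> //; exists m.+1, (fun i => if unlift ord0 i is Some j then z j else y).
have [Ddl dlDD dlM] := dlD.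
split=> //.
- by move=> i; case: unlift.
- by move=> t /DT /TpS.
- move=> t /genD; apply: (@adj_least _ _ S1 (family z) (adj_sa S _)) => [|_ [j ->]].
    apply: adj_least => [s Ss|_ <-]; first exact: adj_base.
    by apply: adj_gen; exists ord0; rewrite unlift_none.
  by apply: adj_gen; exists (fintype.lift ord0 j); rewrite liftK.
have Ddz j u : D u -> D (dz j u) by case: (dzD j) => H _ _; exact: H.
(* Index 0 stands for y. Its derivation dl is corrected so as to vanish on the z_j, while the dz_j
   already kill y because they vanish on S[y]. *)
exists (fun i w => if unlift ord0 i is Some j then dz j w
                   else dl w - \sum_j dl (z j) * dz j w).
split=> [i|i s Ss|i k].
- case: (unlift ord0 i) => [j|]; first exact: dzD.
  split=> [a Da|a b Da Db|a b Da Db].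
  + apply: saB; first exact: Ddl.
    by apply: sa_sum => j _; apply: saM; [exact: Ddl | exact: Ddz].
  + rewrite dlDD // [X in _ - X](_ : _ = \sum_j dl (z j) * dz j a +
       \sum_j dl (z j) * dz j b); first by ring.
    rewrite -big_split; apply: eq_bigr => j _; have [_ dzDD _] := dzD j.
    by rewrite dzDD // mulrDr.
  rewrite dlM // [X in _ - X](_ : _ = (\sum_j dl (z j) * dz j a) * b +
     a * \sum_j dl (z j) * dz j b); first by ring.
  rewrite mulr_suml mulr_sumr -big_split; apply: eq_bigr => j _ /=.
  by have [_ _ dzM] := dzD j; rewrite dzM //; ring.
- case: (unlift ord0 i) => [j|]; first by apply: dzS1; exact: SS1.
  rewrite dl0 // big1 ?subrr // => j _; rewrite dzS1 ?mulr0 //; exact: SS1.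
case: unliftP => [j ->|->]; case: unliftP => [l ->|->].
- by rewrite dzz (inj_eq (@lift_inj _ _)).
- by rewrite dzS1 // eq_sym (negPf (neq_lift _ _)).
- rewrite (bigD1 l) //= dzz eqxx mulr1 big1 ?addr0 ?subrr.
    by [].
  by move=> j /negPf ne; rewrite dzz ne mulr0.
by rewrite dly big1 ?subr0 ?eqxx // => j _; rewrite dzS1 ?mulr0.
Qed.

End Exchange.

(** * Monomial bases from p-bases *)

Section Expansion.
Variables (p : nat) (W : fibre_alg p).
Local Notation K := (fa_field W).
Local Notation iota := (iota W).
Local Notation eps := (eps W).
Local Notation subalg := (subalg W).
Implicit Types (S T D U G : subalg) (y z w : W).

Definition mono n (x : 'I_n -> W) (m : 'I_n -> nat) : W := \prod_i x i ^+ m i.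

Lemma monoD n (x : 'I_n -> W) m m' :
  mono x m * mono x m' = mono x (fun i => m i + m' i)%N.
Proof. by rewrite -big_split; apply: eq_bigr => i _; rewrite exprD. Qed.

Lemma sa_mono T n (x : 'I_n -> W) m : (forall i, T (x i)) -> T (mono x m).
Proof. by move=> Tx; apply: sa_prod => i _; apply: saX. Qed.

Definition spanned n (x : 'I_n -> W) (S : W -> Prop) (Q : ('I_n -> nat) -> Prop) :
    W -> Prop :=
  addcl (fun w => exists s m, [/\ S s, Q m & w = s * mono x m]).

Section Basis.
Variables (S T : subalg) (n : nat) (x : 'I_n -> W).
Hypothesis xP : pbasis S T x.

Local Notation idx := {ffun 'I_n -> 'I_p}.
Let mon (c : idx) : W := mono x (fun i => c i).

Lemma pbasis_sub : sub_sa S T. Proof. by case: xP. Qed.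
Lemma pbasis_in i : T (x i). Proof. by case: xP. Qed.
Lemma pbasis_pexp t : T t -> S (t ^+ p). Proof. by case: xP => _ _ + _ _; apply. Qed.

Let ST := pbasis_sub.
Let Tx := pbasis_in.
Let p_gt0 : (0 < p)%N. Proof. exact: prime_gt0 (fa_prime W). Qed.

Lemma mono_pdivn m :
  mono x m = mono (fun i => x i ^+ p) (fun i => m i %/ p)%N * mono x (fun i => m i %% p)%N.
Proof.
rewrite -big_split; apply: eq_bigr => i _ /=.
by rewrite -exprM -exprD mulnC -divn_eq.
Qed.

Let modidx (m : 'I_n -> nat) : idx := [ffun i => Ordinal (ltn_pmod (m i) p_gt0)].

Let mon_mod m : mono x (fun i => m i %% p)%N = mon (modidx m).
Proof. by apply: eq_bigr => i _; rewrite ffunE. Qed.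

Lemma pbasis_span t : T t ->
  exists s : idx -> W, (forall c, S (s c)) /\ t = \sum_c s c * mon c.
Proof.
move=> Tt.
have : spanned x S (fun=> True) t.
  have [_ _ _ genT _] := xP; elim: (genT t Tt) => {t Tt}[s Ss|_ [i ->]|u v _ Hu _ Hv|u v _ Hu _ Hv].
  - apply: addcl_gen; exists s, (fun=> 0%N); split=> //.
    by rewrite /mono big1 ?mulr1.
  - apply: addcl_gen; exists 1, (fun j => i == j); split=> //; first exact: sa1.
    rewrite mul1r /mono (bigD1 i) //= eqxx expr1 big1 ?mulr1 // => j ne.
    by rewrite eq_sym (negPf ne).
  - exact: addclD.
  move: Hu; apply: (@addcl_map _ _ _ _ (fun w => w * v)) => [|a b _ _|_ [s [m [Ss _ ->]]]].
  - by rewrite mul0r.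
  - by rewrite mulrDl.
  move: Hv; apply: (@addcl_map _ _ _ _ (fun w => s * mono x m * w)) => [|a b _ _|_ [s' [m' [Ss' _ ->]]]].
  - by rewrite mulr0.
  - by rewrite mulrDr.
  apply: addcl_gen; exists (s * s'), (fun i => m i + m' i)%N; split=> //.
    exact: saM.
  by rewrite -monoD mulrACA.
apply: (@addcl_least _ _ (fun t => exists s : idx -> W,
  (forall c, S (s c)) /\ t = \sum_c s c * mon c)).
- exists (fun=> 0); split=> [_|]; first exact: sa0.
  by rewrite big1 // => c _; rewrite mul0r.
- move=> _ _ [s [Ss ->]] [s' [Ss' ->]]; exists (fun c => s c + s' c).
  split=> [c|]; first exact: saD.
  by rewrite -big_split; apply: eq_bigr => c _; rewrite mulrDl.
move=> _ [s [m [Ss _ ->]]]; rewrite mono_pdivn mon_mod mulrA.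
set a := s * _; have Sa : S a.
  by apply: saM => //; apply: sa_mono => i; exact: pbasis_pexp.
exists (fun c => if c == modidx m then a else 0); split=> [c|].
  by case: eqP => // _; exact: sa0.
rewrite (bigD1 (modidx m)) //= eqxx big1 ?addr0 // => c /negPf ->.
by rewrite mul0r.
Qed.

Lemma deriv_mono d i m : dual_deriv S T x d ->
  d i (mono x m) = (m i)%:R * mono x (fun j => m j - (i == j))%N.
Proof.
move=> dual_d; pose mm := [multinom m j | j < n].
have evm k : ev x 'X_[k] = mono x k by rewrite /ev mmapX.
have -> : mono x m = ev x 'X_[mm] by rewrite evm; apply: eq_bigr => j _; rewrite mnmE.
rewrite (deriv_ev Tx dual_d) mderivX mnmE -mul_mpolyC evM evC evm rmorph_nat.
by congr (_ * _); apply: eq_bigr => j _; rewrite mnmBE mnm1E mnmE.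
Qed.

(** A nontrivial relation is differentiated to the order of its leading monomial. What is left is
    the leading coefficient times a product of factorials, invertible because the exponents are
    below p. *)
Lemma pbasis_independent (s : idx -> W) : (forall c, S (s c)) ->
  \sum_c s c * mon c = 0 -> forall c, s c = 0.
Proof.
have [_ _ _ _ [d dual_d]] := xP; have [dT dS _] := dual_d.
move=> Ss s0.
pose mn (c : idx) : 'X_{1..n} := [multinom (c i : nat) | i < n].
have mn_inj : injective mn.
  move=> c c' /mnmP H; apply/ffunP => i; apply/val_inj.
  by have := H i; rewrite !mnmE.
pose f : {mpoly W[n]} := \sum_c s c *: 'X_[mn c].
have fE c : f@_(mn c) = s c.
  rewrite raddf_sum (bigD1 c) //= mcoeffZ mcoeffX eqxx mulr1 big1 ?addr0 // => c'.
  by rewrite mcoeffZ mcoeffX (inj_eq mn_inj) => /negPf ->; rewrite mulr0.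
pose val (g : {mpoly W[n]}) := \sum_(m <- msupp g) g@_m * mono x m.
have valE (g : {mpoly W[n]}) : val g = mmap idfun x g by [].
(* Polynomials over S that vanish at x; formal derivatives preserve this class because the d_i are
   S-linear. *)
pose Q (g : {mpoly W[n]}) := (forall m, S g@_m) /\ val g = 0.
have Qd i g : Q g -> Q g^`M(i).
  move=> [Sg g0]; split=> [m|].
    by rewrite mcoeff_mderiv -mulr_natl; apply: saM => //; exact: sa_nat.
  have : d i (val g) = 0 by rewrite g0; exact: (deriv0 (@dS i)).
  have [Td dD dM] := dT i.
  rewrite (additive_sum (T := T)) // => [<-|m]; last first.
    by apply: saM; [exact: ST|exact: sa_mono].
  rewrite valE /mderiv raddf_sum /=; apply: eq_bigr => m _.
  rewrite mmapZ mmapX (derivZ (dT i) (@dS i)) //; last exact: sa_mono.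
  rewrite (deriv_mono _ _ dual_d) mulrCA mulrA; congr (_ * _).
  by apply: eq_bigr => j _; rewrite mnmBE mnm1E.
have Qf : Q f.
  split=> [m|].
    rewrite raddf_sum; apply: sa_sum => c _ /=; rewrite mcoeffZ mcoeffX.
    by apply: saM => //; exact: sa_nat.
  rewrite valE -[RHS]s0 raddf_sum; apply: eq_bigr => c _ /=.
  by rewrite mmapZ mmapX; congr (_ * _); apply: eq_bigr => i _; rewrite mnmE.
suff f0 : f = 0 by move=> c; rewrite -fE f0 mcoeff0.
apply/eqP; apply: contraT => nf; set m := mlead f.
have fm := mlead_supp nf.
have [c mE] : exists c, m = mn c.
  apply: contrapT => H; move: fm; rewrite mcoeff_msupp raddf_sum /= big1 ?eqxx // => c _.
  rewrite mcoeffZ mcoeffX; case: eqP => [E|]; last by rewrite mulr0.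
  by case: H; exists c; rewrite E.
have : Q f^`M[m] by rewrite mderivm_foldr; elim: (flatten _) => //= i l; exact: Qd.
case=> _; have -> : f^`M[m] = (f@_m *+ \prod_(i < n) (m i)`!)%:MP.
  apply/mpolyP => k; rewrite mcoeff_mderivm mcoeffC.
  have [->|nk] := eqVneq k 0%MM.
    by rewrite mulr1 addm0; congr (_ *+ _); apply: eq_bigr => i _; rewrite ffactnn.
  rewrite mulr0 memN_msupp_eq0 ?mul0rn //; apply/negP => /msize_mdeg_lt.
  rewrite -(mlead_deg nf) -/m mdegD ltnS -[X in (_ <= X)%N]addn0 leq_add2l.
  by rewrite leqn0 mdeg_eq0 (negPf nk).
rewrite valE mmapC /= -mulr_natr -(rmorph_nat iota) => H.
have u : (\prod_(i < n) (m i)`!)%:R != 0 :> K.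
  rewrite natr_prod; apply/prodf_neq0 => i _; apply: (fact_natr_neq0 (fa_char W)).
  by rewrite mE mnmE.
move: fm; rewrite mcoeff_msupp -[f@__]mulr1 -(rmorph1 iota) -(mulfV u) rmorphM.
by rewrite mulrA H mul0r eqxx.
Qed.

Lemma pbasis_coord : exists l : idx -> W -> W,
  [/\ forall c t, T t -> S (l c t),
      forall t, T t -> t = \sum_c l c t * mon c
    & forall s t, (forall c, S (s c)) -> t = \sum_c s c * mon c -> forall c, l c t = s c].
Proof.
have /choice[l lP] t : exists s : idx -> W, T t ->
    (forall c, S (s c)) /\ t = \sum_c s c * mon c.
  have [Tt|nT] := pselect (T t); last by exists (fun=> 0).
  by have [s Hs] := pbasis_span Tt; exists s.
exists (fun c t => l t c); split=> [c t /lP[]//|t /lP[]//|s t Ss tE c].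
have Tt : T t.
  rewrite tE; apply: sa_sum => c' _; apply: saM; [exact: ST|exact: sa_mono].
have [Sl lE] := lP t Tt.
apply/eqP; rewrite -subr_eq0; apply/eqP.
apply: (pbasis_independent (s := fun c => l t c - s c)) => [c'|].
  exact: saB.
rewrite (eq_bigr (fun c => l t c * mon c - s c * mon c)) => [|c' _].
  by rewrite sumrB -lE -tE subrr.
by rewrite mulrBl.
Qed.

Lemma pbasis_proj : proj S T.
Proof.
have [l [Sl lE lU]] := pbasis_coord.
exists {ffun 'I_n -> 'I_p}, mon, l; split=> // [c|c a b Ta Tb|c s t Ss Tt].
- exact: sa_mono.
- apply: (lU (fun c => l c a + l c b)) => [c'|].
    by apply: saD; exact: Sl.
  rewrite {1}(lE a Ta) {1}(lE b Tb) -big_split; apply: eq_bigr => c' _.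
  by rewrite mulrDl.
- apply: (lU (fun c => s * l c t)) => [c'|].
    by apply: saM => //; exact: Sl.
  by rewrite {1}(lE t Tt) mulr_sumr; apply: eq_bigr => c' _; rewrite mulrA.
Qed.

End Basis.
End Expansion.

(** * Frobenius towers in a fibre algebra *)

Section Towers.
Variables (p : nat) (W : fibre_alg p).
Local Notation K := (fa_field W).
Local Notation iota := (iota W).
Local Notation eps := (eps W).
Local Notation subalg := (subalg W).
Implicit Types (S T D U G B : subalg) (y z w : W).

Section ExtendDerivation.
Variables (G S T : subalg) (n : nat) (x : 'I_n -> W) (d : W -> W).
Hypotheses (xP : pbasis S T x) (GS : sub_sa G S).
Hypothesis TpG : forall t, T t -> G (t ^+ p).
Hypotheses (dS : deriv S d) (dG : forall g, G g -> d g = 0).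

(** The extension lets d act on the coefficients of the expansion in monomials of x. Reducing
    exponents in a product of monomials produces factors x_i^p, which lie in G and are killed by d;
    hence the Leibniz rule. *)
Lemma extend_deriv : exists D : W -> W, [/\ deriv T D, forall s, S s -> D s = d s
  & forall i, D (x i) = 0].
Proof.
have [l [Sl lE lU]] := pbasis_coord xP.
have [Sd dD dM] := dS.
have ST := pbasis_sub xP; have Tx := pbasis_in xP.
have p_gt0 : (0 < p)%N := prime_gt0 (fa_prime W).
pose mon (c : {ffun 'I_n -> 'I_p}) : W := mono x (fun i => c i).
pose D t := \sum_c d (l c t) * mon c.
have d0 : d 0 = 0 by exact: deriv0 dG.
have DE s t : (forall c, S (s c)) -> t = \sum_c s c * mon c ->
    D t = \sum_c d (s c) * mon c.
  by move=> Ss tE; apply: eq_bigr => c _; rewrite (lU s).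
have DD a b : T a -> T b -> D (a + b) = D a + D b.
  move=> Ta Tb; rewrite (DE (fun c => l c a + l c b)).
  - rewrite -big_split; apply: eq_bigr => c _ /=.
    by rewrite dD ?mulrDl //; exact: Sl.
  - by move=> c; apply: saD; exact: Sl.
  rewrite {1}(lE a Ta) {1}(lE b Tb) -big_split; apply: eq_bigr => c _.
  by rewrite mulrDl.
have Dmono s m : S s -> D (s * mono x m) = d s * mono x m.
  move=> Ss; pose c0 : {ffun 'I_n -> 'I_p} :=
    [ffun i => Ordinal (ltn_pmod (m i) p_gt0)].
  have mE : mono x (fun i => m i %% p)%N = mon c0.
    by apply: eq_bigr => i _; rewrite ffunE.
  rewrite (mono_pdivn x m) mE; set a := mono _ _.
  have Ga : G a by apply: sa_mono => i; apply: TpG.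
  have Sa := GS Ga.
  rewrite mulrA (DE (fun c => if c == c0 then s * a else 0)) => [|c|].
  - rewrite (bigD1 c0) //= eqxx big1 ?addr0 => [|c /negPf ->]; last first.
      by rewrite d0 mul0r.
    by rewrite dM // (dG Ga) mulr0 addr0 mulrA.
  - by case: eqP => _; [exact: saM|exact: sa0].
  rewrite (bigD1 c0) //= eqxx big1 ?addr0 // => c /negPf ->.
  by rewrite mul0r.
have mono0 : mono x (fun=> 0%N) = 1 by rewrite /mono big1.
have DSd s : S s -> D s = d s.
  by move=> Ss; have := Dmono s (fun=> 0%N) Ss; rewrite mono0 !mulr1.
have Tsp t : T t -> spanned x S (fun=> True) t.
  move=> Tt; rewrite (lE t Tt); apply: addcl_sum => c _; apply: addcl_gen.
  by exists (l c t), (fun i => val (c i)); split=> //; exact: Sl.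
have Tm m : T (mono x m) by exact: sa_mono.
have spT t : spanned x S (fun=> True) t -> T t.
  apply: addcl_least; [exact: sa0|exact: saD|].
  by move=> _ [s [m [Ss _ ->]]]; apply: saM => //; exact: ST.
have D0 : D 0 = 0 by rewrite DSd //; exact: sa0.
exists D; split=> // [|i].
  split=> // [t Tt|a b Ta Tb].
    by apply: sa_sum => c _; apply: saM; [apply: (ST); apply: (Sd); exact: Sl|exact: Tm].
  elim: (Tsp a Ta) => {a Ta}[|_ v [s [m [Ss _ ->]]] /spT Tv IH].
    by rewrite !mul0r D0 mul0r add0r.
  have Tsm : T (s * mono x m) by apply: saM => //; exact: ST.
  rewrite mulrDl !DD //; [|exact: saM|exact: saM]; rewrite IH.
  suff -> : D (s * mono x m * b) = D (s * mono x m) * b + s * mono x m * D b by ring.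
  elim: (Tsp b Tb) => {b Tb IH}[|_ u [s' [m' [Ss' _ ->]]] /spT Tu IH].
    by rewrite !mulr0 D0 mulr0 addr0.
  have Tsm' : T (s' * mono x m') by apply: saM => //; exact: ST.
  rewrite mulrDr !DD //; [|exact: saM|exact: saM]; rewrite IH.
  rewrite mulrACA monoD !Dmono //; last exact: saM.
  by rewrite dM // -monoD; ring.
have -> : x i = 1 * mono x (fun j => i == j).
  rewrite mul1r /mono (bigD1 i) //= eqxx expr1 big1 ?mulr1 // => j ne.
  by rewrite eq_sym (negPf ne).
rewrite Dmono; last exact: sa1.
by rewrite dG ?mul0r //; exact: sa1.
Qed.

End ExtendDerivation.

(** The concatenated family has dual derivations: those dual to z extend to T so as to kill x, and
    those dual to x already kill S, hence z. *)
Lemma pbasis_trans G S T m n (z : 'I_m -> W) (x : 'I_n -> W) :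
  pbasis G S z -> pbasis S T x -> (forall t, T t -> G (t ^+ p)) ->
  exists k (y : 'I_k -> W), pbasis G T y.
Proof.
move=> zP xP TpG.
have [GS Sz SpG genS [dz [dzD dzG dzz]]] := zP.
have [ST Tx TpS genT [dx [dxD dxS dxx]]] := xP.
have /choice[Dz DzP] i : exists D : W -> W, [/\ deriv T D, forall s, S s -> D s = dz i s
    & forall i, D (x i) = 0].
  by apply: (@extend_deriv G S T n x (dz i) xP GS TpG) => //; exact: dzG.
pose y k := match split k with inl i => z i | inr i => x i end.
have yl i : y (lshift n i) = z i.
  by rewrite /y -[lshift n i]/(unsplit (inl i)) unsplitK.
have yr i : y (rshift m i) = x i.
  by rewrite /y -[rshift m i]/(unsplit (inr i)) unsplitK.
exists (m + n)%N, y; split=> //.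
- by move=> w /GS /ST.
- by move=> k; case: (split_ordP k) => i ->; rewrite ?yl ?yr //; exact: ST.
- move=> t /genT; apply: (@adj_least _ _ S (family x) (adj_sa G _)) => [s /genS|_ [i ->]].
    apply: (@adj_least _ _ G (family z) (adj_sa G _)) => [g Gg|_ [i ->]].
      exact: adj_base.
    by apply: adj_gen; exists (lshift n i); rewrite yl.
  by apply: adj_gen; exists (rshift m i); rewrite yr.
exists (fun k => match split k with inl i => Dz i | inr i => dx i end).
split=> [k|k g Gg|k l].
- by case: (split_ordP k) => i _ //; have [] := DzP i.
- case: (split k) => i; last by apply: dxS; exact: GS.
  by have [_ E _] := DzP i; rewrite E; [exact: dzG|exact: GS].
case: (split_ordP l) => j ->; rewrite ?yl ?yr; case: (split_ordP k) => i ->.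
- by have [_ E _] := DzP i; rewrite E // eq_lshift.
- by rewrite dxS // eq_rlshift.
- by have [_ _ ->] := DzP i; rewrite eq_lrshift.
by rewrite dxx eq_rshift.
Qed.

Definition scalars : subalg.
Proof.
refine (@Subalg _ _ (fun w => exists k, w = iota k) _ _ _).
- by move=> k; exists k.
- by move=> _ _ [k ->] [l ->]; exists (k + l); rewrite rmorphD.
- by move=> _ _ [k ->] [l ->]; exists (k * l); rewrite rmorphM.
Defined.

Definition whole : subalg := @Subalg _ _ (fun=> True) (fun=> I) (fun _ _ _ _ => I)
  (fun _ _ _ _ => I).

(* G[T^(p^e)], for subalgebras G and T *)
Definition frob_gen (G T : W -> Prop) (e : nat) (w : W) : Prop :=
  exists g t, [/\ G g, T t & w = g * t ^+ (p ^ e)].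

Lemma frobM G T e x y : addcl (frob_gen G T e) x -> addcl (frob_gen G T e) y ->
  addcl (frob_gen G T e) (x * y).
Proof.
move=> + Hy; apply: (@addcl_map _ _ _ _ (fun w => w * y)) => [|a b _ _|_ [g [t [Gg Tt ->]]]].
- by rewrite mul0r.
- by rewrite mulrDl.
move: Hy; apply: (@addcl_map _ _ _ _ (fun w => g * t ^+ (p ^ e) * w)) =>
  [|a b _ _|_ [h [u [Gh Tu ->]]]].
- by rewrite mulr0.
- by rewrite mulrDr.
apply: addcl_gen; exists (g * h), (t * u); split; [exact: saM|exact: saM|].
by rewrite exprMn mulrACA.
Qed.

Definition frob (G T : subalg) (e : nat) : subalg.
Proof.
refine (@Subalg _ _ (addcl (frob_gen G T e)) _ _ _).
- move=> k; apply: addcl_gen; exists (iota k), 1; split; first exact: sa_iota.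
    exact: sa1.
  by rewrite expr1n mulr1.
- by move=> x y; exact: addclD.
- by move=> x y; exact: frobM.
Defined.

Lemma sfrob_base G T e : sub_sa G (frob G T e).
Proof.
move=> g Gg; apply: addcl_gen; exists g, 1; split=> //; first exact: sa1.
by rewrite expr1n mulr1.
Qed.

Lemma frob_exp G T e t : T t -> frob G T e (t ^+ (p ^ e)).
Proof.
by move=> Tt; apply: addcl_gen; exists 1, t; split; rewrite ?mul1r //; exact: sa1.
Qed.

Lemma frob_least G T e U :
  sub_sa G U -> (forall t, T t -> U (t ^+ (p ^ e))) -> sub_sa (frob G T e) U.
Proof.
move=> GU TU w; apply: (@addcl_least _ _ U); [exact: sa0|exact: saD|].
by move=> _ [g [t [Gg Tt ->]]]; apply: saM; [exact: GU|exact: TU].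
Qed.

Lemma frob_mono G G' T T' e :
  sub_sa G G' -> sub_sa T T' -> sub_sa (frob G T e) (frob G' T' e).
Proof.
move=> GG TT; apply: frob_least => [g /GG|t /TT]; first exact: sfrob_base.
exact: frob_exp.
Qed.

Lemma frob_sub G T e : sub_sa G T -> sub_sa (frob G T e) T.
Proof. by move=> GT; apply: frob_least => // t Tt; exact: saX. Qed.

Lemma frobS G T e : sub_sa (frob G T e.+1) (frob G T e).
Proof.
apply: frob_least => [|t Tt]; first exact: sfrob_base.
by rewrite expnSr exprM; apply: saX; exact: frob_exp.
Qed.

Lemma frob_pexp G T e t : frob G T e t -> frob G T e.+1 (t ^+ p).
Proof.
elim=> [|_ v [g [u [Gg Tu ->]]] _ IH].
  rewrite expr0n (negPf (lt0n_neq0 (prime_gt0 (fa_prime W)))); exact: sa0.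
have := pexpD 1 (g * u ^+ (p ^ e)) v; rewrite expn1 => ->; apply: saD => //.
rewrite exprMn -exprM -expnSr; apply: saM; last exact: frob_exp.
by apply: sfrob_base; exact: saX.
Qed.

Lemma frob0 G T w : sub_sa G T -> frob G T 0 w <-> T w.
Proof.
move=> GT; split; first exact: frob_sub.
by move=> Tw; rewrite -[w]expr1; exact: (@frob_exp G T 0).
Qed.

Lemma scalars_sub S : sub_sa scalars S.
Proof. by move=> _ [k ->]; exact: sa_iota. Qed.

Definition has_pbasis (S T : subalg) : Prop :=
  exists n (x : 'I_n -> W), pbasis S T x.

(** For G = K this is what is retained of a truncated polynomial presentation
    ([trunc_frob_pbases]). *)
Definition frob_pbases (G T : subalg) : Prop :=
  forall e, has_pbasis (frob G T e.+1) (frob G T e).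

Lemma eq_has_pbasis S S' T T' :
  (forall w, S w <-> S' w) -> (forall w, T w <-> T' w) ->
  has_pbasis S T -> has_pbasis S' T'.
Proof. by move=> SS TT [n [x xP]]; exists n, x; exact: pbasis_eq xP. Qed.

Lemma eq_frob_pbases G G' T T' : (forall w, G w <-> G' w) -> (forall w, T w <-> T' w) ->
  frob_pbases G T -> frob_pbases G' T'.
Proof.
move=> GG TT H e; apply: eq_has_pbasis (H e) => w.
  by split; apply: frob_mono => u; [move/GG|move/TT|move/GG|move/TT].
by split; apply: frob_mono => u; [move/GG|move/TT|move/GG|move/TT].
Qed.

Lemma frob_pbases_proj T e : frob_pbases scalars T -> proj (frob scalars T e) T.
Proof.
move=> gT; have KT := scalars_sub T; elim: e => [|e IHe].
  exists unit, (fun=> 1), (fun _ w => w); split=> // [_|_ t Tt|t Tt].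
  - exact: sa1.
  - exact/frob0.
  - by rewrite big_const card_unit /= addr0 mulr1.
have [n [x xP]] := gT e; apply: proj_trans (pbasis_proj xP) IHe.
  exact: frobS.
exact: frob_sub.
Qed.

(** Since T^p lies in D, the filtrations interlace: K[T^(p^(e+1))] < K[D^(p^e)] < K[T^(p^e)].
    [exponent_one_intermediate] gives p-bases of both inclusions, and composing the two that meet at
    K[T^(p^(e+1))] gives a p-basis for each Frobenius step of D. *)
Proposition frob_pbases_descend T D :
  frob_pbases scalars T -> sub_sa (frob scalars T 1) D -> sub_sa D T ->
  proj D T -> (forall e, proj (frob scalars D e) D) ->
  frob_pbases scalars D /\ has_pbasis D T.
Proof.
move=> gT T1D DT pDT pD.
have TD e : sub_sa (frob scalars T e.+1) (frob scalars D e).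
  apply: frob_least => [|t Tt]; first exact: sfrob_base.
  rewrite expnS exprM; apply: frob_exp; apply: T1D.
  by have := @frob_exp scalars T 1 t Tt; rewrite expn1.
have DTe e : sub_sa (frob scalars D e) (frob scalars T e) by exact: frob_mono.
have inter e : has_pbasis (frob scalars T e.+1) (frob scalars D e) /\
               has_pbasis (frob scalars D e) (frob scalars T e).
  have [n [x xP]] := gT e.
  apply: exponent_one_intermediate xP; [exact: TD|exact: DTe|].
  apply: (@proj_summand _ _ _ _ T) => //.
  - by apply: frob_sub; exact: scalars_sub.
  - apply: (@proj_trans _ _ _ D) => //; apply: frob_sub; exact: scalars_sub.
  exact: frob_pbases_proj.
split=> [e|].
  have [[n [x xP]] _] := inter e; have [_ [m [z zP]]] := inter e.+1.
  by apply: pbasis_trans zP xP _ => t; exact: frob_pexp.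
have [_] := inter 0%N; apply: eq_has_pbasis => w; apply: frob0; exact: scalars_sub.
Qed.

(** Induction along D_e = B[W^(p^e)], starting from D_0 = W: as D_e^p lies in D_(e+1),
    [frob_pbases_descend] applies to D_(e+1) < D_e. *)
Theorem frob_tower_pbases B :
  frob_pbases scalars whole ->
  (forall e, proj (frob B whole e) whole) ->
  (forall e j, (0 < e)%N -> proj (frob scalars (frob B whole e) j) (frob B whole e)) ->
  forall e, frob_pbases scalars (frob B whole e) /\
            has_pbasis (frob B whole e.+1) (frob B whole e).
Proof.
move=> gW pW pD.
have step e : frob_pbases scalars (frob B whole e) ->
    frob_pbases scalars (frob B whole e.+1) /\
    has_pbasis (frob B whole e.+1) (frob B whole e).
  move=> ge; apply: frob_pbases_descend => //.
  - apply: frob_least => [|t]; first exact: scalars_sub.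
    by rewrite expn1; exact: frob_pexp.
  - exact: frobS.
  - by apply: (@proj_summand _ _ _ _ whole) => //; exact: frobS.
  by move=> j; apply: pD.
have g e : frob_pbases scalars (frob B whole e).
  elim: e => [|e IHe]; last by case: (step e IHe).
  by apply: eq_frob_pbases gW => w //; apply: iff_sym; apply: frob0.
by move=> e; split; [exact: g | case: (step e (g e))].
Qed.

End Towers.

(** * Nested monomial coordinates along a Frobenius filtration *)

Section Coordinates.
Variables (p : nat) (W : fibre_alg p).
Local Notation K := (fa_field W).
Local Notation iota := (iota W).
Local Notation eps := (eps W).
Local Notation subalg := (subalg W).
Implicit Types (S T G : subalg) (y z w : W).

(** Members are replaced one at a time. If d_i0 took no unit value on Z, the augmentation of d_i0
    would vanish on S[Z], hence on T, by the Leibniz rule, against d_i0 w_i0 = 1. *)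
Lemma pbasis_exchange S T m (w : 'I_m -> W) (Z : W -> Prop) :
  pbasis S T w -> sub_sa Z T -> sub_sa T (adj S Z) ->
  exists w' : 'I_m -> W, pbasis S T w' /\ forall i, Z (w' i).
Proof.
move=> wP ZT genZ.
suff H k : (k <= m)%N ->
    exists w' : 'I_m -> W, pbasis S T w' /\ forall i : 'I_m, (i < k)%N -> Z (w' i).
  by have [w' [w'P w'Z]] := H m (leqnn m); exists w'; split=> // i; exact: w'Z.
elim: k => [|k IHk] ltkm; first by exists w.
have [w' [[ST Tw TpS genT [d dual_d]] w'Z]] := IHk (ltnW ltkm).
have [dT dS dw] := dual_d; pose i0 := Ordinal ltkm.
have [z [Zz uz]] : exists z, Z z /\ eps (d i0 z) != 0.
  apply: contrapT => nz.
  have noz t : adj S Z t -> T t /\ eps (d i0 t) = 0.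
    have [_ dD dM] := dT i0.
    elim=> [s Ss|z Zz|a b _ [Ta a0] _ [Tb b0]|a b _ [Ta a0] _ [Tb b0]].
    - by rewrite dS // rmorph0; split=> //; exact: ST.
    - split; first exact: ZT.
      by apply/eqP/negP => /negP H; apply: nz; exists z.
    - by rewrite dD // rmorphD /= a0 b0 addr0; split=> //; exact: saD.
    by rewrite dM // rmorphD !rmorphM /= a0 b0 mul0r mulr0 addr0; split=> //; exact: saM.
  have [_ /eqP] := noz _ (genZ _ (Tw i0)).
  by rewrite dw eqxx rmorph1 oner_eq0.
exists (replace w' i0 z); split.
  exact: (pbasis_replace ST Tw TpS genT dual_d (ZT _ Zz)).
move=> i; rewrite ltnS leq_eqVlt /replace => /orP[/eqP ik|ltik].
  by rewrite (_ : i = i0) ?eqxx //; apply/val_inj.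
by case: eqP => // _; exact: w'Z.
Qed.

Section Tower.
Variables (G T : subalg) (E : nat).
Hypothesis GT : sub_sa G T.
Hypothesis TE : sub_sa (frob G T E) G.
Hypothesis pbT : forall e, has_pbasis (frob G T e.+1) (frob G T e).

Let p_gt0 : (0 < p)%N. Proof. exact: prime_gt0 (fa_prime W). Qed.
Let q_gt0 e : (0 < p ^ e)%N. Proof. by rewrite expn_gt0 p_gt0. Qed.

Lemma frob_le e e' : (e <= e')%N -> sub_sa (frob G T e') (frob G T e).
Proof.
move=> le_ee'; rewrite -(subnKC le_ee'); elim: (e' - e)%N => [|k IHk] w.
  by rewrite addn0.
by rewrite addnS => /frobS /IHk.
Qed.

Lemma bounded_exponent e e' h k :
  (e <= e')%N -> (p ^ e' * k < p ^ (e + h))%N -> h = 0%N -> k = 0%N.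
Proof.
move=> le_ee' + h0; rewrite h0 addn0; case: k => // k.
by rewrite mulnS ltnNge (leq_trans _ (leq_addr _ _)) // leq_pexp2l.
Qed.

Lemma frob_gen_pexp e Z :
  sub_sa (frob G T e) (adj (frob G T e.+1) Z) ->
  sub_sa (frob G T e.+1) (adj (frob G T e.+2) (fun w => exists2 z, Z z & w = z ^+ p)).
Proof.
move=> H; apply: (@frob_least _ _ _ _ _ (adj_sa (frob G T e.+2) _)).
  by move=> g Gg; apply: adj_base; exact: sfrob_base.
move=> t Tt; rewrite expnSr exprM.
elim: (H _ (@frob_exp _ _ G T e t Tt)) => [s /frob_pexp Ss|z Zz|a b _ IHa _ IHb|a b _ IHa _ IHb].
- exact: adj_base.
- by apply: adj_gen; exists z.
- have := pexpD 1 a b; rewrite expn1 => ->; exact: adjD.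
- by rewrite exprMn; exact: adjM.
Qed.

(** The number h i counts the levels, from e on, at which a p-power of x i belongs to the p-basis.
    Spanning is stated for all levels e' >= e at once because level h i is later needed to express x
    i^(p^h i) by p^h i-th powers; independence is stated at level e only. *)
Definition nested_coordinates n (x : 'I_n -> W) (h : 'I_n -> nat) e : Prop :=
  (forall e' t, (e <= e')%N -> frob G T e' t ->
     spanned (fun i => x i ^+ (p ^ e')) G
       (fun m => forall i, (p ^ e' * m i < p ^ (e + h i))%N) t) /\
  (forall (s : seq 'X_{1..n}) (g : 'X_{1..n} -> W), uniq s ->
     (forall m, m \in s -> forall i, (m i < p ^ h i)%N) -> (forall m, G (g m)) ->
     \sum_(m <- s) g m * mono (fun i => x i ^+ (p ^ e)) m = 0 ->
     forall m, m \in s -> g m = 0).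

(** Descending induction on the level, with k bounding its distance to E. If the x_(j l)^(p^e) form
    a p-basis at level e, their p-th powers generate the next level, so [pbasis_exchange] picks a
    p-basis there among them. Base-p digits of exponents then correspond to levels. *)
Lemma nested_coordinates_exist k e n (x : 'I_n -> W) m (j : 'I_m -> 'I_n) :
  (E <= e + k)%N -> injective j -> (forall i, T (x i)) ->
  pbasis (frob G T e.+1) (frob G T e) (fun i => x (j i) ^+ (p ^ e)) ->
  exists h : 'I_n -> nat,
    (forall i, (0 < h i)%N <-> exists l, i = j l) /\ nested_coordinates x h e.
Proof.
elim: k e n x m j => [|k IHk] e n x m j leE j_inj Tx.
  rewrite addn0 in leE; move=> [_ Tz _ _ [d [_ dS dz]]].
  have eG e' : (e <= e')%N -> sub_sa (frob G T e') G.
    move=> le_ee' w Hw; apply: TE; exact: (frob_le (leq_trans leE le_ee') Hw).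
  (* From level E on the algebra lies in G, so the p-basis is empty: a derivation that kills G
     cannot take the value 1. *)
  have m0 (l : 'I_m) : False.
    have /eqP : d l (x (j l) ^+ (p ^ e)) = 1 by rewrite dz eqxx.
    rewrite dS ?(eq_sym 0) ?oner_eq0 //; apply: sfrob_base; apply: (eG e) => //.
  exists (fun=> 0%N); split=> [i|]; first by split=> // -[l _]; case: (m0 l).
  split=> [e' t le_ee' Tt|s g us sP Gg].
    have Gt := eG _ le_ee' _ Tt; apply: addcl_gen; exists t, (fun=> 0%N); split=> // [i|].
      by rewrite muln0 addn0.
    by rewrite /mono big1 ?mulr1.
  have s0 a : a \in s -> a = 0%MM.
    move=> /sP a1; apply/mnmP => i; apply/eqP.
    by rewrite mnm0E -leqn0 -ltnS; exact: a1.
  move=> sum0 a sa; move: sum0; rewrite (big_rem a) //= big_seq big1 => [|b].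
    rewrite addr0 (s0 _ sa) /mono big1 ?mulr1 // => i _.
    by rewrite mnm0E.
  rewrite mem_rem_uniq // inE => /andP[/eqP ne sb].
  by case: ne; rewrite (s0 _ sa) (s0 _ sb).
move=> zP; set z := fun i => _ in zP.
have [m' [w wP]] := pbT e.+1.
pose Z w := exists l, w = x (j l) ^+ (p ^ e.+1).
have [||w' [w'P w'Z]] := @pbasis_exchange _ _ _ w Z wP.
- by move=> _ [l ->]; exact: frob_exp.
- have [_ _ _ gen_z _] := zP.
  move=> t /(frob_gen_pexp gen_z).
  apply: (@adj_least _ _ _ _ (adj_sa (frob G T e.+2) Z)) => [s Ss|_ [_ [l ->] ->]].
    exact: adj_base.
  by apply: adj_gen; exists l; rewrite -exprM -expnSr.
have /choice[u uE] : forall i, exists l, w' i = x (j l) ^+ (p ^ e.+1) by [].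
have u_inj : injective u.
  move=> a b uab; have [_ _ _ _ [d [_ _ dw]]] := w'P.
  have := dw a b; rewrite uE -uab -uE dw eqxx; case: eqP => // _ /eqP.
  by rewrite oner_eq0.
have ju_inj : injective (fun i => j (u i)) by move=> a b /j_inj /u_inj.
have [||h' [h'P [span' indep']]] := IHk e.+1 n x m' _ _ ju_inj Tx.
- by rewrite addSnnS.
- case: w'P => H1 H2 H3 H4 [d [d1 d2 d3]]; split=> //.
  + by move=> i; rewrite -uE.
  + move=> t /H4; apply: (@adj_least _ _ _ _ (adj_sa (frob G T e.+2) _)) => [s Ss|_ [i ->]].
      exact: adj_base.
    by apply: adj_gen; exists i; rewrite uE.
  by exists d; split=> // a b; rewrite -uE.
pose inj i := [pick l | j l == i].
have injP l : inj (j l) = Some l.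
  rewrite /inj; case: pickP => [l' /eqP /j_inj -> //|/(_ l)]; by rewrite eqxx.
have injN i : inj i = None -> ~ exists l, i = j l.
  by move=> iN [l il]; rewrite il injP in iN.
have h'0 i : inj i = None -> h' i = 0%N.
  move=> /injN iN; apply/eqP; rewrite -leqn0 leqNgt; apply/negP => /h'P[l il].
  by apply: iN; exists (u l).
(* Indices in the image of j gain one level; by [h'0] the others are absent from all deeper levels
   too. *)
pose h i := if inj i is Some _ then (h' i).+1 else 0%N.
pose tl (c : {ffun 'I_m -> 'I_p}) (i : 'I_n) : nat :=
  if inj i is Some l then nat_of_ord (c l) else 0%N.
have tlE (c : {ffun 'I_m -> 'I_p}) :
    mono z (fun l => c l) = mono (fun i => x i ^+ (p ^ e)) (tl c).
  rewrite /mono [RHS](bigID (fun i => inj i != None)) /= [X in _ * X]big1 ?mulr1.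
    rewrite (reindex_omap j inj) => [|i]; last first.
      by rewrite /inj; case: pickP => // l /eqP /= ->.
    apply: eq_big => [l|l _]; first by rewrite injP eqxx.
    by rewrite /tl injP.
  by move=> i; rewrite negbK /tl => /eqP ->.
have pmonoS f : mono (fun i => x i ^+ (p ^ e.+1)) f =
    mono (fun i => x i ^+ (p ^ e)) (fun i => p * f i)%N.
  by apply: eq_bigr => i _; rewrite expnSr exprM -exprM.
exists h; split=> [i|].
  rewrite /h; case Ei: (inj i) => [l|]; last by split=> // H; case: (injN i Ei).
  split=> // _; exists l; move: Ei; rewrite /inj; case: pickP => // l' /eqP <- [->] //.
split=> [e' t|s g us sP Gg sum0].
  rewrite leq_eqVlt => /orP[/eqP <-|lt_ee'] Tt; last first.
    apply: addcl_mono (span' e' t lt_ee' Tt) => _ [g [f [Gg fP ->]]].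
    exists g, f; split=> // i; have := fP i; rewrite /h.
    case Ei: (inj i) => [l|]; first by rewrite addSnnS.
    move=> H; rewrite (bounded_exponent lt_ee' H) ?muln0 ?addn0 //; exact: h'0.
  have [c [Sc ->]] := pbasis_span zP Tt; apply: addcl_sum => b _.
  rewrite tlE; move: (span' e.+1 _ (leqnn _) (Sc b)).
  apply: (@addcl_map _ _ _ _ (fun w => w * _)) => [|a a' _ _|_ [g [f [Gg fP ->]]]].
  - by rewrite mul0r.
  - by rewrite mulrDl.
  apply: addcl_gen; exists g, (fun i => p * f i + tl b i)%N; split=> // [i|]; last first.
    by rewrite -monoD mulrA pmonoS.
  have := fP i; rewrite /h /tl; case Ei: (inj i) => [l|] H; last first.
    rewrite (bounded_exponent (leqnn _) H) ?muln0 //; exact: h'0.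
  rewrite expnD ltn_pmul2l ?q_gt0 // expnS.
  move: H; rewrite expnD ltn_pmul2l ?q_gt0 // => H.
  rewrite (leq_trans (n := p * (f i).+1)) ?leq_mul2l ?H ?orbT //.
  by rewrite mulnS addnC ltn_add2r.
have supp (a : 'X_{1..n}) i : a \in s -> inj i = None -> a i = 0%N.
  move=> /sP /(_ i); rewrite /h => + Ei; rewrite Ei expn0 ltnS leqn0.
  by move/eqP.
(* Lowest base-p digit of an exponent vector, its remaining digits and their recombination. Grouped
   by lowest digit, the relation has coefficients that vanish by the p-basis at level e, and each of
   them is a relation at level e+1. *)
pose ga (a : 'X_{1..n}) : {ffun 'I_m -> 'I_p} :=
  [ffun l => Ordinal (ltn_pmod (a (j l)) p_gt0)].
pose be (a : 'X_{1..n}) : 'X_{1..n} := [multinom (a i %/ p)%N | i < n].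
pose re c (b : 'X_{1..n}) : 'X_{1..n} := [multinom (tl c i + p * b i)%N | i < n].
have reK a : a \in s -> re (ga a) (be a) = a.
  move=> sa; apply/mnmP => i; rewrite !mnmE /tl; case Ei: (inj i) => [l|].
    move: Ei; rewrite /inj; case: pickP => // l' /eqP <- [<-].
    by rewrite ffunE /= addnC mulnC -divn_eq.
  by rewrite (supp a i sa Ei) div0n muln0.
have monoE a : a \in s -> mono (fun i => x i ^+ (p ^ e)) a =
    mono (fun i => x i ^+ (p ^ e.+1)) (be a) * mono z (fun l => ga a l).
  move=> sa; rewrite -{1}(reK a sa) tlE pmonoS monoD.
  by apply: eq_bigr => i _; rewrite !mnmE addnC.
pose inner c := \sum_(a <- s | ga a == c) g a * mono (fun i => x i ^+ (p ^ e.+1)) (be a).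
have inner0 : forall c, inner c = 0.
  apply: (pbasis_independent zP) => [c|].
    apply: sa_sum => a _; apply: saM; first by apply: sfrob_base; exact: Gg.
    by apply: sa_mono => i; exact: frob_exp.
  rewrite -[RHS]sum0 [RHS](partition_big ga xpredT) //=.
  apply: eq_bigr => c _; rewrite mulr_suml big_seq_cond [RHS]big_seq_cond.
  by apply: eq_bigr => a /andP[sa /eqP <-]; rewrite (monoE a sa) mulrA.
move=> a sa.
have be_inj : {in [seq b <- s | ga b == ga a] &, injective be}.
  move=> b c; rewrite !mem_filter => /andP[/eqP gb sb] /andP[/eqP gc sc] bc.
  by rewrite -(reK b sb) -(reK c sc) gb gc bc.
have be_mem : be a \in map be [seq b <- s | ga b == ga a].
  by apply: map_f; rewrite mem_filter eqxx.
have := indep' (map be [seq b <- s | ga b == ga a]) (fun b => g (re (ga a) b)) _ _ _ _ _ be_mem.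
rewrite reK //; apply => //.
- by rewrite map_inj_in_uniq // filter_uniq.
- move=> _ /mapP[b + ->] i; rewrite mem_filter => /andP[_ sb]; rewrite mnmE.
  have := sP b sb i; rewrite /h; case Ei: (inj i) => [l|] H.
    by rewrite ltn_divLR // -expnSr.
  by rewrite (supp b i sb Ei) div0n q_gt0.
rewrite -[RHS](inner0 (ga a)) /inner big_map big_filter.
rewrite big_seq_cond [RHS]big_seq_cond; apply: eq_bigr => b /andP[sb /eqP gb].
by rewrite -gb reK.
Qed.

(** Z will be the set of images of ring elements: coordinates taken from Z can be lifted out of the
    fibre. *)
Theorem tower_coordinates (Z : W -> Prop) :
  (forall w, T w -> addcl (fun v => exists k z, Z z /\ v = iota k * z) w) ->
  sub_sa Z T ->
  exists n (x : 'I_n -> W) (h : 'I_n -> nat),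
  [/\ forall i, Z (x i), forall i, (0 < h i)%N
    & nested_coordinates x h 0].
Proof.
move=> spanZ ZT; have [n [w wP]] := pbT 0.
have [||x [xP Zx]] := @pbasis_exchange _ _ _ w Z wP.
- by move=> z /ZT Tz; exact/frob0.
- move=> t /(frob_sub GT)/spanZ.
  apply: (@addcl_least _ _ (adj (frob G T 1) Z)).
  + exact: (sa0 (adj_sa _ _)).
  + exact: adjD.
  move=> _ [k [z [Zz ->]]]; apply: adjM; last exact: adj_gen.
  by apply: adj_base; exact: sa_iota.
have Tx i : T (x i) by exact: ZT.
have [h [hP coord]] :=
  @nested_coordinates_exist E 0 n x n id (leqnn E) (@inj_id _) Tx xP.
by exists n, x, h; split=> // i; apply/hP; exists i.
Qed.

End Tower.
End Coordinates.

(** * Fibres of a purely inseparable extension *)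

Section Residue.
Variable R : comNzRingType.

Definition ideal (J : R -> Prop) : Prop :=
  [/\ J 0, ~ J 1, forall x y, J x -> J y -> J (x + y) & forall a x, J x -> J (a * x)].

Lemma maximal_ideal_exists (J : R -> Prop) : ideal J ->
  exists M : R -> Prop, [/\ ideal M, forall x, J x -> M x
    & forall x, ~ M x -> exists a m, M m /\ a * x + m = 1].
Proof.
move=> idJ.
pose T := {M : R -> Prop | ideal M /\ forall x, J x -> M x}.
pose le (s t : T) : bool := `[< forall x, sval s x -> sval t x >].
have t0 : T by exists J; split.
have [|r s t|A totA|[M [idM JM]] maxM] := @classical_sets.ZL_preorder T t0 le.
- by move=> t; apply/asboolP.
- by move=> /asboolP rs /asboolP st; apply/asboolP => x /rs /st.
- have [[s0 As0]|noA] := pselect (exists s, A s); last first.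
    by exists t0 => s As; case: noA; exists s.
  pose U x := exists2 s, A s & sval s x.
  have idU : ideal U.
    split.
    + by exists s0 => //; case: (svalP s0) => -[].
    + by move=> [s _ s1]; case: (svalP s) => -[].
    + move=> x y [s As sx] [t At ty].
      have [/asboolP st|/asboolP ts] := totA s t As At.
        by exists t => //; case: (svalP t) => -[_ _ tD _] _; apply: tD => //; exact: st.
      by exists s => //; case: (svalP s) => -[_ _ sD _] _; apply: sD => //; exact: ts.
    + move=> a x [s As sx]; exists s => //.
      by case: (svalP s) => -[_ _ _ sM] _; exact: sM.
  have JU x : J x -> U x by move=> Jx; exists s0 => //; case: (svalP s0) => _; apply.
  by exists (exist _ U (conj idU JU)) => s As; apply/asboolP => x sx; exists s.
exists M; split=> // x nMx; apply: contrapT => nunit.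
have [M0 M1 MD MM] := idM.
pose N y := exists a m, M m /\ a * x + m = y.
have idN : ideal N.
  split=> //.
  - by exists 0, 0; rewrite mul0r addr0.
  - move=> _ _ [a [m [Mm <-]]] [b [n [Mn <-]]]; exists (a + b), (m + n).
    by split; [exact: MD | ring].
  - move=> b _ [a [m [Mm <-]]]; exists (b * a), (b * m).
    by split; [exact: MM | ring].
have MN y : M y -> N y by move=> My; exists 0, y; rewrite mul0r add0r.
have JN y : J y -> N y by move=> /JM /MN.
have /asboolP NM := maxM (exist _ N (conj idN JN)) (asboolT (MN : forall y, _ -> _)).
by apply: nMx; apply: NM; exists 1, 0; rewrite mul1r addr0.
Qed.

Variables (M : R -> Prop) (idM : ideal M).
Hypothesis maxM : forall x, ~ M x -> exists a m, M m /\ a * x + m = 1.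

(** The hypotheses are arguments so that the ideal and field structures can be attached to the
    predicate and to its quotient. *)
Definition max_pred of ideal M & (forall x, ~ M x -> exists a m, M m /\ a * x + m = 1)
  : {pred R} := fun x => `[< M x >].

Lemma max_pred_closed : idealr_closed (max_pred idM maxM).
Proof.
have [M0 M1 MD MM] := idM; split.
- exact/asboolP.
- exact/asboolP.
by move=> a x y /asboolP Mx /asboolP My; apply/asboolP; apply: MD => //; exact: MM.
Qed.

HB.instance Definition _ := isIdealr.Build R (max_pred idM maxM) max_pred_closed.

Definition residue : Type := {ideal_quot (max_pred idM maxM)}.
HB.instance Definition _ := GRing.ComNzRing.on residue.

Definition residue_pi (x : R) : residue := \pi_{ideal_quot (max_pred idM maxM)} x.

Lemma residue_pi_eq0 x : residue_pi x = 0 <-> M x.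
Proof.
rewrite /residue_pi; split=> [/eqP|Mx].
  rewrite -[0]/(0 : {ideal_quot (max_pred idM maxM)}) -(rmorph0 \pi_{ideal_quot (max_pred idM maxM)}).
  by rewrite -Quotient.idealrBE subr0 => /asboolP.
apply/eqP; rewrite -(rmorph0 \pi_{ideal_quot (max_pred idM maxM)}).
by rewrite -Quotient.idealrBE subr0; apply/asboolP.
Qed.

Lemma residue_pi_zmod_morphism : zmod_morphism residue_pi.
Proof. by move=> x y; rewrite /residue_pi rmorphB. Qed.

Lemma residue_pi_monoid_morphism : monoid_morphism residue_pi.
Proof. by split=> [|x y]; rewrite /residue_pi ?rmorph1 ?rmorphM. Qed.

HB.instance Definition _ := GRing.isZmodMorphism.Build R residue residue_pi
  residue_pi_zmod_morphism.
HB.instance Definition _ := GRing.isMonoidMorphism.Build R residue residue_pi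
  residue_pi_monoid_morphism.

Lemma residue_inv_exists (x : residue) :
  exists y, (x != 0 -> y * x = 1) /\ (x = 0 -> y = 0).
Proof.
have [x0|/eqP nx0] := eqVneq x 0; first by exists 0.
have xE : x = residue_pi (repr x) by rewrite /residue_pi reprK.
have [|a [m [Mm E]]] := maxM (x := repr x).
  by move=> /residue_pi_eq0; rewrite -xE.
exists (residue_pi a); split=> // _; rewrite {1}xE -rmorphM /=.
rewrite -(rmorph1 residue_pi) -E rmorphD /=.
by have -> : residue_pi m = 0; [exact/residue_pi_eq0 | rewrite addr0].
Qed.

Definition residue_inv (x : residue) : residue := sval (cid (residue_inv_exists x)).

Lemma residue_mulVf (x : residue) : x != 0 -> residue_inv x * x = 1.
Proof. by rewrite /residue_inv; case: (cid _) => y []. Qed.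

Lemma residue_inv0 : residue_inv 0 = 0.
Proof. by rewrite /residue_inv; case: (cid _) => y [_ H] /=; exact: H. Qed.

HB.instance Definition _ := GRing.ComNzRing_isField.Build residue
  residue_mulVf residue_inv0.

End Residue.

Lemma residue_field_exists (R : comNzRingType) (J : R -> Prop) : ideal J ->
  exists (K : fieldType) (f : {rmorphism R -> K}), forall x, J x -> f x = 0.
Proof.
move=> /maximal_ideal_exists[M [idM JM maxM]].
exists (residue idM maxM), (residue_pi idM maxM : {rmorphism R -> residue idM maxM}).
by move=> x /JM Mx; apply/residue_pi_eq0.
Qed.

(** * Tensor products and faithful flatness *)

Section TensorFacts.
Variables (R : comPzRingType) (M N : lmodType R).

Lemma tens0r (m : M) : tens m (0 : N) = 0.
Proof. by apply: (addrI (tens m 0)); rewrite -tensDr !addr0. Qed.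

Lemma tens0l (n : N) : tens (0 : M) n = 0.
Proof. by apply: (addrI (tens 0 n)); rewrite -tensDl !addr0. Qed.

Lemma tens_suml (J : Type) (s : seq J) (E : J -> M) (n : N) :
  tens (\sum_(j <- s) E j) n = \sum_(j <- s) tens (E j) n.
Proof.
by elim: s => [|j s IHs]; rewrite ?big_nil ?tens0l // !big_cons tensDl IHs.
Qed.

Lemma tensor_lift0 (V : zmodType) (b : M -> N -> V) : balanced b -> tensor_lift b 0 = 0.
Proof.
move=> bb; have := tensor_liftB bb 0 0; rewrite !subrr; exact.
Qed.

Lemma tensor_lift_sum (V : zmodType) (b : M -> N -> V) (J : Type) (s : seq J)
    (E : J -> tensor M N) : balanced b ->
  tensor_lift b (\sum_(j <- s) E j) = \sum_(j <- s) tensor_lift b (E j).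
Proof.
move=> bb; elim: s => [|j s IHs]; first by rewrite !big_nil tensor_lift0.
by rewrite !big_cons tensor_liftD // IHs.
Qed.

End TensorFacts.

Section TensorMap.
Variables (R : comPzRingType) (M N1 N2 : lmodType R) (g : {linear N1 -> N2}).

Lemma tensor_map_balanced : balanced (fun (m : M) n => tens m (g n)).
Proof.
split=> [n m1 m2|m n1 n2|a m n]; first by rewrite tensDl.
  by rewrite linearD tensDr.
by rewrite linearZ tensZ.
Qed.

Lemma tensor_mapE (m : M) n : tensor_map g (tens m n) = tens m (g n).
Proof. exact: tensor_liftE tensor_map_balanced m n. Qed.

Lemma tensor_mapB : {morph tensor_map (M := M) g : x y / x - y}.
Proof. exact: tensor_liftB tensor_map_balanced. Qed.

Lemma tensor_map_sum (J : Type) (s : seq J) (E : J -> tensor M N1) :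
  tensor_map g (\sum_(j <- s) E j) = \sum_(j <- s) tensor_map g (E j).
Proof. exact: tensor_lift_sum tensor_map_balanced. Qed.

End TensorMap.

Section FaithfullyFlatProper.
Variables (R : comPzRingType) (n : nat) (m : 'I_n -> R).

Definition row_comb (v : 'rV[R]_n) : R^o := \sum_i v 0 i * m i.

Lemma row_comb_linear : linear row_comb.
Proof.
move=> a u v; rewrite /row_comb scaler_sumr -big_split; apply: eq_bigr => i _.
by rewrite !mxE mulrDl -mulrA.
Qed.

HB.instance Definition _ := GRing.isLinear.Build R 'rV[R]_n R^o _ row_comb
  row_comb_linear.

Definition zero_map (v : R^o) : R^o := 0.

Lemma zero_map_linear : linear zero_map.
Proof. by move=> a u v; rewrite /zero_map scaler0 addr0. Qed.

HB.instance Definition _ := GRing.isLinear.Build R R^o R^o _ zero_map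
  zero_map_linear.

(** The m_i generate R exactly when R^n -> R -> 0 is exact, the zero map R -> R standing for R -> 0.
    The hypothesis makes the sequence exact after tensoring with S, and faithful flatness reflects
    this. *)
Lemma faithfully_flat_unit_ideal (S : comPzRingType) (phi : {rmorphism R -> S})
    (a : 'I_n -> S) :
  faithfully_flat phi -> \sum_i phi (m i) * a i = 1 ->
  exists v : 'I_n -> R, \sum_i v i * m i = 1.
Proof.
move=> ff a1; pose Sf := restr_scalars phi.
have [_ H] := ff _ _ _ (row_comb : {linear 'rV[R]_n -> R^o})
                       (zero_map : {linear R^o -> R^o}).
have ex : exact_seq (row_comb : {linear 'rV[R]_n -> R^o})
                    (zero_map : {linear R^o -> R^o}).
  apply: H => y; split=> _.
    elim/tensorW: y => [s r|x y [x' <-] [y' <-]]; last first.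
      by exists (x' - y'); rewrite tensor_mapB.
    exists (\sum_i tens (s * phi r * a i : Sf) (delta_mx 0 i)).
    rewrite tensor_map_sum.
    transitivity (\sum_i tens (phi (m i) * a i * (s * phi r) : Sf) (1 : R^o)).
      apply: eq_bigr => i _; rewrite tensor_mapE /=.
      have -> : row_comb (delta_mx 0 i) = m i *: (1 : R^o).
        rewrite /row_comb (bigD1 i) //= mxE !eqxx mul1r big1 ?addr0.
          by rewrite /GRing.scale /= mulr1.
        by move=> j ne; rewrite mxE (negPf ne) andbF mul0r.
      rewrite -tensZ; congr (tens _ _).
      by rewrite /GRing.scale /= /restr_scale; ring.
    rewrite -tens_suml -mulr_suml a1 mul1r.
    have -> : s * phi r = r *: s by rewrite /GRing.scale /= /restr_scale mulrC.
    by rewrite tensZ; congr (tens _ _); rewrite /GRing.scale /= mulr1.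
  elim/tensorW: y => [s r|x y x0 y0]; first by rewrite tensor_mapE tens0r.
  by rewrite tensor_mapB x0 y0 subrr.
have [|v vE] := (ex (1 : R^o)).1; first by [].
by exists (fun i => v 0 i).
Qed.

End FaithfullyFlatProper.

(** * Truncated polynomial algebras *)

Section TruncatedRing.
Variables (R : comNzRingType) (n : nat) (d : 'I_n -> nat).
Hypothesis d_gt0 : forall i, (0 < d i)%N.
Local Notation T := (trunc_mpoly R d_gt0).

Definition trunc_pi : {rmorphism {mpoly R[n]} -> T} :=
  \pi_{ideal_quot (trunc_ideal d_gt0)}.

Lemma trunc_pi_eq0 g :
  trunc_pi g = 0 <-> (forall m : 'X_{1..n}, reduced d m -> g@_m = 0).
Proof.
rewrite -in_ideal_truncP; have -> : (0 : T) = trunc_pi 0 by rewrite rmorph0.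
split=> [/eqP|H]; first by rewrite -Quotient.idealrBE subr0 => /trunc_idealP.
by apply/eqP; rewrite -Quotient.idealrBE subr0; apply/trunc_idealP.
Qed.

Lemma trunc_reprK (w : T) : trunc_pi (repr w) = w.
Proof. exact: reprK. Qed.

Lemma trunc_pi_surj (w : T) : exists g, w = trunc_pi g.
Proof. by exists (repr w); rewrite trunc_reprK. Qed.

Lemma trunc_const_pi a : trunc_const d_gt0 a = trunc_pi a%:MP.
Proof. by []. Qed.

Lemma trunc_piX i : trunc_pi 'X_i ^+ d i = 0.
Proof.
rewrite -rmorphXn; apply/trunc_pi_eq0; apply/in_ideal_truncP.
exact: (in_ideal_gen (fun i => 'X_i ^+ d i)).
Qed.

Section Lift.
Variables (S : comPzRingType) (h : {rmorphism {mpoly R[n]} -> S}).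
Hypothesis hX : forall i, h 'X_i ^+ d i = 0.

(** Universal property of the quotient, by evaluation at the chosen representative. The proof is an
    argument so that the morphism structures can be attached. *)
Definition trunc_lift of (forall i, h 'X_i ^+ d i = 0) := fun w : T => h (repr w).

Lemma trunc_liftE g : trunc_lift hX (trunc_pi g) = h g.
Proof.
apply/eqP; rewrite -subr_eq0 /trunc_lift -rmorphB; apply/eqP.
have /trunc_pi_eq0/in_ideal_truncP[c ->] :
    trunc_pi (repr (trunc_pi g) - g) = 0 by rewrite rmorphB trunc_reprK subrr.
by rewrite rmorph_sum big1 // => i _; rewrite rmorphM rmorphXn hX mulr0.
Qed.

Lemma trunc_lift_zmod_morphism : zmod_morphism (trunc_lift hX).
Proof.
move=> x y; have [g ->] := trunc_pi_surj x; have [k ->] := trunc_pi_surj y.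
by rewrite -rmorphB !trunc_liftE rmorphB.
Qed.

Lemma trunc_lift_monoid_morphism : monoid_morphism (trunc_lift hX).
Proof.
split=> [|x y]; first by rewrite -(rmorph1 trunc_pi) trunc_liftE rmorph1.
have [g ->] := trunc_pi_surj x; have [k ->] := trunc_pi_surj y.
by rewrite -rmorphM !trunc_liftE rmorphM.
Qed.

HB.instance Definition _ := GRing.isZmodMorphism.Build T S (trunc_lift hX)
  trunc_lift_zmod_morphism.
HB.instance Definition _ := GRing.isMonoidMorphism.Build T S (trunc_lift hX)
  trunc_lift_monoid_morphism.

End Lift.

Lemma mcoeff_prod_low (s : seq {mpoly R[n]}) : (forall g, g \in s -> g@_0%MM = 0) ->
  forall m : 'X_{1..n}, (mdeg m < size s)%N -> (\prod_(g <- s) g)@_m = 0.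
Proof.
elim: s => // g s IHs s0 m ltm; rewrite big_cons mcoeffM big1 // => -[k l] /= /eqP mE.
have [k0|nk] := eqVneq (k : 'X_{1..n}) 0%MM.
  by rewrite k0 s0 ?mul0r // mem_head.
rewrite IHs ?mulr0 // => [h hs|]; first by rewrite s0 // inE hs orbT.
have mdegE : mdeg m = (mdeg k + mdeg l)%N by rewrite [in LHS]mE mdegD.
have H : (mdeg k + mdeg l < (size s).+1)%N by rewrite -mdegE.
rewrite -ltnS (leq_trans _ H) //.
by rewrite ltnS -[X in (X <= _)%N]add1n leq_add2r lt0n mdeg_eq0.
Qed.

(** The product has only monomials of degree above sum_i d_i, and no reduced monomial has such a
    degree. *)
Lemma trunc_nilpotent (s : seq T) : size s = (\sum_i d i).+1 ->
  (forall w, w \in s -> exists2 g, w = trunc_pi g & g@_0%MM = 0) ->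
  \prod_(w <- s) w = 0.
Proof.
move=> szs sP; have [r [rE r0]] : exists r : seq {mpoly R[n]},
    s = map trunc_pi r /\ forall g, g \in r -> g@_0%MM = 0.
  elim: (s) sP => [|w t IHt] tP; first by exists [::].
  have [|r [-> r0]] := IHt; first by move=> v vt; apply: tP; rewrite inE vt orbT.
  have [g -> g0] := tP w (mem_head _ _).
  by exists (g :: r); split=> // h; rewrite inE => /orP[/eqP -> //|/r0].
rewrite rE big_map -rmorph_prod; apply/trunc_pi_eq0 => m /reducedP redm.
apply: mcoeff_prod_low => //; have -> : size r = (\sum_i d i).+1.
  by rewrite -szs rE size_map.
by rewrite ltnS mdegE leq_sum // => i _; exact: ltnW.
Qed.

End TruncatedRing.

Section TruncatedFibre.
Variables (p : nat) (p_pr : prime p) (K : fieldType) (n : nat) (e : 'I_n -> nat).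
Hypotheses (charK : p \in [pchar K]) (e_gt0 : forall i, (0 < e i)%N).

Let d_gt0 i := prime_exp_gt0 p_pr (e i).
Local Notation T := (trunc_mpoly K d_gt0).
Local Notation d := (fun i => p ^ e i)%N.

Definition trunc_iota : {rmorphism K -> T} := trunc_pi K d_gt0 \o @mpolyC n K.

Lemma mcoeff0_X i : mcoeff 0%MM ('X_i : {mpoly K[n]}) ^+ d i = 0.
Proof.
rewrite mcoeffX; case: eqP => [/(congr1 mdeg)|_]; first by rewrite mdeg1 mdeg0.
by rewrite expr0n gtn_eqF.
Qed.

Definition trunc_eps : {rmorphism T -> K} :=
  @trunc_lift K n d d_gt0 K (mcoeff 0%MM) mcoeff0_X.

Lemma trunc_epsK k : trunc_eps (trunc_iota k) = k.
Proof.
by rewrite [LHS](trunc_liftE d_gt0 mcoeff0_X k%:MP) /= mcoeffC eqxx mulr1.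
Qed.

Lemma trunc_fibre_nil (s : seq T) : size s = (\sum_i d i).+1 ->
  (forall w, w \in s -> trunc_eps w = 0) -> \prod_(w <- s) w = 0.
Proof.
move=> szs s0; apply: trunc_nilpotent => // w /s0.
have [g ->] := trunc_pi_surj w; rewrite [trunc_eps _](trunc_liftE d_gt0 mcoeff0_X g).
by exists g.
Qed.

Definition trunc_fibre : fibre_alg p :=
  FibreAlg charK trunc_epsK trunc_fibre_nil.

Let x (i : 'I_n) : trunc_fibre := trunc_pi K d_gt0 'X_i.
Local Notation frobW j := (frob (scalars trunc_fibre) (whole trunc_fibre) j).

(** Substitution of x_i^(p^j) for the variables, a parametrization of K[W^(p^j)] by polynomials
    whose kernel is again spanned by monomials ([frob_eval_eq0]). *)
Definition frob_eval (j : nat) (g : {mpoly K[n]}) : trunc_fibre :=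
  mmap trunc_iota (fun i => x i ^+ (p ^ j)) g.

Lemma frob_evalE j g : frob_eval j g =
  trunc_pi K d_gt0 (\sum_(m <- msupp g) g@_m *: 'X_[m *+ (p ^ j)]).
Proof.
rewrite rmorph_sum; apply: eq_bigr => m _ /=; rewrite -mul_mpolyC rmorphM.
congr (_ * _); rewrite /mmap1 mpolyXE_id rmorph_prod; apply: eq_bigr => i _.
by rewrite mulmnE mulnC exprM rmorphXn rmorphXn.
Qed.

Lemma frob_eval_eq0 j g : frob_eval j g = 0 <->
  (forall m : 'X_{1..n}, (forall i, (m i * p ^ j < p ^ e i)%N) -> g@_m = 0).
Proof.
have coefE m : (\sum_(k <- msupp g) g@_k *: 'X_[k *+ (p ^ j)])@_(m *+ (p ^ j)) = g@_m.
  rewrite raddf_sum /= [RHS](congr1 (mcoeff m) (mpolyE g)) raddf_sum /=.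
  apply: eq_bigr => k _; rewrite !mcoeffZ !mcoeffX; congr (_ * (_ : bool)%:R).
  apply/eqP/eqP => [/mnmP H|-> //]; apply/mnmP => i; have := H i.
  by rewrite !mulmnE => /eqP; rewrite eqn_pmul2r ?prime_exp_gt0 // => /eqP.
rewrite frob_evalE trunc_pi_eq0; split=> [H m redm|H m redm].
  by rewrite -coefE H //; apply/reducedP => i; rewrite mulmnE.
rewrite raddf_sum /= big1 // => k _; rewrite mcoeffZ mcoeffX.
case: eqP => [km|_]; last by rewrite mulr0.
rewrite H ?mul0r // => i; move/reducedP: redm => /(_ i).
by rewrite -km mulmnE.
Qed.

Lemma frob_eval_surj j w : frobW j w -> exists g, w = frob_eval j g.
Proof.
elim=> [|_ v [_ [t [[k ->] _ ->]]] _ [h ->]].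
  by exists 0; rewrite /frob_eval mmap0.
have [g ->] : exists g, t = frob_eval 0 g.
  have [g ->] := trunc_pi_surj t; exists g; rewrite frob_evalE; congr (trunc_pi _ _ _).
  by rewrite {1}[g]mpolyE; apply: eq_bigr => m _; rewrite mulm1n.
pose gp := \sum_(m <- msupp g) g@_m ^+ (p ^ j) *: 'X_[m].
exists (k *: gp + h); rewrite /frob_eval mmapD mmapZ; congr (_ * _ + _).
rewrite /frob_eval {1}/mmap pexp_sum raddf_sum /=; apply: eq_bigr => m _.
rewrite mmapZ mmapX exprMn (rmorphXn trunc_iota); congr (_ * _).
by rewrite /mmap1 -prodrXl; apply: eq_bigr => i _; rewrite expr1 exprAC.
Qed.

Lemma frob_evalX j i : frob_eval j 'X_i = x i ^+ (p ^ j).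
Proof. by rewrite /frob_eval mmapX mmap1U. Qed.

Lemma frob_evalC j c : frob_eval j c%:MP = trunc_iota c.
Proof. by rewrite /frob_eval mmapC. Qed.

Lemma frob_evalS j g :
  frob_eval j.+1 g = frob_eval j (\sum_(m <- msupp g) g@_m *: 'X_[m *+ p]).
Proof.
rewrite /frob_eval {1}/mmap raddf_sum /=; apply: eq_bigr => m _.
rewrite mmapZ mmapX; congr (_ * _); apply: eq_bigr => i _.
by rewrite mulmnE mulnC expnSr !exprM.
Qed.

(** A monomial of the kernel can leave it under differentiation only if its exponent at i is p^(e_i
    - j), which is divisible by p because j < e_i. *)
Lemma frob_eval_deriv0 j g i : (j < e i)%N ->
  frob_eval j g = 0 -> frob_eval j g^`M(i) = 0.
Proof.
move=> ltj /frob_eval_eq0 g0; apply/frob_eval_eq0 => m redm.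
rewrite mcoeff_mderiv.
have [ltm|] := ltnP ((m i).+1 * p ^ j)%N (p ^ e i)%N.
  rewrite g0 ?mul0rn // => k; rewrite mnmDE mnm1E.
  by case: eqVneq => [<-|_]; rewrite ?addn1 ?addn0.
rewrite -{1}(subnKC (ltnW ltj)) expnD mulnC leq_pmul2r ?prime_exp_gt0 // => lem.
have /eqP mE : (m i).+1 == (p ^ (e i - j))%N.
  rewrite eqn_leq lem andbT; move: (redm i).
  by rewrite -{1}(subnKC (ltnW ltj)) expnD mulnC ltn_pmul2l ?prime_exp_gt0.
rewrite mE -(prednK (n := e i - j)) ?subn_gt0 // expnS mulrnA.
by rewrite (mulrn_pchar charK) mul0rn.
Qed.

(** The p-basis at level j consists of the x_i^(p^j) with j < e_i, the others being zero. Its dual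
    derivations are the formal partial derivatives, which descend to K[W^(p^j)] by
    [frob_eval_deriv0]. *)
Lemma trunc_frob_pbases : frob_pbases (scalars trunc_fibre) (whole trunc_fibre).
Proof.
move=> j; pose J := [set i : 'I_n | (j < e i)%N].
have Jv (l : 'I_#|J|) : (j < e (enum_val l))%N by have := enum_valP l; rewrite inE.
pose y (l : 'I_#|J|) := x (enum_val l) ^+ (p ^ j).
have evB g h : frob_eval j (g - h) = frob_eval j g - frob_eval j h.
  by rewrite /frob_eval raddfB.
have evD g h : frob_eval j (g + h) = frob_eval j g + frob_eval j h.
  by rewrite /frob_eval raddfD.
have evM g h : frob_eval j (g * h) = frob_eval j g * frob_eval j h.
  by rewrite /frob_eval rmorphM.
have ev_in g : frobW j (frob_eval j g).
  elim/mpoly_ring_ind: g => [c|i|g h Hg Hh|g h Hg Hh].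
  - by rewrite frob_evalC; exact: (sa_iota (frobW j) c).
  - by rewrite frob_evalX; apply: frob_exp.
  - by rewrite evD; apply: saD.
  - by rewrite evM; apply: saM.
have /choice[sel selP] w : exists g, frobW j w -> w = frob_eval j g.
  have [/frob_eval_surj[g ->]|nw] := pselect (frobW j w); first by exists g.
  by exists 0.
pose d (l : 'I_#|J|) w := frob_eval j (sel w)^`M(enum_val l).
have dE l g : d l (frob_eval j g) = frob_eval j g^`M(enum_val l).
  apply/eqP; rewrite -subr_eq0 -evB -mderivB; apply/eqP.
  by apply: frob_eval_deriv0 => //; rewrite evB -selP ?subrr.
exists #|J|, y; split.
- exact: frobS.
- by move=> l; apply: frob_exp.
- by move=> t; exact: frob_pexp.
- move=> t /frob_eval_surj[g ->].
  elim/mpoly_ring_ind: g => [c|i|g h Hg Hh|g h Hg Hh].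
  + by rewrite frob_evalC; apply: adj_base; exact: (sa_iota (frobW j.+1) c).
  + rewrite frob_evalX; have [iJ|] := boolP (i \in J).
      by apply: adj_gen; exists (enum_rank_in iJ i); rewrite /y enum_rankK_in.
    rewrite inE -leqNgt => le_ej; apply: adj_base.
    have -> : x i ^+ (p ^ j) = 0.
      rewrite -(subnKC le_ej) expnD exprM [x i ^+ _]trunc_piX expr0n.
      by rewrite gtn_eqF ?prime_exp_gt0.
    exact: (sa0 (frobW j.+1)).
  + by rewrite evD; apply: adjD.
  + by rewrite evM; apply: adjM.
exists d; split=> [l|l s /frob_eval_surj[g ->]|l k].
- split=> [_ /frob_eval_surj[g ->]|_ _ /frob_eval_surj[g ->] /frob_eval_surj[h ->]
          |_ _ /frob_eval_surj[g ->] /frob_eval_surj[h ->]].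
  + by rewrite dE.
  + by rewrite -evD !dE mderivD evD.
  + by rewrite -evM !dE mderivM evD !evM.
- rewrite frob_evalS dE raddf_sum /= big1 ?/frob_eval ?mmap0 // => m _.
  by rewrite mderivZ mderivX mulmnE natrM (pcharf0 charK) mulr0 scale0r scaler0.
rewrite /y -frob_evalX dE mderivX mnm1E (inj_eq enum_val_inj) eq_sym.
have [->|_] := eqVneq l k; last by rewrite scale0r /frob_eval mmap0.
rewrite scale1r (_ : (U_(enum_val k) - U_(enum_val k))%MM = 0%MM).
  by rewrite mpolyX0 -(mpolyC1 n K) frob_evalC rmorph1.
by apply/mnmP => i; rewrite mnmBE subnn mnm0E.
Qed.

End TruncatedFibre.

(** * Localizations and the fibre at a prime *)

Section LocalizationMap.
Variables (A C : comNzRingType) (f : {rmorphism A -> C}) (P : prime_idealr A).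
Local Notation CP := (localization f P).

Definition loc_in (c : C) : CP := mk_frac f c (prime_notin1 P).

Lemma loc_in_zmod_morphism : zmod_morphism loc_in.
Proof.
move=> c d; rewrite -[- loc_in d]/(loc_opp _) loc_oppE -[RHS]/(loc_add _ _).
by rewrite loc_addE; apply: loc_eq; rewrite !(rmorph1, mulr1).
Qed.

Lemma loc_in_monoid_morphism : monoid_morphism loc_in.
Proof.
split=> [|c d] //; rewrite -[RHS]/(loc_mul _ _) loc_mulE; apply: loc_eq.
by rewrite !(rmorph1, mulr1).
Qed.

HB.instance Definition _ := GRing.isZmodMorphism.Build C CP loc_in
  loc_in_zmod_morphism.
HB.instance Definition _ := GRing.isMonoidMorphism.Build C CP loc_in
  loc_in_monoid_morphism.

Lemma loc_in_frac c s (sI : s \notin (P : {pred A})) :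
  loc_in (f s) * mk_frac f c sI = loc_in c.
Proof.
rewrite -[LHS]/(loc_mul _ _) loc_mulE; apply: loc_eq.
by rewrite !(rmorph1, mulr1, mul1r) mulrC.
Qed.

Lemma loc_in_eq0 c : loc_in c = 0 ->
  exists2 u : A, u \notin (P : {pred A}) & f u * c = 0.
Proof.
move=> /mk_frac_inj[u uI H]; exists u => //.
by move: H; rewrite /= !rmorph1 !mulr1 mulr0.
Qed.

End LocalizationMap.

Lemma loc_map_in (A C : comNzRingType) (f : {rmorphism A -> C}) (P : prime_idealr A) a :
  loc_map f P (loc_in idfun P a) = loc_in f P (f a).
Proof. exact: loc_mapE. Qed.

Section TensorInclusions.
Variables (R S1 S2 : comPzRingType).
Variables (f1 : {rmorphism R -> S1}) (f2 : {rmorphism R -> S2}).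
Local Notation T := (tensor_ring f1 f2).

Definition tensor_inl (a : S1) : T :=
  tens (a : restr_scalars f1) (1 : restr_scalars f2).

Lemma tensor_inl_zmod_morphism : zmod_morphism tensor_inl.
Proof.
move=> a b; apply/eqP; rewrite eq_sym subr_eq; apply/eqP.
by rewrite -[RHS]tensDl subrK.
Qed.

Lemma tensor_inl_monoid_morphism : monoid_morphism tensor_inl.
Proof. by split=> [//|a b]; rewrite -[RHS]/(tensor_mul _ _) tensor_mulE mul1r. Qed.

HB.instance Definition _ := GRing.isZmodMorphism.Build S1 T tensor_inl
  tensor_inl_zmod_morphism.
HB.instance Definition _ := GRing.isMonoidMorphism.Build S1 T tensor_inl
  tensor_inl_monoid_morphism.

Lemma tensor_inr_zmod_morphism : zmod_morphism (tensor_inr f1 f2).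
Proof.
move=> a b; apply/eqP; rewrite eq_sym subr_eq; apply/eqP.
by rewrite -[RHS]tensDr subrK.
Qed.

Lemma tensor_inr_monoid_morphism : monoid_morphism (tensor_inr f1 f2).
Proof. by split=> [//|a b]; rewrite -[RHS]/(tensor_mul _ _) tensor_mulE mul1r. Qed.

HB.instance Definition _ := GRing.isZmodMorphism.Build S2 T (tensor_inr f1 f2)
  tensor_inr_zmod_morphism.
HB.instance Definition _ := GRing.isMonoidMorphism.Build S2 T (tensor_inr f1 f2)
  tensor_inr_monoid_morphism.

Lemma tens_mul (a : S1) (b : S2) :
  tens (a : restr_scalars f1) (b : restr_scalars f2) =
  tensor_inl a * tensor_inr f1 f2 b :> T.
Proof. by rewrite -[RHS]/(tensor_mul _ _) tensor_mulE mulr1 mul1r. Qed.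

Lemma tensor_inl_base r : tensor_inl (f1 r) = tensor_inr f1 f2 (f2 r).
Proof.
have := tensZ r (1 : restr_scalars f1) (1 : restr_scalars f2).
by rewrite /GRing.scale /= /restr_scale !mulr1.
Qed.

End TensorInclusions.

Section Fibre.
Variables (p : nat) (p_pr : prime p) (A C : comNzRingType).
Variables (f : {rmorphism A -> C}) (P : prime_idealr A).
Hypothesis charA : p \in [pchar A].
Local Notation I := (P : {pred A}).
Local Notation AP := (localization (idfun : {rmorphism A -> A}) P).
Local Notation CP := (localization f P).
Variables (A' : comNzRingType) (phi : {rmorphism AP -> A'}).
Hypothesis ff : faithfully_flat phi.

(** By faithful flatness P generates a proper ideal of A'; K is the residue field of a maximal ideal
    containing it. Elements outside P stay nonzero in K because they are units in A_P. *)
Lemma fibre_field : exists (K : fieldType) (rho : {rmorphism A' -> K}),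
  forall a, (rho (phi (loc_in idfun P a)) == 0) = (a \in I).
Proof.
pose inP (x : AP) := exists a s (sI : s \notin I), a \in I /\ x = mk_frac idfun a sI.
have inPD x y : inP x -> inP y -> inP (x + y).
  move=> [a [s [sI [aI ->]]]] [b [t [tI [bI ->]]]].
  exists (a * t + b * s), (s * t), (prime_notinM sI tI); split.
    by rewrite rpredD // mulrC idealMr.
  by rewrite -[LHS]/(loc_add _ _) loc_addE.
have inPM x y : inP y -> inP (x * y).
  move=> [a [s [sI [aI ->]]]]; have [b [t [tI ->]]] := mk_fracP x.
  exists (b * a), (t * s), (prime_notinM tI sI); split; first by rewrite idealMr.
  by rewrite -[LHS]/(loc_mul _ _) loc_mulE.
have inP0 : inP 0 by exists 0, 1, (prime_notin1 P); rewrite idealr0.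
have inP1 : ~ inP 1.
  move=> [a [s [sI [aI /mk_frac_inj[u uI /= H]]]]].
  have : u * s \in I by rewrite -[s]mul1r H mulr1 idealMr.
  by rewrite prime_idealrM (negPf uI) (negPf sI).
pose J := addcl (fun x : A' => exists m a, inP m /\ x = phi m * a).
have idJ : ideal J.
  split; [exact: addcl0| |exact: addclD|]; last first.
    move=> a x; apply: (@addcl_map _ _ _ _ (fun x => a * x)) =>
      [|y z _ _|_ [m [b [Pm ->]]]].
    - by rewrite mulr0.
    - by rewrite mulrDr.
    by apply: addcl_gen; exists m, (a * b); split=> //; rewrite mulrCA.
  have JE x : J x -> exists n (m : 'I_n -> AP) a, (forall i, inP (m i)) /\
      x = \sum_i phi (m i) * a i.
    elim=> [|_ y [m [a [Pm ->]]] _ [n [m' [a' [Pm' ->]]]]].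
      by exists 0%N, (fun=> 0), (fun=> 0); split=> [[]|] //; rewrite big_ord0.
    exists n.+1, (fun i => oapp m' m (unlift ord0 i)),
      (fun i => oapp a' a (unlift ord0 i)); split=> [i|].
      by case: (unlift ord0 i).
    rewrite big_ord_recl unlift_none /=; congr (_ + _); apply: eq_bigr => i _.
    by rewrite liftK.
  move=> /JE[n [m [a [Pm /esym/(faithfully_flat_unit_ideal ff)[v vE]]]]].
  apply: inP1; rewrite -vE; apply: (big_ind inP) => // i _; exact: inPM.
have [K [rho rho0]] := residue_field_exists idJ.
exists K, rho => a; apply/eqP/idP => [ra0|aI]; last first.
  apply: rho0; apply: addcl_gen; exists (loc_in idfun P a), 1.
  by rewrite mulr1; split=> //; exists a, 1, (prime_notin1 P).
apply: contraT => aI; have := congr1 (rho \o phi) (loc_in_frac idfun 1 aI).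
rewrite /= !rmorphM /= ra0 mul0r !rmorph1 => /eqP.
by rewrite eq_sym oner_eq0.
Qed.

Variables (K : fieldType) (rho : {rmorphism A' -> K}).
Hypothesis rhoP : forall a, (rho (phi (loc_in idfun P a)) == 0) = (a \in I).

Definition fibre_kap : {rmorphism A -> K} := rho \o phi \o loc_in idfun P.

Lemma fibre_char : p \in [pchar K].
Proof. exact: (rmorph_pchar fibre_kap charA). Qed.

Lemma fibre_kap_frac a s (sI : s \notin I) :
  fibre_kap s * rho (phi (mk_frac idfun a sI)) = fibre_kap a.
Proof.
by have := congr1 (rho \o phi) (loc_in_frac idfun a sI); rewrite /= !rmorphM.
Qed.

Lemma fibre_kap_neq0 s : s \notin I -> fibre_kap s != 0.
Proof. by rewrite [fibre_kap s == 0]rhoP. Qed.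

Variables (n : nat) (e : 'I_n -> nat).
Hypothesis e_gt0 : forall i, (0 < e i)%N.
Local Notation d_gt0 := (fun i => prime_exp_gt0 p_pr (e i)).
Local Notation T := (tensor_ring (loc_map f P) phi).
Variable psi : {rmorphism T -> trunc_mpoly A' d_gt0}.
Hypothesis psi_bij : bijective psi.
Hypothesis psi_inr : forall a, psi (tensor_inr (loc_map f P) phi a) = trunc_const _ a.

Definition the_fibre : fibre_alg p := trunc_fibre p_pr e fibre_char.
Local Notation W := the_fibre.

Lemma fibre_map_X i :
  (trunc_pi K d_gt0 \o map_mpoly rho) ('X_i) ^+ (p ^ e i) = 0.
Proof. by rewrite /= map_mpolyX trunc_piX. Qed.

Definition fibre_red : {rmorphism trunc_mpoly A' d_gt0 -> W} :=
  @trunc_lift A' n (fun i => p ^ e i)%N d_gt0 W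
    (trunc_pi K d_gt0 \o map_mpoly rho) fibre_map_X.

Lemma fibre_redE g : fibre_red (trunc_pi A' d_gt0 g) = trunc_pi K d_gt0 (map_mpoly rho g).
Proof. exact: (trunc_liftE d_gt0 fibre_map_X g). Qed.

Definition fibre_theta : {rmorphism C -> W} :=
  fibre_red \o psi \o tensor_inl (loc_map f P) phi \o loc_in f P.

Lemma fibre_red_inr a : fibre_red (psi (tensor_inr (loc_map f P) phi a)) = iota W (rho a).
Proof. by rewrite psi_inr trunc_const_pi fibre_redE map_mpolyC. Qed.

Lemma fibre_theta_base a : fibre_theta (f a) = iota W (fibre_kap a).
Proof.
rewrite -[LHS]/(fibre_red (psi (tensor_inl (loc_map f P) phi (loc_in f P (f a))))).
by rewrite -loc_map_in tensor_inl_base fibre_red_inr.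
Qed.

(** Through psi every monomial of W comes from C_P (x) A', and the denominators of C_P become
    nonzero scalars of K. *)
Lemma fibre_theta_span (w : W) :
  addcl (fun v => exists k c, v = iota W k * fibre_theta c) w.
Proof.
set Q := fun v => _.
have QZ k v : addcl Q v -> addcl Q (iota W k * v).
  apply: (@addcl_map _ _ _ _ (fun v => iota W k * v)) => [|x y _ _|_ [l [c ->]]].
  - by rewrite mulr0.
  - by rewrite mulrDr.
  by apply: addcl_gen; exists (k * l), c; rewrite rmorphM mulrA.
have Qred (z : T) : addcl Q (fibre_red (psi z)).
  elim/tensorW: z => [x a|x y Hx Hy]; last first.
    rewrite !rmorphB; apply: addclD => //; rewrite -mulN1r.
    by have := QZ (- 1) _ Hy; rewrite rmorphN1.
  have [c [s [sI ->]]] := mk_fracP x.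
  rewrite tens_mul 2!rmorphM fibre_red_inr mulrC; apply: QZ.
  apply: addcl_gen; exists (fibre_kap s)^-1, c.
  have : fibre_theta (f s) * fibre_red (psi (tensor_inl (loc_map f P) phi (mk_frac f c sI)))
      = fibre_theta c.
    rewrite -[fibre_theta c]/(fibre_red (psi (tensor_inl (loc_map f P) phi (loc_in f P c)))).
    by rewrite -(loc_in_frac f c sI) 3!rmorphM.
  move <-; rewrite fibre_theta_base mulrA -rmorphM mulVf ?fibre_kap_neq0 //.
  by rewrite rmorph1 mul1r.
have [g ->] := trunc_pi_surj w.
rewrite [g]mpolyE rmorph_sum; apply: addcl_sum => m _ /=.
rewrite -mul_mpolyC rmorphM; apply: (QZ g@_m).
have [inv _ invK] := psi_bij.
have := Qred (inv (trunc_pi A' d_gt0 'X_[m])).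
by rewrite invK fibre_redE map_mpolyX.
Qed.

Section Universal.
Variable F : C -> W.
Hypothesis FD : forall x y, F (x + y) = F x + F y.
Hypothesis FZ : forall a c, F (f a * c) = iota W (fibre_kap a) * F c.

Definition fibre_frac (x : CP) : W :=
  iota W (fibre_kap (val (repr x).2))^-1 * F (repr x).1.

Lemma fibre_fracE c s (sI : s \notin I) :
  fibre_frac (mk_frac f c sI) = iota W (fibre_kap s)^-1 * F c.
Proof.
have [] := repr_mk_frac f c sI; rewrite /fibre_frac.
case: (repr _) => d [t tI] /= u uI; rewrite ![_ * f _]mulrC => /(congr1 F).
rewrite !FZ => H.
have [ku ks kt] := And3 (fibre_kap_neq0 uI) (fibre_kap_neq0 sI) (fibre_kap_neq0 tI).
move: H ku ks kt; set a := fibre_kap u; set b := fibre_kap s; set r := fibre_kap t.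
move=> H a0 b0 r0; have iotaE := rmorphM (iota W).
transitivity (iota W (a * b * r)^-1 * (iota W a * (iota W b * F d))).
  by rewrite !mulrA -!iotaE; congr (iota W _ * _); field; rewrite ?a0 ?b0 ?r0.
rewrite H !mulrA -!iotaE; congr (iota W _ * _).
by field; rewrite ?a0 ?b0 ?r0.
Qed.

Lemma fibre_fracD x y : fibre_frac (x + y) = fibre_frac x + fibre_frac y.
Proof.
have [c [s [sI ->]]] := mk_fracP x; have [d [t [tI ->]]] := mk_fracP y.
rewrite -[mk_frac _ _ _ + _]/(loc_add _ _) loc_addE !fibre_fracE.
rewrite FD ![_ * f _]mulrC !FZ mulrDr !mulrA.
have [ks kt] := (fibre_kap_neq0 sI, fibre_kap_neq0 tI).
have iotaE := rmorphM (iota W); rewrite -!iotaE (rmorphM fibre_kap).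
move: ks kt; set b := fibre_kap s; set r := fibre_kap t => b0 r0.
by congr (iota W _ * _ + iota W _ * _); field; rewrite ?b0 ?r0.
Qed.

Lemma fibre_fracZ r x : fibre_frac (loc_map f P r * x) = iota W (rho (phi r)) * fibre_frac x.
Proof.
have [c [s [sI ->]]] := mk_fracP x; have [a [t [tI ->]]] := mk_fracP r.
rewrite loc_mapE -[mk_frac _ _ _ * _]/(loc_mul _ _) loc_mulE !fibre_fracE.
have [ks kt] := (fibre_kap_neq0 sI, fibre_kap_neq0 tI).
have iotaE := rmorphM (iota W).
rewrite FZ !mulrA -!iotaE (rmorphM fibre_kap) -(fibre_kap_frac a tI).
move: ks kt; set b := fibre_kap s; set q := fibre_kap t => b0 q0.
by congr (iota W _ * _); field; rewrite ?b0 ?q0.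
Qed.

Definition fibre_bil (x : restr_scalars (loc_map f P)) (a : restr_scalars phi) : W :=
  fibre_frac x * iota W (rho a).

Lemma fibre_bil_balanced : balanced fibre_bil.
Proof.
split=> [a x y|x a b|r x a]; rewrite /fibre_bil.
- by rewrite fibre_fracD mulrDl.
- by rewrite !rmorphD mulrDr.
rewrite /GRing.scale /= /restr_scale fibre_fracZ !rmorphM /=; ring.
Qed.

Let Fl : T -> W := tensor_lift fibre_bil.

Lemma fibre_lift_inr z a :
  Fl (z * tensor_inr (loc_map f P) phi a) = iota W (rho a) * Fl z.
Proof.
elim/tensorW: z => [x b|x y Hx Hy].
  have -> : (tens x b : T) * tensor_inr (loc_map f P) phi a = tens (x * 1) (b * a).
    exact: tensor_mulE.
  rewrite /Fl !(tensor_liftE fibre_bil_balanced) /fibre_bil mulr1 !rmorphM /=; ring.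
have FlB u v : Fl (u - v) = Fl u - Fl v := tensor_liftB fibre_bil_balanced u v.
by rewrite mulrBl !FlB Hx Hy mulrBr.
Qed.

(** With [fibre_theta_span] this says that W is C (x)_A K. F extends to C_P, then bilinearly to C_P
    (x) A', and F' is defined on W by the resulting values on the reduced monomials. *)
Lemma fibre_universal : exists F' : W -> W,
  [/\ forall x y, F' (x + y) = F' x + F' y,
      forall k w, F' (iota W k * w) = iota W k * F' w
    & forall c, F' (fibre_theta c) = F c].
Proof.
have [inv invK psiK] := psi_bij.
pose ik (k : K) : W := iota W k.
have ikD k l : ik (k + l) = ik k + ik l := rmorphD (iota W) k l.
have ikM k l : ik (k * l) = ik k * ik l := rmorphM (iota W) k l.
have ik0 : ik 0 = 0 := rmorph0 (iota W).
have ik1 : ik 1 = 1 := rmorph1 (iota W).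
have FlD x y : Fl (x + y) = Fl x + Fl y := tensor_liftD fibre_bil_balanced x y.
have invD x y : inv (x + y) = inv x + inv y.
  by apply: (can_inj invK); rewrite rmorphD !psiK.
have Fl0 : Fl 0 = 0 := tensor_lift0 fibre_bil_balanced.
have inv0 : inv 0 = 0 by apply: (can_inj invK); rewrite rmorph0 psiK.
pose v m : W := Fl (inv (trunc_pi A' d_gt0 'X_[m])).
pose Q := (\max_i p ^ e i)%N.
pose mn (c : {ffun 'I_n -> 'I_Q}) : 'X_{1..n} := [multinom (c i : nat) | i < n].
have mn_inj : injective mn.
  move=> c c' /mnmP H; apply/ffunP => i; apply/val_inj.
  by have := H i; rewrite !mnmE.
have mn_red m : reduced (fun i => p ^ e i)%N m -> exists c, m = mn c.
  move=> /reducedP redm.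
  have ltQ i : (m i < Q)%N := leq_trans (redm i) (leq_bigmax (F := fun i => p ^ e i)%N i).
  exists [ffun i => Ordinal (ltQ i)]; apply/mnmP => i; by rewrite mnmE ffunE.
have v0 m : ~~ reduced (fun i => p ^ e i)%N m -> v m = 0.
  move=> nred; rewrite /v (_ : trunc_pi A' d_gt0 'X_[m] = 0) ?inv0 //.
  apply/trunc_pi_eq0 => k redk; rewrite mcoeffX; case: eqP => // mk.
  by rewrite mk redk in nred.
pose L (g : {mpoly K[n]}) : W := \sum_c ik g@_(mn c) * v (mn c).
have LD g h : L (g + h) = L g + L h.
  rewrite /L -big_split; apply: eq_bigr => c _ /=.
  by rewrite mcoeffD ikD mulrDl.
have LZ k g : L (k *: g) = ik k * L g.
  by rewrite /L mulr_sumr; apply: eq_bigr => c _; rewrite mcoeffZ ikM mulrA.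
have L0 : L 0 = 0 by rewrite /L big1 // => c _; rewrite mcoeff0 ik0 mul0r.
have LX m : L 'X_[m] = v m.
  rewrite /L; have [redm|nred] := boolP (reduced (fun i => p ^ e i)%N m).
    have [c mE] := mn_red m redm; rewrite (bigD1 c) //= mE mcoeffX eqxx ik1 mul1r.
    rewrite big1 ?addr0 // => c' ne; rewrite mcoeffX (inj_eq mn_inj) eq_sym (negPf ne).
    by rewrite ik0 mul0r.
  rewrite v0 // big1 // => c _; rewrite mcoeffX; case: eqP => [mE|]; last first.
    by rewrite ik0 mul0r.
  by rewrite -mE v0 ?mulr0.
pose F' (w : W) := L (repr (w : trunc_mpoly K d_gt0)).
have F'E g : F' (trunc_pi K d_gt0 g) = L g.
  have : trunc_pi K d_gt0 (repr (trunc_pi K d_gt0 g) - g) = 0.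
    by rewrite rmorphB trunc_reprK subrr.
  move=> /trunc_pi_eq0 H; rewrite /F' -[repr _](subrK g) LD.
  rewrite [X in X + _](_ : _ = 0) ?add0r // /L big1 // => c _.
  have [redc|nred] := boolP (reduced (fun i => p ^ e i)%N (mn c)).
    by rewrite H // ik0 mul0r.
  by rewrite v0 ?mulr0.
have F'red g : F' (fibre_red (trunc_pi A' d_gt0 g)) = Fl (inv (trunc_pi A' d_gt0 g)).
  have piM h k : trunc_pi A' d_gt0 (h * k) = trunc_pi A' d_gt0 h * trunc_pi A' d_gt0 k.
    exact: rmorphM.
  have mapM h k : map_mpoly rho (h * k) = map_mpoly rho h * map_mpoly rho k.
    exact: rmorphM.
  have piS : trunc_pi A' d_gt0 g =
      \sum_(m <- msupp g) trunc_pi A' d_gt0 (g@_m)%:MP * trunc_pi A' d_gt0 'X_[m].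
    rewrite {1}[g]mpolyE rmorph_sum; apply: eq_bigr => m _.
    by rewrite -mul_mpolyC -piM.
  have mapS : map_mpoly rho g = \sum_(m <- msupp g) rho g@_m *: 'X_[m].
    rewrite {1}[g]mpolyE rmorph_sum; apply: eq_bigr => m _.
    by rewrite -[in LHS]mul_mpolyC [LHS]mapM map_mpolyC map_mpolyX mul_mpolyC.
  rewrite fibre_redE F'E piS mapS.
  elim: (msupp g) => [|m s IHs]; first by rewrite !big_nil inv0 Fl0.
  rewrite !big_cons invD LD FlD IHs; congr (_ + _).
  rewrite LZ LX /v /ik -fibre_lift_inr; congr (Fl _); apply: (can_inj invK).
  by rewrite psiK (rmorphM psi) psiK psi_inr mulrC trunc_const_pi.
exists F'; split=> [x y|k w|c].
- have [g ->] := trunc_pi_surj x; have [h ->] := trunc_pi_surj y.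
  by rewrite -rmorphD !F'E LD.
- have [g ->] := trunc_pi_surj w.
  have -> : iota W k * trunc_pi K d_gt0 g = trunc_pi K d_gt0 (k *: g).
    by rewrite -mul_mpolyC rmorphM.
  by rewrite !F'E LZ.
rewrite /fibre_theta /=; have [g gE] := trunc_pi_surj (psi (tensor_inl (loc_map f P) phi (loc_in f P c))).
rewrite gE F'red -gE invK /Fl (tensor_liftE fibre_bil_balanced) /fibre_bil.
by rewrite !rmorph1 mulr1 fibre_fracE !rmorph1 invr1 rmorph1 mul1r.
Qed.

End Universal.
End Fibre.

(** The interface of the fibre: the last two clauses characterize W as C (x)_A K, and the first
    retains the Frobenius p-bases of the truncated presentation. *)
Theorem fibre_exists (p : nat) (p_pr : prime p) (A C : comNzRingType)
    (f : {rmorphism A -> C}) (charA : p \in [pchar A]) (P : prime_idealr A)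
    (A' : comNzRingType)
    (phi : {rmorphism localization (idfun : {rmorphism A -> A}) P -> A'}) :
  faithfully_flat phi -> truncated_over p_pr f phi ->
  exists (W : fibre_alg p) (kap : {rmorphism A -> fa_field W}) (theta : {rmorphism C -> W}),
  [/\ frob_pbases (scalars W) (whole W),
      forall a, (kap a == 0) = (a \in (P : {pred A})),
      forall a, theta (f a) = iota W (kap a),
      forall w, addcl (fun v => exists k c, v = iota W k * theta c) w
    & forall F : C -> W, (forall x y, F (x + y) = F x + F y) ->
        (forall a c, F (f a * c) = iota W (kap a) * F c) ->
        exists F' : W -> W, [/\ forall x y, F' (x + y) = F' x + F' y,
          forall k w, F' (iota W k * w) = iota W k * F' w
        & forall c, F' (theta c) = F c]].
Proof.
move=> ff [n [e [psi [e_gt0 psi_bij psi_inr]]]].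
have [K [rho rhoP]] := fibre_field ff.
exists (the_fibre p_pr charA phi rho e), (fibre_kap phi rho), (fibre_theta charA rho psi).
split.
- exact: trunc_frob_pbases.
- exact: rhoP.
- exact: fibre_theta_base.
- exact: fibre_theta_span.
by move=> F FD FZ; apply: fibre_universal.
Qed.

(** * Descent from the fibre to the localization *)

Section IntermediateAlgebras.
Variables (p : nat) (A C : comNzRingType) (f : {rmorphism A -> C}).
Hypothesis charA : p \in [pchar A].

Lemma charC : p \in [pchar C]. Proof. exact: (rmorph_pchar f charA). Qed.

Record intalg := Intalg {
  ia :> C -> Prop;
  ia_base : forall a, ia (f a);
  iaD : forall x y, ia x -> ia y -> ia (x + y);
  iaM : forall x y, ia x -> ia y -> ia (x * y) }.

Implicit Types S T G M : intalg.

Lemma ia0 S : S 0. Proof. by rewrite -(rmorph0 f); exact: ia_base. Qed.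
Lemma ia1 S : S 1. Proof. by rewrite -(rmorph1 f); exact: ia_base. Qed.

Lemma iaX S x n : S x -> S (x ^+ n).
Proof.
by move=> Sx; elim: n => [|n IHn]; rewrite ?expr0 ?exprS; [exact: ia1 | exact: iaM].
Qed.

Lemma iaN S x : S x -> S (- x).
Proof.
by move=> Sx; rewrite -mulN1r -(rmorphN1 f); apply: iaM => //; exact: ia_base.
Qed.

Lemma ia_sum S (J : Type) (r : seq J) (Q : pred J) (E : J -> C) :
  (forall j, Q j -> S (E j)) -> S (\sum_(j <- r | Q j) E j).
Proof. by move=> SE; elim/big_ind: _ => //; [exact: ia0 | exact: iaD]. Qed.

Lemma ia_prod S (J : Type) (r : seq J) (Q : pred J) (E : J -> C) :
  (forall j, Q j -> S (E j)) -> S (\prod_(j <- r | Q j) E j).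
Proof. by move=> SE; elim/big_ind: _ => //; [exact: ia1 | exact: iaM]. Qed.

Lemma ia_additive_sum S (F : C -> C) (J : Type) (r : seq J) (E : J -> C) :
  (forall a b, S a -> S b -> F (a + b) = F a + F b) -> (forall j, S (E j)) ->
  F (\sum_(j <- r) E j) = \sum_(j <- r) F (E j).
Proof.
move=> FD SE; have F0 : F 0 = 0.
  by apply: (addrI (F 0)); rewrite -FD ?addr0 //; exact: ia0.
elim: r => [|j r IHr]; first by rewrite !big_nil.
by rewrite !big_cons FD ?IHr //; apply: ia_sum.
Qed.

Definition ia_whole : intalg := @Intalg (fun=> True) (fun=> I) (fun _ _ _ _ => I)
  (fun _ _ _ _ => I).

(* S[T^(p^e)] *)
Definition cfrob_gen (S T : C -> Prop) (e : nat) (x : C) : Prop :=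
  exists s t, [/\ S s, T t & x = s * t ^+ (p ^ e)].

Definition cfrob (S T : intalg) (e : nat) : intalg.
Proof.
refine (@Intalg (addcl (cfrob_gen S T e)) _ _ _).
- move=> a; apply: addcl_gen; exists (f a), 1; split; first exact: ia_base.
    exact: ia1.
  by rewrite expr1n mulr1.
- by move=> x y; exact: addclD.
- move=> x y + Hy; apply: (@addcl_map _ _ _ _ (fun w => w * y)) =>
    [|a b _ _|_ [g [t [Gg Tt ->]]]].
  + by rewrite mul0r.
  + by rewrite mulrDl.
  move: Hy; apply: (@addcl_map _ _ _ _ (fun w => g * t ^+ (p ^ e) * w)) =>
    [|a b _ _|_ [h [u [Gh Tu ->]]]].
  + by rewrite mulr0.
  + by rewrite mulrDr.
  apply: addcl_gen; exists (g * h), (t * u); split; [exact: iaM|exact: iaM|].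
  by rewrite exprMn mulrACA.
Defined.

Lemma cfrob_least S T e (U : C -> Prop) :
  U 0 -> (forall x y, U x -> U y -> U (x + y)) ->
  (forall x y, U x -> U y -> U (x * y)) ->
  (forall s, S s -> U s) -> (forall t, T t -> U (t ^+ (p ^ e))) ->
  forall x, cfrob S T e x -> U x.
Proof.
move=> U0 UD UM SU TU x; apply: (@addcl_least _ _ U) => // _ [s [t [Ss Tt ->]]].
by apply: UM; [exact: SU|exact: TU].
Qed.

Lemma cfrob_base S T e s : S s -> cfrob S T e s.
Proof.
move=> Ss; apply: addcl_gen; exists s, 1; split=> //; first exact: ia1.
by rewrite expr1n mulr1.
Qed.

Lemma cfrob_exp S T e t : T t -> cfrob S T e (t ^+ (p ^ e)).
Proof.
by move=> Tt; apply: addcl_gen; exists 1, t; split; rewrite ?mul1r //; exact: ia1.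
Qed.

Section Fibre.
Variables (P : prime_idealr A) (W : fibre_alg p).
Local Notation K := (fa_field W).
Variables (kap : {rmorphism A -> K}) (theta : {rmorphism C -> W}).
Hypothesis kapP : forall a, (kap a == 0) = (a \in (P : {pred A})).
Hypothesis theta_base : forall a, theta (f a) = iota W (kap a).
Hypothesis theta_span :
  forall w, addcl (fun v => exists k c, v = iota W k * theta c) w.
Hypothesis universal : forall F : C -> W,
  (forall x y, F (x + y) = F x + F y) ->
  (forall a c, F (f a * c) = iota W (kap a) * F c) ->
  exists F' : W -> W, [/\ forall x y, F' (x + y) = F' x + F' y,
    forall k w, F' (iota W k * w) = iota W k * F' w
    & forall c, F' (theta c) = F c].

Definition kspan (N : C -> Prop) : W -> Prop :=
  addcl (fun v => exists k c, N c /\ v = iota W k * theta c).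

Lemma kspan_gen (N : C -> Prop) c : N c -> kspan N (theta c).
Proof.
by move=> Nc; apply: addcl_gen; exists 1, c; rewrite rmorph1 mul1r.
Qed.

Lemma kspanZ (N : C -> Prop) k w : kspan N w -> kspan N (iota W k * w).
Proof.
apply: (@addcl_map _ _ _ _ (fun v => iota W k * v)) => [|x y _ _|_ [l [c [Nc ->]]]].
- by rewrite mulr0.
- by rewrite mulrDr.
by apply: addcl_gen; exists (k * l), c; rewrite rmorphM mulrA.
Qed.

Definition fibre_sub (S : intalg) : subalg W.
Proof.
refine (@Subalg _ _ (kspan S) _ _ _).
- move=> k; apply: addcl_gen; exists k, 1; split; first exact: ia1.
  by rewrite rmorph1 mulr1.
- by move=> x y; exact: addclD.
- move=> x y + Hy; apply: (@addcl_map _ _ _ _ (fun w => w * y)) =>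
    [|a b _ _|_ [k [s [Ss ->]]]].
  + by rewrite mul0r.
  + by rewrite mulrDl.
  rewrite -mulrA; apply: (@kspanZ S k).
  move: Hy; apply: (@addcl_map _ _ _ _ (fun w => theta s * w)) =>
    [|a b _ _|_ [l [t [St ->]]]].
  + by rewrite mulr0.
  + by rewrite mulrDr.
  apply: addcl_gen; exists l, (s * t); split; first exact: iaM.
  by rewrite mulrCA rmorphM.
Defined.

Lemma fibre_sub_mono S T : (forall x, S x -> T x) -> sub_sa (fibre_sub S) (fibre_sub T).
Proof.
by move=> ST w; apply: addcl_mono => _ [k [c [Sc ->]]]; exists k, c; split=> //; exact: ST.
Qed.

Lemma fibre_whole w : fibre_sub ia_whole w <-> whole W w.
Proof.
split=> // _; have := theta_span w.
by apply: addcl_mono => _ [k [c ->]]; exists k, c.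
Qed.

(** A p-power of a K-combination is a K-combination of p-powers, so forming S[T^(p^e)] commutes with
    passing to the fibre. *)
Lemma fibre_frob S T e w :
  fibre_sub (cfrob S T e) w <-> frob (fibre_sub S) (fibre_sub T) e w.
Proof.
split.
  apply: (@addcl_least _ _ (frob (fibre_sub S) (fibre_sub T) e)) => [|x y|_ [k [c [Cc ->]]]].
  - exact: (sa0 (frob _ _ e)).
  - exact: (@saD _ _ (frob _ _ e)).
  apply: saM; first exact: sa_iota.
  apply: (@cfrob_least S T e (fun c => frob (fibre_sub S) (fibre_sub T) e (theta c))) Cc.
  - rewrite rmorph0; exact: (sa0 (frob _ _ e)).
  - move=> x y; rewrite rmorphD; exact: (@saD _ _ (frob _ _ e)).
  - move=> x y; rewrite rmorphM; exact: (@saM _ _ (frob _ _ e)).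
  - by move=> s Ss; apply: sfrob_base; apply: kspan_gen.
  by move=> t Tt; rewrite rmorphXn; apply: frob_exp; apply: kspan_gen.
apply: frob_least.
  by apply: fibre_sub_mono => x; exact: cfrob_base.
move=> t Ht; elim: Ht => [|_ v [k [c [Tc ->]]] _ IH].
  rewrite expr0n gtn_eqF; last by rewrite expn_gt0 prime_gt0 ?(fa_prime W).
  exact: (sa0 (fibre_sub _)).
rewrite pexpD; apply: saD => //; rewrite exprMn -!rmorphXn.
by apply: kspanZ; apply: kspan_gen; exact: cfrob_exp.
Qed.

(** The coordinate functionals of C over S are A-linear, hence extend to W by the universal
    property; their S-linearity becomes linearity over the K-span of S. *)
Lemma fibre_proj S : proj S ia_whole -> proj (fibre_sub S) (whole W).
Proof.
move=> [I [c [l [_ Sl lD lM lE]]]].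
have lZ i a x : theta (l i (f a * x)) = iota W (kap a) * theta (l i x).
  by rewrite lM // ?rmorphM ?theta_base //; exact: ia_base.
have /choice[L LP] i : exists F' : W -> W, [/\ forall x y, F' (x + y) = F' x + F' y,
    forall k w, F' (iota W k * w) = iota W k * F' w
    & forall x, F' (theta x) = theta (l i x)].
  by apply: universal => [x y|a x]; rewrite ?lD ?rmorphD ?lZ.
have whole_ind (Q : W -> Prop) : Q 0 -> (forall x y, Q x -> Q y -> Q (x + y)) ->
    (forall k x, Q (iota W k * theta x)) -> forall w, Q w.
  move=> Q0 QD Qg w; apply: (@addcl_least _ _ Q) (theta_span w) => //.
  by move=> _ [k [x ->]].
have L0 i : L i 0 = 0.
  by have [LD _ _] := LP i; apply: (addrI (L i 0)); rewrite -LD !addr0.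
exists I, (fun i => theta (c i)), L; split=> //.
- move=> i t _; have [LD LZ LE] := LP i.
  elim/whole_ind: t => [|x y Hx Hy|k x].
  + by rewrite L0; exact: (sa0 (fibre_sub S)).
  + by rewrite LD; exact: (@saD _ _ (fibre_sub S)).
  by rewrite LZ LE; apply: kspanZ; apply: kspan_gen; exact: Sl.
- by move=> i a b _ _; have [] := LP i.
- move=> i s t Ss _; have [LD LZ LE] := LP i.
  elim: Ss => [|_ v [k [x [Sx ->]]] _ IH]; first by rewrite !mul0r L0.
  rewrite !mulrDl LD IH; congr (_ + _); rewrite -!mulrA LZ; congr (_ * _).
  move: {IH} t; elim/whole_ind => [|y z Hy Hz|h y]; first by rewrite !(mulr0, L0).
    by rewrite mulrDr !LD Hy Hz mulrDr.
  by rewrite mulrCA !LZ -rmorphM !LE lM // rmorphM mulrCA.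
move=> t _; elim/whole_ind: t => [|x y Hx Hy|k x].
- by rewrite big1 // => i _; rewrite L0 mul0r.
- rewrite {1}Hx {1}Hy -big_split; apply: eq_bigr => i _.
  by have [-> _ _] := LP i; rewrite mulrDl.
rewrite {1}(lE x) // rmorph_sum mulr_sumr; apply: eq_bigr => i _.
by have [_ LZ LE] := LP i; rewrite LZ LE rmorphM mulrA.
Qed.

Section Descent.
Variable E : nat.
Hypothesis expE : forall c, exists a, f a = c ^+ (p ^ E).
Hypothesis finC : exists (n : nat) (g : 'I_n -> C),
  forall c, exists a : 'I_n -> A, c = \sum_i f (a i) * g i.

Local Notation I := (P : {pred A}).

Lemma notin_kap a : a \notin I <-> kap a != 0.
Proof. by rewrite kapP. Qed.

(** The p^E-th power of 1 = sum_j l_j(1) c_j is an identity in the image of A, so some mu = l_j(1)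
    satisfies mu^(p^E) = f a with a outside P. On M the map x -> l_j (mu^(p^E - 1) x) is then
    multiplication by f a. *)
Lemma local_retraction M : proj M ia_whole ->
  exists (r : C -> C) (a : A), [/\ a \notin I, forall c, M (r c),
    forall x y, r (x + y) = r x + r y, forall b c, r (f b * c) = f b * r c
    & forall m, M m -> r m = f a * m].
Proof.
move=> [J [c [l [_ Ml lD lM lE]]]].
have /choice[al alE] j := expE (l j 1); have /choice[be beE] j := expE (c j).
have [j aj] : exists j, al j \notin I.
  apply: contrapT => H; have /eqP : theta 1 = 0.
    rewrite -(expr1n _ (p ^ E)) {1}(lE 1) // pexp_sum_pchar ?charC // rmorph_sum big1 // => j _.
    rewrite exprMn -alE -beE rmorphM !theta_base.
    have /eqP -> : kap (al j) == 0.
      by rewrite kapP; apply/negPn/negP => Hj; apply: H; exists j.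
    by rewrite rmorph0 mul0r.
  by rewrite rmorph1 oner_eq0.
pose mu := l j 1; have Mmu : M mu by exact: Ml.
exists (fun x => l j (mu ^+ (p ^ E).-1 * x)), (al j); split=> //.
- by move=> x; exact: Ml.
- by move=> x y; rewrite mulrDr lD.
- by move=> b x; rewrite mulrCA (lM _ (f b)) //; exact: ia_base.
move=> m Mm; rewrite -[mu ^+ _ * m]mulr1 lM //; last by apply: iaM => //; exact: iaX.
rewrite mulrAC -exprSr prednK ?expn_gt0 ?prime_gt0 ?(fa_prime W) //.
by rewrite /mu -alE.
Qed.

Section LocalGeneration.
Variables (M : intalg) (N : C -> Prop).
Hypothesis pM : proj M ia_whole.
Hypotheses (N0 : N 0) (ND : forall x y, N x -> N y -> N (x + y)).
Hypotheses (NZ : forall a x, N x -> N (f a * x)) (NM : forall x, N x -> M x).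
Hypothesis MN : forall y, M y -> kspan N (theta y).

Definition loc_gen n (h : 'I_n -> C) : Prop :=
  forall y, M y -> exists s (a : 'I_n -> A) m,
    [/\ s \notin I, N m & f s * y = m + \sum_i f (a i) * h i].

(** If h_0 were not redundant, its coefficient in an expression of y, reduced to K, would depend on
    y only. This gives a functional F on M with F(N) = 0 and F(h_0) = 1, which extends to the fibre
    although theta (h_0) lies in the span of theta (N). *)
Lemma loc_gen_drop n (h : 'I_n.+1 -> C) : (forall i, M (h i)) ->
  loc_gen h -> loc_gen (fun i => h (fintype.lift ord0 i)).
Proof.
move=> Mh gen_h; apply: contrapT => ngen.
pose val y k := exists s (a : 'I_n.+1 -> A) m, [/\ s \notin I, N m,
  f s * y = m + \sum_i f (a i) * h i & k = kap (a ord0) / kap s].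
have val_uniq y k k' : val y k -> val y k' -> k = k'.
  move=> [s [a [m [sI Nm sE ->]]]] [s' [a' [m' [sI' Nm' sE' ->]]]].
  have [ks ks'] := (iffLR (notin_kap s) sI, iffLR (notin_kap s') sI').
  (* If t is outside P, subtracting the two expressions solves for h_0 in terms of N and the other
     h_i, which makes h_0 redundant. *)
  pose t := s' * a ord0 - s * a' ord0.
  have [tI|tI] := boolP (t \in I).
    move: tI; rewrite -kapP rmorphB !rmorphM subr_eq0 => /eqP H.
    by apply/eqP; rewrite eqr_div // mulrC H mulrC.
  case: ngen => z /gen_h[r [b [l [rI Nl rE]]]].
  have hE : f t * h ord0 = (f s * m' - f s' * m) +
      \sum_i f (s * a' (fintype.lift ord0 i) - s' * a (fintype.lift ord0 i)) * h (fintype.lift ord0 i).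
    have : f s' * (f s * y) - f s * (f s' * y) = 0 by ring.
    rewrite sE sE' !big_ord_recl => /eqP; rewrite subr_eq0 => /eqP H.
    rewrite (eq_bigr (fun i => f s * (f (a' (fintype.lift ord0 i)) * h (fintype.lift ord0 i)) -
       f s' * (f (a (fintype.lift ord0 i)) * h (fintype.lift ord0 i)))) => [|i _]; last first.
      by rewrite rmorphB !rmorphM /=; ring.
    rewrite sumrB -!mulr_sumr /t rmorphB !rmorphM /=.
    move: H; set X := \sum_(i < n) _; set Y := \sum_(i < n) _ => H.
    have -> : f s' * m = f s * (m' + (f (a' ord0) * h ord0 + Y)) -
      f s' * (f (a ord0) * h ord0 + X) by rewrite -H; ring.
    ring.
  exists (t * r), (fun i => t * b (fintype.lift ord0 i) + b ord0 *
     (s * a' (fintype.lift ord0 i) - s' * a (fintype.lift ord0 i))),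
    (f t * l + f (b ord0) * (f s * m' - f s' * m)).
  split; first by rewrite prime_idealrM negb_or tI.
    apply: ND; apply: NZ => //; apply: ND; first exact: NZ.
    by rewrite -mulNr -rmorphN; exact: NZ.
  rewrite rmorphM -mulrA rE big_ord_recl; set X := \sum_(i < n) _.
  transitivity (f t * l + f (b ord0) * (f t * h ord0) + f t * X); first by ring.
  rewrite hE {hE}; set Y := \sum_(i < n) _.
  transitivity (f t * l + f (b ord0) * (f s * m' - f s' * m) + (f t * X + f (b ord0) * Y)); first by ring.
  congr (_ + _).
  rewrite !mulr_sumr -big_split; apply: eq_bigr => i _ /=.
  by rewrite [in RHS]rmorphD !(rmorphM, rmorphB) /=; ring.
have /choice[F FP] y : exists k, M y -> val y k.
  have [/gen_h[s [a [m [sI Nm sE]]]]|nM] := pselect (M y); last by exists 0.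
  by exists (kap (a ord0) / kap s) => _; exists s, a, m.
have FE y k : M y -> val y k -> F y = k by move=> My; apply: val_uniq; exact: FP.
have FD x y : M x -> M y -> F (x + y) = F x + F y.
  move=> Mx My; apply: FE; first exact: iaD.
  have [s [a [m [sI Nm sE ->]]]] := FP x Mx.
  have [s' [a' [m' [sI' Nm' sE' ->]]]] := FP y My.
  have [ks ks'] := (iffLR (notin_kap s) sI, iffLR (notin_kap s') sI').
  exists (s * s'), (fun i => s' * a i + s * a' i), (f s' * m + f s * m'); split.
  - by rewrite prime_idealrM negb_or sI.
  - by apply: ND; exact: NZ.
  - have -> : f (s * s') * (x + y) = f s' * (f s * x) + f s * (f s' * y).
      by rewrite rmorphM; ring.
    rewrite sE sE' !mulrDr addrACA !mulr_sumr -big_split; congr (_ + _).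
    by apply: eq_bigr => i _ /=; rewrite rmorphD !rmorphM /=; ring.
  rewrite rmorphD !rmorphM /=; move: ks ks'.
  move: (kap s) (kap s') (kap (a ord0)) (kap (a' ord0)) => u v b c u0 v0.
  by field; rewrite ?u0 ?v0.
have FZ b x : M x -> F (f b * x) = kap b * F x.
  move=> Mx; apply: FE; first by apply: iaM => //; exact: ia_base.
  have [s [a [m [sI Nm sE ->]]]] := FP x Mx.
  exists s, (fun i => b * a i), (f b * m); split=> //; first exact: NZ.
    rewrite mulrCA sE mulrDr mulr_sumr; congr (_ + _).
    by apply: eq_bigr => i _; rewrite rmorphM mulrA.
  by rewrite rmorphM mulrA.
have I1 : 1 \notin I by rewrite idealr1.
have FN x : N x -> F x = 0.
  move=> Nx; apply: FE; first exact: NM.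
  exists 1, (fun=> 0), x; split=> //; last by rewrite rmorph0 mul0r.
  by rewrite rmorph1 mul1r big1 ?addr0 // => i _; rewrite rmorph0 mul0r.
have Fh : F (h ord0) = 1.
  apply: FE => //; exists 1, (fun i => (i == ord0)%:R), 0; split=> //.
    rewrite rmorph1 mul1r add0r (bigD1 ord0) //= rmorph1 mul1r big1 ?addr0 //.
    by move=> i /negPf ->; rewrite rmorph0 mul0r.
  by rewrite eqxx !rmorph1 divr1.
(* F is meaningful on M only; the retraction, which on M is multiplication by f a with a outside P,
   carries it to C so that the universal property applies. *)
have [r [a [aI Mr rD rZ rE]]] := local_retraction pM.
have [||G' [GD GZ GE]] := @universal (fun c => iota W (F (r c))).
- by move=> x y; rewrite rD FD // rmorphD.
- by move=> b c; rewrite rZ FZ // rmorphM.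
have G0 : G' 0 = 0 by apply: (addrI (G' 0)); rewrite -GD !addr0.
have : G' (theta (h ord0)) = 0.
  elim: (MN (Mh ord0)) => [//|_ v [k [c [Nc ->]]] _ IH].
  by rewrite GD IH GZ GE rE ?FN ?rmorph0 ?mulr0 ?addr0 //; [exact: NZ|exact: NM].
rewrite GE rE // FZ // Fh mulr1 => /(congr1 (eps W)); rewrite iotaK rmorph0 => /eqP.
by rewrite (negPf (iffLR (notin_kap a) aI)).
Qed.

(** Nakayama's lemma at P: retracting generators of C gives finitely many local generators of M,
    which are dropped one by one. *)
Theorem local_descent y : M y -> exists2 s, s \notin I & N (f s * y).
Proof.
have [r [a [aI Mr rD rZ rE]]] := local_retraction pM.
have [n [g gP]] := finC.
pose h i := r (g i); have gen0 : loc_gen h.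
  move=> z Mz; have [b bE] := gP z; exists a, b, 0; split=> //.
  rewrite add0r -rE // bE; have r0 : r 0 = 0.
    by apply: (addrI (r 0)); rewrite -rD !addr0.
  elim: (index_enum _) => [|i s IHs]; first by rewrite !big_nil.
  by rewrite !big_cons rD IHs rZ.
have Mh i : M (h i) by exact: Mr.
move: gen0 Mh; clearbody h; clear gP g.
elim: n h => [|n IHn] h gen_h Mh.
  move=> /gen_h[s [b [m [sI Nm]]]]; rewrite big_ord0 addr0 => sE.
  by exists s; rewrite ?sE.
by apply: (IHn (fun i => h (fintype.lift ord0 i))) => //; exact: loc_gen_drop.
Qed.

End LocalGeneration.

(** Determinant trick. The matrix [e] over G satisfies s u_i = sum_j e_ij u_j and is annihilated by
    every relation g. Independence in the fibre forces its image to be the scalar matrix kap s, so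
    its determinant kills g and has its p^E-th power in A outside P. *)
Lemma local_independence G T (J : finType) (u : J -> C) :
  (forall x, G x -> T x) -> proj G T -> (forall j, T (u j)) ->
  (forall y, T y -> exists2 s, s \notin I &
     exists g : J -> C, (forall j, G (g j)) /\ f s * y = \sum_j g j * u j) ->
  (forall g : J -> W, (forall j, fibre_sub G (g j)) ->
     \sum_j g j * theta (u j) = 0 -> forall j, g j = 0) ->
  forall g : J -> C, (forall j, G (g j)) -> \sum_j g j * u j = 0 ->
  exists2 s, s \notin I & forall j, f s * g j = 0.
Proof.
move=> GT [L [t [mu [Tt Gmu muD muM muE]]]] Tu span indep g Gg g0.
have /choice[sl slP] l : exists s, s \notin I /\
    exists c : J -> C, (forall j, G (c j)) /\ f s * t l = \sum_j c j * u j.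
  by have [s sI Hs] := span (t l) (Tt l); exists s.
have /choice[c cP] l : exists c : J -> C, (forall j, G (c j)) /\
  f (sl l) * t l = \sum_j c j * u j by have [] := slP l.
pose s := \prod_l sl l.
have sI : s \notin I.
  rewrite -kapP rmorph_prod; apply/prodf_neq0 => l _; apply/notin_kap.
  by have [] := slP l.
pose e i j := \sum_l mu l (u i) * (f (\prod_(l' | l' != l) sl l') * c l j).
have Ge i j : G (e i j).
  apply: ia_sum => l _; apply: iaM; first exact: Gmu.
  by apply: iaM; [exact: ia_base|case: (cP l)].
have eE i : \sum_j e i j * u j = f s * u i.
  rewrite [in RHS](muE (u i)) // mulr_sumr.
  under eq_bigr => j _ do rewrite mulr_suml.
  rewrite exchange_big; apply: eq_bigr => l _ /=.
  have [_ H] := cP l; have -> : s = sl l * \prod_(l' | l' != l) sl l' by rewrite /s (bigD1 l).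
  rewrite (rmorphM f).
  under eq_bigr => j _ do rewrite -!mulrA.
  by rewrite -!mulr_sumr -H; ring.
have theta_e i j : theta (e i j) = (i == j)%:R * iota W (kap s).
  apply/eqP; rewrite -subr_eq0; apply/eqP; move: j.
  apply: indep => [j|].
    apply: (@saD _ _ (fibre_sub G)); first by apply: kspan_gen; exact: Ge.
    apply: (@saN _ _ (fibre_sub G)); apply: (@saM _ _ (fibre_sub G)).
      exact: (@sa_nat _ _ (fibre_sub G)).
    exact: (@sa_iota _ _ (fibre_sub G)).
  under eq_bigr => j _ do rewrite mulrBl -(rmorphM theta).
  rewrite sumrB -(rmorph_sum theta) eE rmorphM theta_base (bigD1 i) //= eqxx mul1r.
  by rewrite big1 ?addr0 ?subrr // => j /negPf; rewrite eq_sym => ->; rewrite !mul0r.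
(* The row g e factors through the values mu_l (sum_i g_i u_i), which vanish. *)
have ge j : \sum_i g i * e i j = 0.
  under eq_bigr => i _ do rewrite mulr_sumr.
  rewrite exchange_big big1 // => l _ /=.
  under eq_bigr => i _ do rewrite mulrA -muM //.
  rewrite -mulr_suml; suff -> : \sum_i mu l (g i * u i) = 0 by rewrite mul0r.
  rewrite -(@ia_additive_sum T) => [|x y|i].
  - rewrite g0; apply: (addrI (mu l 0)).
    by rewrite -muD ?addr0 //; exact: ia0.
  - exact: muD.
  by apply: iaM => //; exact: GT.
pose E0 : 'M[C]_#|J| := \matrix_(i, j) e (enum_val i) (enum_val j).
pose v : 'rV[C]_#|J| := \row_i g (enum_val i).
have vE0 : v *m E0 = 0.
  apply/rowP => j; rewrite !mxE -[RHS](ge (enum_val j)).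
  rewrite (reindex (@enum_val J predT)) /=; last by apply: onW_bij; exact: enum_val_bij.
  by apply: eq_bigr => i _; rewrite !mxE.
have det_v j : \det E0 * g j = 0.
  have /rowP/(_ (enum_rank j)) : v *m (\det E0)%:M = 0.
    by rewrite -mul_mx_adj mulmxA vE0 mul0mx.
  by rewrite mul_mx_scalar !mxE enum_rankK.
have theta_det : theta (\det E0) = iota W (kap s ^+ #|J|).
  rewrite -det_map_mx; have -> : map_mx theta E0 = (iota W (kap s))%:M.
    apply/matrixP => i j; rewrite !mxE theta_e mulr_natl.
    by rewrite (inj_eq enum_val_inj).
  by rewrite det_scalar rmorphXn.
have [a aE] := expE (\det E0); exists a.
  apply/notin_kap; have : theta (f a) = iota W (kap s ^+ #|J| ^+ (p ^ E)).
    by rewrite aE !rmorphXn theta_det rmorphXn.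
  rewrite theta_base => /(congr1 (eps W)); rewrite !iotaK => ->.
  by rewrite !expf_neq0 //; apply/notin_kap.
move=> j; rewrite aE -(prednK (_ : 0 < p ^ E)%N).
  by rewrite exprSr -mulrA det_v mulr0.
by rewrite expn_gt0 prime_gt0 ?(fa_prime W).
Qed.

End Descent.
End Fibre.
End IntermediateAlgebras.

(** * Normal forms at a prime of A *)

Section ReducedMonomials.
Variables (n : nat) (d : 'I_n -> nat).

Definition red_index : finType := {dffun forall i : 'I_n, 'I_(d i)}.

Definition red_mon (j : red_index) : 'X_{1..n} := [multinom nat_of_ord (j i) | i < n].

Lemma red_mon_lt j i : (red_mon j i < d i)%N.
Proof. by rewrite mnmE. Qed.

Lemma red_mon_inj : injective red_mon.
Proof.
move=> j k /mnmP H; apply/ffunP => i; apply: val_inj.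
by have := H i; rewrite !mnmE.
Qed.

Lemma red_monP (m : 'I_n -> nat) : (forall i, (m i < d i)%N) ->
  exists j, forall i, red_mon j i = m i.
Proof.
move=> H; exists [ffun i => Ordinal (H i)] => i.
by rewrite mnmE ffunE.
Qed.

End ReducedMonomials.

Definition monom (R : comPzRingType) n (x : 'I_n -> R) (q : nat) (m : 'I_n -> nat) : R :=
  \prod_i x i ^+ (q * m i).

Definition mspan (R : comNzRingType) n (G : R -> Prop) (x : 'I_n -> R) (q : nat)
    (Q : ('I_n -> nat) -> Prop) : R -> Prop :=
  addcl (fun v => exists b m, [/\ G b, Q m & v = b * monom x q m]).

Lemma mspan_red (R : comNzRingType) n (G : R -> Prop) (x : 'I_n -> R) d y :
  G 0 -> (forall a b, G a -> G b -> G (a + b)) ->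
  mspan G x 1 (fun m => forall i, (m i < d i)%N) y ->
  exists g : red_index d -> R, (forall j, G (g j)) /\
    y = \sum_j g j * monom x 1 (red_mon j).
Proof.
move=> G0 GD; elim=> [|_ v [b [m [Gb Qm ->]]] _ [g [Gg ->]]].
  by exists (fun=> 0); split=> //; rewrite big1 // => j _; rewrite mul0r.
have [k kE] := red_monP Qm.
exists (fun j => (if j == k then b else 0) + g j); split=> [j|].
  by apply: GD => //; case: eqP.
under [RHS]eq_bigr => j _ do rewrite mulrDl.
rewrite big_split; congr (_ + _) => /=.
rewrite (bigD1 k) //= eqxx big1 ?addr0 => [|j /negPf ->]; last by rewrite mul0r.
by congr (_ * _); apply: eq_bigr => i _; rewrite kE.
Qed.

Section NormalForm.
Variables (p : nat) (A C : comNzRingType) (f : {rmorphism A -> C}).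
Hypothesis charA : p \in [pchar A].
Variables (P : prime_idealr A) (W : fibre_alg p).
Local Notation K := (fa_field W).
Local Notation I := (P : {pred A}).
Variables (kap : {rmorphism A -> K}) (theta : {rmorphism C -> W}).
Hypothesis kapP : forall a, (kap a == 0) = (a \in I).
Hypothesis theta_base : forall a, theta (f a) = iota W (kap a).
Hypothesis theta_span :
  forall w, addcl (fun v => exists k c, v = iota W k * theta c) w.
Hypothesis universal : forall F : C -> W,
  (forall x y, F (x + y) = F x + F y) ->
  (forall a c, F (f a * c) = iota W (kap a) * F c) ->
  exists F' : W -> W, [/\ forall x y, F' (x + y) = F' x + F' y,
    forall k w, F' (iota W k * w) = iota W k * F' w
    & forall c, F' (theta c) = F c].
Variable E : nat.
Hypothesis expE : forall c, exists a, f a = c ^+ (p ^ E).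
Hypothesis finC : exists (n : nat) (g : 'I_n -> C),
  forall c, exists a : 'I_n -> A, c = \sum_i f (a i) * g i.

Local Notation fsub := (fibre_sub theta).

(** Up to denominators outside P, the reduced monomials in the x_i form a basis of T over G, and
    x_i^(p^e_i) involves only p^e_i-th powers of monomials, themselves reduced. Explicit
    denominators keep the whole statement inside C. *)
Definition normal_form (G T : C -> Prop) : Prop :=
  exists n (x : 'I_n -> C) (e : 'I_n -> nat),
  [/\ forall i, T (x i) /\ (0 < e i)%N,
      forall y, T y -> exists2 s, s \notin I & exists g : red_index (fun i => p ^ e i)%N -> C,
        (forall j, G (g j)) /\ f s * y = \sum_j g j * monom x 1 (red_mon j),
      forall i, exists2 s, s \notin I &
        mspan G x (p ^ e i) (fun m => forall j, (p ^ e i * m j < p ^ e j)%N)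
          (f s * x i ^+ (p ^ e i))
    & forall g : red_index (fun i => p ^ e i)%N -> C, (forall j, G (g j)) ->
        \sum_j g j * monom x 1 (red_mon j) = 0 ->
        exists2 s, s \notin I & forall j, f s * g j = 0].

Lemma kspan_mspan (G : intalg f) n (x : 'I_n -> C) q Q w :
  spanned (fun i => theta (x i) ^+ q) (fsub G) Q w -> kspan theta (mspan G x q Q) w.
Proof.
apply: (@addcl_least _ _ (kspan theta (mspan G x q Q))) => [|a b|].
- exact: addcl0.
- exact: addclD.
move=> _ [s [m [Gs Qm ->]]]; move: Gs.
apply: (@addcl_map _ _ _ _ (fun w => w * mono (fun i => theta (x i) ^+ q) m)) =>
  [|a b _ _|_ [k [c [Gc ->]]]].
- by rewrite mul0r.
- by rewrite mulrDl.
apply: addcl_gen; exists k, (c * monom x q m); split.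
  by apply: addcl_gen; exists c, m.
rewrite -mulrA rmorphM rmorph_prod; congr (_ * (_ * _)).
by apply: eq_bigr => i _; rewrite rmorphXn exprM.
Qed.

Section Pair.
Variables G T : intalg f.
Hypothesis GT : forall x, G x -> T x.
Hypothesis pG : proj G T.
Hypothesis pT : forall e, proj (cfrob p G T e) (ia_whole f).
Hypothesis pbases : frob_pbases (fsub G) (fsub T).

Let cfrob0 x : T x -> cfrob p G T 0 x.
Proof. by move=> Tx; rewrite -[x]expr1; exact: (@cfrob_exp p _ _ f G T 0). Qed.

Let mspanZ n (x : 'I_n -> C) q Q a y : mspan G x q Q y -> mspan G x q Q (f a * y).
Proof.
apply: (@addcl_map _ _ _ _ (fun w => f a * w)) => [|u v _ _|_ [b [m [Gb Qm ->]]]].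
- by rewrite mulr0.
- by rewrite mulrDr.
apply: addcl_gen; exists (f a * b), m; split; rewrite ?mulrA //.
by apply: iaM => //; exact: ia_base.
Qed.

Let mspan_cfrob n (x : 'I_n -> C) e Q y : (forall i, T (x i)) ->
  mspan G x (p ^ e) Q y -> cfrob p G T e y.
Proof.
move=> Tx; apply: (@addcl_least _ _ (cfrob p G T e)) => [|u v|_ [b [m [Gb _ ->]]]].
- exact: ia0.
- exact: iaD.
apply: iaM; first exact: cfrob_base.
by apply: ia_prod => i _; rewrite exprM; apply: iaX; exact: cfrob_exp.
Qed.

(** The x_i are lifts of coordinates that [tower_coordinates] finds among the images of T.
    Generation of G[T^(p^e)], used at e = 0 and at e = e_i, descends by [local_descent]; freeness
    descends by [local_independence]. *)
Lemma normal_form_of_pbases : normal_form G T.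
Proof.
have fGT : sub_sa (fsub G) (fsub T) by exact: fibre_sub_mono.
have fTE : sub_sa (frob (fsub G) (fsub T) E) (fsub G).
  apply: frob_least => // t; elim=> [|_ v [k [c [Tc ->]]] _ IH].
    rewrite expr0n gtn_eqF; last by rewrite expn_gt0 prime_gt0 ?(fa_prime W).
    exact: (sa0 (fsub G)).
  rewrite pexpD; apply: saD => //; rewrite exprMn -!rmorphXn.
  by have [a <-] := expE c; apply: kspanZ; apply: kspan_gen; exact: ia_base.
have [||n [w [h [Zw h0 [spn ind]]]]] :=
  @tower_coordinates p W _ _ E fGT fTE pbases (fun w => exists2 c, T c & theta c = w).
- move=> w; apply: addcl_mono => _ [k [c [Tc ->]]].
  by exists k, (theta c); split=> //; exists c.
- by move=> _ [c Tc <-]; exact: kspan_gen.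
have /choice[x xP] i : exists c, T c /\ theta c = w i by have [c Tc cE] := Zw i; exists c.
have wE i : w i = theta (x i) by have [_ ->] := xP i.
have Tx i : T (x i) by have [] := xP i.
have desc e (Q : ('I_n -> nat) -> Prop) :
    (forall m, (forall i, (p ^ e * m i < p ^ (0 + h i))%N) -> Q m) ->
    forall y, cfrob p G T e y ->
    exists2 s, s \notin I & mspan G x (p ^ e) Q (f s * y).
  move=> HQ; apply: (@local_descent p A C f charA P W kap theta kapP theta_base universal
    E expE finC (cfrob p G T e)) => //.
  - exact: addcl0.
  - exact: addclD.
  - by move=> a y; exact: mspanZ.
  - by move=> y; exact: (mspan_cfrob Tx).
  move=> y Ty; apply: kspan_mspan.
  have /(spn e _ (leq0n e)) : frob (fsub G) (fsub T) e (theta y).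
    by apply/fibre_frob; exact: kspan_gen.
  apply: addcl_mono => _ [s [m [Gs Qm ->]]]; exists s, m; split=> //; first exact: HQ.
  by congr (_ * _); apply: eq_bigr => i _; rewrite wE.
have span y : T y -> exists2 s, s \notin I &
    exists g : red_index (fun i => p ^ h i)%N -> C,
    (forall j, G (g j)) /\ f s * y = \sum_j g j * monom x 1 (red_mon j).
  move=> /cfrob0 /(@desc 0 (fun m => forall i, (m i < p ^ h i)%N))[|s sI sy].
    by move=> m H i; have := H i; rewrite mul1n.
  exists s => //; apply: mspan_red sy; first exact: ia0.
  exact: iaD.
exists n, x, h; split=> //.
- move=> i; apply: desc => [m H j|]; first by have := H j.
  exact: cfrob_exp.
apply: (@local_independence p A C f P W kap theta kapP theta_base E expE G T) => //.
  by move=> j; apply: ia_prod => i _; exact: iaX.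
move=> g Gg g0 j.
pose d i := (p ^ h i)%N.
(* Independence in the fibre is stated for coefficients indexed by all multi-indices, so g is
   extended by 0 off the reduced ones. *)
pose gm (m : 'X_{1..n}) := if pselect (exists k : red_index d, red_mon k = m) is left H
  then g (projT1 (cid H)) else 0.
have gmE k : gm (red_mon k) = g k.
  rewrite /gm; case: pselect => [H|[]]; last by exists k.
  by congr g; apply: red_mon_inj; case: (cid H).
rewrite -gmE; apply: (ind [seq red_mon k | k <- enum {: red_index d}]) => //.
- by rewrite map_inj_uniq ?enum_uniq //; exact: red_mon_inj.
- by move=> _ /mapP[k _ ->] i; exact: red_mon_lt.
- by move=> m; rewrite /gm; case: pselect => // _; exact: (sa0 (fsub G)).
- rewrite big_map big_enum -[RHS]g0; apply: eq_bigr => k _; rewrite gmE rmorph_prod.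
  congr (_ * _); apply: eq_bigr => i _.
  by rewrite rmorphXn mul1n wE expr1.
by apply: map_f; rewrite mem_enum.
Qed.

End Pair.
End NormalForm.

Section TowerNormalForm.
Variables (p : nat) (A C : comNzRingType) (f : {rmorphism A -> C}).
Hypothesis charA : p \in [pchar A].

Definition ia_image (S : comNzRingType) (u : {rmorphism A -> S}) (k : {rmorphism S -> C})
  (fE : forall a, f a = k (u a)) : intalg f.
Proof.
refine (@Intalg _ _ f (fun c => exists y, k y = c) _ _ _).
- by move=> a; exists (u a); rewrite fE.
- by move=> _ _ [a <-] [b <-]; exists (a + b); rewrite rmorphD.
- by move=> _ _ [a <-] [b <-]; exists (a * b); rewrite rmorphM.
Defined.

Definition ia_range : intalg f := ia_image (u := idfun) (k := f) (fun=> erefl).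

Lemma eq_proj (R : comNzRingType) (S S' T T' : R -> Prop) :
  (forall x, S x <-> S' x) -> (forall x, T x <-> T' x) -> proj S T -> proj S' T'.
Proof.
move=> SS TT; have -> : S' = S by apply/funext => x; apply/propext; split=> /SS.
by have -> : T' = T by apply/funext => x; apply/propext; split=> /TT.
Qed.

Variables (B : intalg f) (E : nat).
Hypothesis expE : forall c, exists a, f a = c ^+ (p ^ E).
Hypothesis finC : exists (n : nat) (g : 'I_n -> C),
  forall c, exists a : 'I_n -> A, c = \sum_i f (a i) * g i.
Hypothesis projAB : forall e, proj (cfrob p ia_range B e) B.
Hypothesis projBC : forall e, proj (cfrob p B (ia_whole f) e) (ia_whole f).
Hypothesis projA : forall e j, (0 < e)%N ->
  proj (cfrob p ia_range (cfrob p B (ia_whole f) e) j) (cfrob p B (ia_whole f) e).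

Local Notation wholeC := (ia_whole f).

Lemma cfrob_large (S T : intalg f) e : (E <= e)%N -> forall x, cfrob p S T e x <-> S x.
Proof.
move=> Ee x; split=> [|Sx]; last exact: cfrob_base.
apply: cfrob_least => [||||t _]; [exact: ia0|exact: iaD|exact: iaM|by []|].
rewrite -(subnK Ee) addnC expnD exprM; have [a <-] := expE t.
by rewrite -rmorphXn; exact: ia_base.
Qed.

Lemma cfrob_sub (S T : intalg f) e : (forall x, S x -> T x) ->
  forall x, cfrob p S T e x -> T x.
Proof.
move=> ST x; apply: cfrob_least => // [||u v|t Tt]; first exact: ia0.
- exact: iaD.
- exact: iaM.
exact: iaX.
Qed.

Lemma range_sub (S : intalg f) x : ia_range x -> S x.
Proof. by move=> [a <-]; exact: ia_base. Qed.

Lemma proj_B_whole : proj B wholeC.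
Proof. by apply: eq_proj (projBC E) => x //; exact: cfrob_large. Qed.

(** The hypotheses pass to the fibre, where [frob_tower_pbases] applies. Its level E is B' itself,
    which yields the Frobenius p-bases of K < B'; the successive steps of the tower are those of B'
    < W. *)
Theorem tower_normal_form (P : prime_idealr A) (A' : comNzRingType)
    (phi : {rmorphism localization (idfun : {rmorphism A -> A}) P -> A'})
    (p_pr : prime p) :
  faithfully_flat phi -> truncated_over p_pr f phi ->
  normal_form p f P ia_range B /\ normal_form p f P B wholeC.
Proof.
move=> ff tr; have [W [kap [theta [pbW kapP theta_base theta_span univ]]]] :=
  fibre_exists charA ff tr.
pose F S := fibre_sub theta (f := f) S.
have Fproj (S : intalg f) : proj S wholeC -> proj (F S) (whole W).
  exact: (fibre_proj theta_base theta_span univ).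
have Fwhole w : F wholeC w <-> whole W w by exact: (fibre_whole f theta_span).
have Frange w : F ia_range w <-> scalars W w.
  split; last exact: scalars_sub.
  apply: (@addcl_least _ _ (scalars W)) => [|u v|]; [exact: sa0|exact: saD|].
  move=> _ [k [_ [[a <-] ->]]]; rewrite theta_base -(rmorphM (iota W)).
  by exists (k * kap a).
have Ffrob (S T : intalg f) (G' T' : subalg W) e w : (forall w, F S w <-> G' w) -> (forall w, F T w <-> T' w) ->
    F (cfrob p S T e) w <-> frob G' T' e w.
  move=> SG TT; split=> [/fibre_frob|H]; first by apply: frob_mono => u; [move/SG|move/TT].
  by apply/fibre_frob; move: H; apply: frob_mono => u; [move/SG|move/TT].
have FD e w : F (cfrob p B wholeC e) w <-> frob (F B) (whole W) e w.
  exact: Ffrob.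
have whole_mul x y : wholeC x -> wholeC y -> wholeC (x * y) by [].
have projAD e j : (0 < e)%N ->
    proj (frob (scalars W) (frob (F B) (whole W) e) j) (frob (F B) (whole W) e).
  move=> e0; pose D := cfrob p B wholeC e.
  have pD : proj (F (cfrob p ia_range D j)) (F D).
    apply: (@proj_summand _ _ _ _ (whole W)) => //.
    - by apply: fibre_sub_mono; apply: cfrob_sub => x; exact: range_sub.
    - apply: Fproj; apply: proj_comp (projA j e0) (projBC e) => //.
      by apply: cfrob_sub => x; exact: range_sub.
    exact/Fproj/projBC.
  apply: eq_proj pD => w; last exact: FD.
  by apply: Ffrob => // u; exact: FD.
have projD e : proj (frob (F B) (whole W) e) (whole W).
  by apply: eq_proj (Fproj _ (projBC e)) => w //; exact: FD.
have main := @frob_tower_pbases _ _ (F B) pbW projD projAD.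
split; apply: (@normal_form_of_pbases p A C f charA P W kap theta kapP theta_base
  univ E expE finC) => //.
- by move=> x; exact: range_sub.
- by apply: eq_proj (projAB E) => x //; exact: cfrob_large.
- move=> e; apply: proj_comp (projAB e) proj_B_whole => //.
  by apply: cfrob_sub => x; exact: range_sub.
- have [pbE _] := main E; apply: eq_frob_pbases pbE => w.
    by symmetry; exact: Frange.
  by rewrite -FD; split; apply: fibre_sub_mono => x; rewrite cfrob_large.
- exact: proj_B_whole.
move=> e; have [_] := main e; apply: eq_has_pbasis => w; rewrite -FD;
  exact: fibre_frob.
Qed.

End TowerNormalForm.

(** * Splitting after a finite free base change *)

(** Localizations and tensor products come without a proof of 1 != 0, which polynomial rings and
    their quotients require; the proof is made part of the type. *)
Definition nonzero_ring (R : comPzRingType) of (1 : R) != 0 : Type := R.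

Section NonzeroRing.
Variables (R : comPzRingType) (R1 : (1 : R) != 0).
HB.instance Definition _ := GRing.ComPzRing.on (nonzero_ring R1).
HB.instance Definition _ := GRing.PzSemiRing_isNonZero.Build (nonzero_ring R1) R1.

Definition to_nonzero : {rmorphism R -> nonzero_ring R1} := idfun.
End NonzeroRing.

Lemma pexpD_pz (R : comPzRingType) p e (x y : R) : prime p -> p%:R = 0 :> R ->
  (x + y) ^+ (p ^ e) = x ^+ (p ^ e) + y ^+ (p ^ e).
Proof.
move=> p_pr p0; have [R0|R1] := eqVneq (1 : R) 0.
  have R00 (z : R) : z = 0 by rewrite -[z]mul1r R0 mul0r.
  by rewrite [LHS]R00 [RHS]R00.
by apply: (@pexpD_pchar (nonzero_ring R1)); rewrite inE p_pr; apply/eqP.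
Qed.

Lemma pexp_sum_pz (R : comPzRingType) p e (J : Type) (r : seq J) (E : J -> R) :
  prime p -> p%:R = 0 :> R ->
  (\sum_(j <- r) E j) ^+ (p ^ e) = \sum_(j <- r) E j ^+ (p ^ e).
Proof.
move=> p_pr p0; elim/big_rec2: _ => [|j x y _ <-]; last by rewrite pexpD_pz.
by rewrite expr0n gtn_eqF // expn_gt0 prime_gt0.
Qed.

Definition finite_free (R S : comPzRingType) (f : R -> S) : Prop :=
  exists (I : finType) (b : I -> S),
  [/\ inhabited I, forall y, exists c : I -> R, y = \sum_i f (c i) * b i
    & forall c : I -> R, \sum_i f (c i) * b i = 0 -> forall i, c i = 0].

Lemma finite_free_id (R : comPzRingType) : finite_free (idfun : R -> R).
Proof.
exists unit, (fun=> 1); split=> [|y|c]; first by [].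
  by exists (fun=> y); rewrite (bigD1 tt) //= big1 ?addr0 ?mulr1 // => -[].
by rewrite (bigD1 tt) //= big1 => [|[] //]; rewrite addr0 mulr1 => c0 [].
Qed.

Lemma finite_free_comp (R S T : comPzRingType) (f : {rmorphism R -> S})
    (g : {rmorphism S -> T}) :
  finite_free f -> finite_free g -> finite_free (g \o f).
Proof.
move=> [I [b [[i0] bP b0]]] [J [d [[j0] dP d0]]].
exists (I * J)%type, (fun ij => g (b ij.1) * d ij.2); split=> [|y|c].
- exact: (inhabits (i0, j0)).
- have [c ->] := dP y; have /choice[e eP] j := bP (c j).
  exists (fun ij => e ij.2 ij.1).
  rewrite -(pair_bigA _ (fun i j => g (f (e j i)) * (g (b i) * d j))) exchange_big /=.
  apply: eq_bigr => j _; rewrite {1}eP rmorph_sum mulr_suml.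
  by apply: eq_bigr => i _; rewrite rmorphM mulrA.
move=> c0 [i j]; apply: (b0 (fun i => c (i, j))).
apply: (d0 (fun j => \sum_i f (c (i, j)) * b i)).
transitivity (\sum_i \sum_j g (f (c (i, j))) * (g (b i) * d j)).
  rewrite exchange_big; apply: eq_bigr => k _; rewrite rmorph_sum mulr_suml.
  by apply: eq_bigr => l _; rewrite rmorphM mulrA.
by rewrite -[RHS]c0 pair_bigA; apply: eq_bigr => -[].
Qed.

Section FreeFlat.
Variables (R S : comPzRingType) (f : {rmorphism R -> S}).
Local Notation M := (restr_scalars f).
Variables (I : finType) (b : I -> S) (i0 : I).
Hypothesis b_span : forall y, exists c : I -> R, y = \sum_i f (c i) * b i.
Hypothesis b_free :
  forall c : I -> R, \sum_i f (c i) * b i = 0 -> forall i, c i = 0.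

Definition basis_coord (y : S) : I -> R := projT1 (cid (b_span y)).
Local Notation co := basis_coord.

Let coE y : y = \sum_i f (co y i) * b i.
Proof. by rewrite /basis_coord; case: cid. Qed.

Let co_uniq y (c : I -> R) : y = \sum_i f (c i) * b i -> co y = c.
Proof.
move=> yc; apply/funext => i; apply/eqP; rewrite -subr_eq0; apply/eqP.
move: i; apply: b_free; under eq_bigr => i _ do rewrite rmorphB mulrBl.
by rewrite sumrB -coE -yc subrr.
Qed.

Let coD y z i : co (y + z) i = co y i + co z i.
Proof.
rewrite (co_uniq (c := fun i => co y i + co z i)) // {1}(coE y) {1}(coE z) -big_split.
by apply: eq_bigr => j _; rewrite rmorphD mulrDl.
Qed.

Let coZ a y i : co (f a * y) i = a * co y i.
Proof.
rewrite (co_uniq (c := fun i => a * co y i)) // {1}(coE y) mulr_sumr.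
by apply: eq_bigr => j _; rewrite rmorphM mulrA.
Qed.

Lemma basis_coord_basis i j : co (b i) j = (i == j)%:R.
Proof.
rewrite (co_uniq (c := fun j => (i == j)%:R)) // (bigD1 i) //= eqxx rmorph1 mul1r.
by rewrite big1 ?addr0 // => k /negPf; rewrite eq_sym => ->; rewrite rmorph0 mul0r.
Qed.

Section Coordinate.
Variables (N : lmodType R) (i : I).

Let bil (y : M) (n : N) : N := co y i *: n.

Lemma tensor_coord_balanced : balanced bil.
Proof.
split=> [n y z|y n m|a y n]; rewrite /bil.
- by rewrite coD scalerDl.
- by rewrite scalerDr.
by rewrite [co _ _](coZ a) mulrC scalerA.
Qed.


Definition tensor_coord (z : tensor M N) : N := tensor_lift bil z.

Lemma tensor_coordE (y : M) n : tensor_coord (tens y n) = co y i *: n.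
Proof. exact: (tensor_liftE tensor_coord_balanced). Qed.

Lemma tensor_coordB x y : tensor_coord (x - y) = tensor_coord x - tensor_coord y.
Proof. exact: (tensor_liftB tensor_coord_balanced). Qed.

Lemma tensor_coord0 : tensor_coord 0 = 0.
Proof. exact: (tensor_lift0 tensor_coord_balanced). Qed.

End Coordinate.

Lemma tensor_expand (N : lmodType R) (z : tensor M N) :
  z = \sum_i tens (b i : M) (tensor_coord i z).
Proof.
elim/tensorW: z => [y n|x y {1}-> {1}->].
  rewrite {1}(coE y) (tens_suml (M := M)); apply: eq_bigr => i _.
  by rewrite tensor_coordE; exact: (@tensZ R M N (co y i) (b i)).
rewrite -sumrB; apply: eq_bigr => i _.
by rewrite tensor_coordB; apply: (addIr (tens (b i : M) (tensor_coord i y))); rewrite -tensDr !subrK.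
Qed.

Lemma tensor_coord_basis (N : lmodType R) (c : I -> N) k :
  tensor_coord k (\sum_i tens (b i : M) (c i)) = c k.
Proof.
rewrite [LHS](tensor_lift_sum _ _ (tensor_coord_balanced N k)).
rewrite (bigD1 k) //= big1 => [|i /negPf ik].
  by rewrite addr0 [LHS]tensor_coordE basis_coord_basis eqxx scale1r.
by rewrite [LHS]tensor_coordE basis_coord_basis ik scale0r.
Qed.

(** Tensoring with a free module gives copies of N on which maps act coordinatewise; the coordinate
    i0 is there to reflect exactness. *)
Lemma finite_free_flat : faithfully_flat f.
Proof.
move=> N1 N2 N3 g h.
have coord_map (N N' : lmodType R) (k : {linear N -> N'}) i z :
    tensor_coord i (tensor_map k z) = k (tensor_coord i z).
  elim/tensorW: z => [y n|x y Hx Hy]; first by rewrite tensor_mapE !tensor_coordE linearZ.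
  by rewrite (tensor_mapB k) !tensor_coordB Hx Hy linearB.
split=> ex y; split.
- move=> hy; have /choice[x xP] i : exists x, g x = tensor_coord i y.
    by apply/ex; rewrite -coord_map hy tensor_coord0.
  exists (\sum_i tens (b i : M) (x i)).
  rewrite tensor_map_sum [RHS]tensor_expand; apply: eq_bigr => i _.
  by rewrite tensor_mapE xP.
- move=> [x <-]; rewrite [LHS]tensor_expand big1 // => i _.
  rewrite !coord_map; have -> : h (g (tensor_coord i x)) = 0 by apply/ex; eexists.
  exact: tens0r.
- move=> hy; have /ex[x xE] : tensor_map h (tens (b i0 : M) y) = 0.
    by rewrite tensor_mapE hy tens0r.
  exists (tensor_coord i0 x); rewrite -coord_map xE tensor_coordE basis_coord_basis eqxx.
  by rewrite scale1r.
move=> [x <-]; have : tensor_map h (tens (b i0 : M) (g x)) = 0.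
  by apply/ex; exists (tens (b i0 : M) x); rewrite tensor_mapE.
move/(congr1 (tensor_coord i0)).
by rewrite tensor_coord0 tensor_mapE tensor_coordE basis_coord_basis eqxx scale1r.
Qed.

End FreeFlat.

Lemma finite_free_faithfully_flat (R S : comPzRingType) (f : {rmorphism R -> S}) :
  finite_free f -> faithfully_flat f.
Proof. by move=> [I [b [[i0] bP b0]]]; exact: (finite_free_flat i0 bP b0). Qed.

(** The ring is R[X]/(X^q - a), free on the powers of X below q because the polynomial is monic. *)
Lemma adjoin_root (R : comNzRingType) (a : R) (q : nat) : (0 < q)%N ->
  exists (S : comNzRingType) (f : {rmorphism R -> S}) (r : S),
    finite_free f /\ r ^+ q = f a.
Proof.
move=> q_gt0; pose h : {poly R} := 'X^q - a%:P.
have szh : size h = q.+1 by rewrite size_XnsubC.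
have mh : mk_monic h = h by rewrite /mk_monic szh ltnS q_gt0 monicXnsubC.
pose S : comNzRingType := {poly %/ h}.
pose f : {rmorphism R -> S} := in_qpoly h \o polyC.
exists S, f, 'qX; split; last first.
  apply/eqP; rewrite -subr_eq0 -rmorphXn -rmorphB; apply/eqP; apply: val_inj => /=.
  by rewrite mh Pdiv.RingMonic.rmodpp // monicXnsubC.
have sumE (c : 'I_q -> R) :
    \sum_i f (c i) * 'qX ^+ i = in_qpoly h (\poly_(i < q) (if insub i is Some j then c j else 0)).
  rewrite poly_def rmorph_sum; apply: eq_bigr => i _.
  by rewrite -mul_polyC rmorphM rmorphXn valK.
exists 'I_q, (fun i : 'I_q => 'qX ^+ i : S); split=> [|y|c].
- exact: (inhabits (Ordinal q_gt0)).
- exists (fun i : 'I_q => (y : {poly R})`_i); rewrite sumE.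
  apply/val_inj/esym; apply: etrans (in_qpoly_small _) _.
    by apply: leq_ltn_trans (size_poly _ _) _; rewrite mh szh.
  apply/polyP => i; rewrite coef_poly; case: ltnP => [iq|qi].
    by rewrite insubT.
  by rewrite nth_default //; apply: leq_trans (size_npoly (y : {poly %/ h})) _; rewrite mh szh.
rewrite sumE => /(congr1 (fun w : {poly %/ h} => w : {poly R})).
rewrite in_qpoly_small; last by rewrite mh szh ltnS size_poly.
by move=> /polyP H i; have := H i; rewrite coef_poly ltn_ord coef0 valK.
Qed.

Lemma adjoin_roots (R : comNzRingType) (s : seq (R * nat)) :
  (forall c, c \in s -> (0 < c.2)%N) ->
  exists (S : comNzRingType) (f : {rmorphism R -> S}), finite_free f /\
    forall c, c \in s -> exists r, r ^+ c.2 = f c.1.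
Proof.
elim: s => [|c s IHs] s_gt0.
  by exists R, idfun; split=> //; exact: finite_free_id.
have [d ds|S [f [ff fP]]] := IHs; first by rewrite s_gt0 // inE ds orbT.
have [|T [g [r [fg rE]]]] := @adjoin_root S (f c.1) c.2.
  by rewrite s_gt0 // inE eqxx.
exists T, (g \o f); split=> [|d]; first exact: finite_free_comp.
rewrite inE => /predU1P[->|/fP[u uE]]; first by exists r.
by exists (g u); rewrite -rmorphXn uE.
Qed.

Lemma rmorphism_inverse (R S : pzRingType) (f : {rmorphism R -> S}) :
  injective f -> (forall y, exists x, f x = y) ->
  exists g : {rmorphism S -> R}, cancel f g /\ cancel g f.
Proof.
move=> f_inj /choice[g gK]; have fK : cancel f g by move=> x; apply: f_inj; rewrite gK.
pose gz := GRing.isZmodMorphism.Build S R g (GRing.can2_zmod_morphism fK gK).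
pose gm := GRing.isMonoidMorphism.Build S R g (GRing.can2_monoid_morphism fK gK).
by exists (HB.pack_for {rmorphism S -> R} g gz gm).
Qed.

Lemma finmx1C (R : comPzRingType) (J : finType) (M N : J -> J -> R) :
  (forall j l, \sum_k M j k * N k l = (j == l)%:R) ->
  forall j l, \sum_k N j k * M k l = (j == l)%:R.
Proof.
move=> MN j l.
pose mx (F : J -> J -> R) : 'M[R]_#|J| := \matrix_(i, k) F (enum_val i) (enum_val k).
have mx_mul F G i k : (mx F *m mx G) i k = \sum_l F (enum_val i) l * G l (enum_val k).
  rewrite mxE [RHS](reindex (@enum_val J predT)) /=; last first.
    by apply: onW_bij; exact: enum_val_bij.
  by apply: eq_bigr => m _; rewrite !mxE.
have /mulmx1C/matrixP/(_ (enum_rank j) (enum_rank l)) : mx M *m mx N = 1%:M.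
  by apply/matrixP => i k; rewrite mx_mul MN !mxE (inj_eq enum_val_inj).
by rewrite mx_mul !enum_rankK mxE (inj_eq enum_rank_inj).
Qed.

Lemma trunc_expand (R : comNzRingType) n (d : 'I_n -> nat) (d_gt0 : forall i, (0 < d i)%N)
    (w : trunc_mpoly R d_gt0) :
  exists c : red_index d -> R,
    w = \sum_j trunc_const d_gt0 (c j) * trunc_pi R d_gt0 'X_[red_mon j].
Proof.
have [g ->] := trunc_pi_surj w; exists (fun j => g@_(red_mon j)).
apply/eqP; rewrite -subr_eq0; apply/eqP.
under eq_bigr => j _ do rewrite trunc_const_pi -rmorphM mul_mpolyC.
rewrite -(rmorph_sum (trunc_pi R d_gt0)) -rmorphB.
apply/trunc_pi_eq0 => m /reducedP red_m; rewrite mcoeffB.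
have [k kE] := red_monP red_m; have {kE} kE : red_mon k = m by apply/mnmP.
rewrite raddf_sum (bigD1 k) //= big1 => [|j jk].
  by rewrite mcoeffZ mcoeffX kE eqxx mulr1 addr0 subrr.
rewrite mcoeffZ mcoeffX -kE (inj_eq (@red_mon_inj _ _)).
by rewrite (negPf jk) mulr0.
Qed.

Section Splitting.
Variables (p : nat) (p_pr : prime p).
Variables (R : comNzRingType) (S : comPzRingType) (h : {rmorphism R -> S}).
Hypothesis charR : p%:R = 0 :> R.
Variables (n : nat) (x : 'I_n -> S) (e : 'I_n -> nat).
Local Notation d := (fun i => (p ^ e i)%N).
Local Notation d_gt0 := (fun i => prime_exp_gt0 p_pr (e i)).
Local Notation J := (red_index d).
Local Notation b := (fun j : J => monom x 1 (red_mon j)).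
Hypothesis b_span : forall y, exists a : J -> R, y = \sum_j h (a j) * b j.
Hypothesis b_free : forall a : J -> R, \sum_j h (a j) * b j = 0 -> forall j, a j = 0.
Variable s : 'I_n -> seq (R * 'X_{1..n}).
Hypothesis s_lt : forall i c, c \in s i -> forall j, (p ^ e i * c.2 j < p ^ e j)%N.
Hypothesis xq : forall i,
  x i ^+ (p ^ e i) = \sum_(c <- s i) h c.1 * monom x (p ^ e i) c.2.

Section Trivialisation.
Variables (R' : comNzRingType) (phi : {rmorphism R -> R'}).
Variable rt : 'I_n -> R * 'X_{1..n} -> R'.
Hypothesis rtE : forall i c, c \in s i -> rt i c ^+ (p ^ e i) = phi c.1.

Local Notation T := (tensor_ring h phi).
Local Notation inl := (tensor_inl h phi).
Local Notation inr := (tensor_inr h phi).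

Lemma split_coord (c : J -> R') k :
  tensor_coord b_span (N := restr_scalars phi) k
    (\sum_j inr (c j) * inl (b j)) = c k.
Proof.
rewrite -[RHS](tensor_coord_basis b_span b_free (N := restr_scalars phi)); congr tensor_coord.
by apply: eq_bigr => j _; rewrite tens_mul mulrC.
Qed.

Lemma split_expand (z : T) : exists c : J -> R', z = \sum_j inr (c j) * inl (b j).
Proof.
exists (fun j => tensor_coord b_span (N := restr_scalars phi) j z).
rewrite {1}[z](tensor_expand b_span b_free (N := restr_scalars phi)).
by apply: eq_bigr => j _; rewrite tens_mul mulrC.
Qed.

Lemma split_uniq (c c' : J -> R') :
  \sum_j inr (c j) * inl (b j) = \sum_j inr (c' j) * inl (b j) -> c = c'.
Proof. by move=> H; apply/funext => j; rewrite -split_coord H split_coord. Qed.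

Lemma split_nonzero : (1 : T) != 0.
Proof.
apply/eqP => T0.
have H : \sum_j inr 1 * inl (b j) = \sum_j inr 0 * inl (b j).
  by apply: eq_bigr => j _; rewrite -[LHS]mul1r -[RHS]mul1r T0 !mul0r.
have [j _] : exists j : J, forall i, red_mon j i = 0%N by apply: red_monP => i; exact: d_gt0.
by have /(congr1 (fun c => c j))/eqP := split_uniq H; rewrite oner_eq0.
Qed.

Definition split_ring : comNzRingType := nonzero_ring split_nonzero.

(** The corrected variable. The p^e_i-th power of the subtracted sum is formed termwise and turns
    the roots into coefficients, so it reproduces the expression of x_i^(p^e_i). *)
Definition split_var (i : 'I_n) : split_ring :=
  inl (x i) - \sum_(c <- s i) inr (rt i c) * inl (monom x 1 c.2).

Lemma split_var_pow i : split_var i ^+ (p ^ e i) = 0.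
Proof.
have T0 : p%:R = 0 :> T.
  by rewrite -(rmorph_nat inl) -(rmorph_nat h) charR !rmorph0.
pose y : T := \sum_(c <- s i) inr (rt i c) * inl (monom x 1 c.2).
pose v : T := split_var i.
have : inl (x i) ^+ (p ^ e i) = v ^+ (p ^ e i) + y ^+ (p ^ e i).
  by rewrite -pexpD_pz // subrK.
suff -> : y ^+ (p ^ e i) = inl (x i) ^+ (p ^ e i).
  by rewrite -[LHS]add0r => /addIr <-.
rewrite pexp_sum_pz // -rmorphXn xq rmorph_sum big_seq_cond [RHS]big_seq_cond.
apply: eq_bigr => c /andP[cs _]; rewrite exprMn -!rmorphXn rtE // rmorphM.
congr (_ * _); first exact: (esym (tensor_inl_base h phi c.1)).
congr (inl _); rewrite -prodrXl.
by apply: eq_bigr => j _; rewrite mul1n -exprM mulnC.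
Qed.

Definition split_const : {rmorphism R' -> split_ring} := to_nonzero split_nonzero \o inr.

Lemma split_eval_pow i : mmap split_const split_var 'X_i ^+ (p ^ e i) = 0.
Proof. by rewrite mmapX mmap1U split_var_pow. Qed.

Definition split_map : {rmorphism trunc_mpoly R' d_gt0 -> split_ring} :=
  trunc_lift split_eval_pow.

Lemma split_mapC a : split_map (trunc_const _ a) = split_const a.
Proof. by rewrite trunc_const_pi [LHS]trunc_liftE /= mmapC. Qed.

Lemma split_mapX i : split_map (trunc_pi _ _ 'X_i) = split_var i.
Proof. by rewrite [LHS]trunc_liftE /= mmapX mmap1U. Qed.

Let im (z : split_ring) : Prop := exists w, split_map w = z.

Let imD u v : im u -> im v -> im (u + v).
Proof. by move=> [w <-] [w' <-]; exists (w + w'); rewrite rmorphD. Qed.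

Let imM u v : im u -> im v -> im (u * v).
Proof. by move=> [w <-] [w' <-]; exists (w * w'); rewrite rmorphM. Qed.

Let im_const a : im (split_const a).
Proof. by eexists; exact: split_mapC. Qed.

Let im_sum (K : Type) (r : seq K) (E : K -> split_ring) :
  (forall k, im (E k)) -> im (\sum_(k <- r) E k).
Proof.
move=> imE; apply: (@big_ind _ im) => [|u v|//]; last exact: imD.
by exists 0; rewrite rmorph0.
Qed.

Let im_prod (K : finType) (E : K -> split_ring) : (forall k, im (E k)) -> im (\prod_k E k).
Proof.
move=> imE; apply: (@big_ind _ im) => [|u v|//]; last exact: imM.
by exists 1; rewrite rmorph1.
Qed.

Let imX u k : im u -> im (u ^+ k).
Proof. by move=> [w <-]; exists (w ^+ k); rewrite rmorphXn. Qed.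

Let im_inl_prod m : (forall i, (0 < m i)%N -> im (inl (x i))) -> im (inl (monom x 1 m)).
Proof.
move=> H; rewrite rmorph_prod; apply: im_prod => i; rewrite rmorphXn mul1n.
have [->|] := posnP (m i); last by move/H/imX; apply.
by rewrite expr0; exists 1; rewrite rmorph1.
Qed.

(* The monomials in [xq] for [x i] only involve the [x j] with [e i < e j]. *)
Let im_inl i : im (inl (x i)).
Proof.
pose M := \sum_i e i.
have eM j : (e j <= M)%N by rewrite /M (bigD1 j) //= leq_addr.
(* Descending induction on e j, started above the bound M. *)
suff H k j : (M < e j + k)%N -> im (inl (x j)) by apply: (H M.+1); rewrite addnS ltnS leq_addl.
elim: k j => [|k IHk] j; first by rewrite addn0 ltnNge eM.
move=> ltM; have -> : inl (x j) = split_var j +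
    \sum_(c <- s j) inr (rt j c) * inl (monom x 1 c.2) :> split_ring by rewrite subrK.
apply: imD; first by eexists; exact: split_mapX.
rewrite big_seq_cond; apply: (@big_ind _ im) => [|u v|c /andP[cs _]]; last 1 first.
- apply: imM; first exact: im_const.
  apply: im_inl_prod => l cl; apply: IHk.
  have : (e j < e l)%N.
    rewrite -(ltn_exp2l _ _ (prime_gt1 p_pr)); apply: leq_ltn_trans (s_lt cs l).
    by rewrite leq_pmulr.
  by move=> ejl; move: ltM; rewrite addnS ltnS => /leq_ltn_trans; apply; rewrite ltn_add2r.
- by exists 0; rewrite rmorph0.
exact: imD.
Qed.

Lemma split_map_surj z : exists w, split_map w = z.
Proof.
have [c ->] := split_expand z; apply: im_sum => j; apply: imM; first exact: im_const.
by apply: im_inl_prod => i _; exact: im_inl.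
Qed.

(** A surjection between free modules of the same rank. In bases, surjectivity gives M N = 1, hence
    N M = 1 by [finmx1C], and then c N = 0 forces c = 0. *)
Lemma split_map_inj : injective split_map.
Proof.
pose X (k : J) : trunc_mpoly R' d_gt0 := trunc_pi _ _ 'X_[red_mon k].
have /choice[M ME] (j : J) : exists c : J -> R',
    inl (b j) = split_map (\sum_k trunc_const _ (c k) * X k) :> split_ring.
  have [w <-] := split_map_surj (inl (b j)).
  by have [c ->] := trunc_expand w; exists c.
have /choice[N NE] (k : J) : exists c : J -> R',
    split_map (X k) = \sum_l inr (c l) * inl (b l) :> T by exact: split_expand.
have comb (c : J -> R') : split_map (\sum_k trunc_const _ (c k) * X k) =
    \sum_l inr (\sum_k c k * N k l) * inl (b l) :> T.
  rewrite rmorph_sum.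
  under eq_bigr => k _ do rewrite rmorphM split_mapC NE mulr_sumr.
  rewrite exchange_big; apply: eq_bigr => l _ /=.
  rewrite rmorph_sum mulr_suml; apply: eq_bigr => k _.
  by rewrite rmorphM mulrA.
have MN j l : \sum_k M j k * N k l = (j == l)%:R.
  suff /(congr1 (fun c => c l)) : (fun l => \sum_k M j k * N k l) =
    (fun l => (j == l)%:R : R') by [].
  apply: split_uniq; rewrite -comb -ME (bigD1 j) //= eqxx rmorph1 mul1r.
  by rewrite big1 ?addr0 // => k /negPf; rewrite eq_sym => ->; rewrite rmorph0 mul0r.
have NM := finmx1C MN.
apply: raddf_inj => w; have [c ->] := trunc_expand w => /=.
rewrite [X in X = _ -> _]comb => H.
have cN l : \sum_k c k * N k l = 0.
  suff /(congr1 (fun c => c l)) : (fun l => \sum_k c k * N k l) = (fun=> 0) by [].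
  by apply: split_uniq; rewrite H big1 // => k _; rewrite rmorph0 mul0r.
rewrite big1 // => k _; suff -> : c k = 0 by rewrite trunc_const_pi mpolyC0 rmorph0 mul0r.
have -> : c k = \sum_l c l * (l == k)%:R.
  rewrite (bigD1 k) //= eqxx mulr1 big1 ?addr0 // => l /negPf ->.
  by rewrite mulr0.
under eq_bigr => l _ do rewrite -NM mulr_sumr.
rewrite exchange_big big1 // => l _ /=.
by under eq_bigr => m _ do rewrite mulrA; rewrite -mulr_suml cN mul0r.
Qed.

End Trivialisation.

Theorem splitting_extension :
  exists (R' : comNzRingType) (phi : {rmorphism R -> R'}), finite_free phi /\
    exists psi : {rmorphism tensor_ring h phi -> trunc_mpoly R' d_gt0},
      bijective psi /\ forall a, psi (tensor_inr h phi a) = trunc_const _ a.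
Proof.
pose all_roots := flatten [seq [seq (c.1, p ^ e i)%N | c <- s i] | i <- enum 'I_n].
have [|R' [phi [free_phi phiP]]] := @adjoin_roots R all_roots.
  move=> c /flatten_mapP[i _ /mapP[c' _ ->]]; exact: d_gt0.
have /choice[rt rtE] i : exists r : R * 'X_{1..n} -> R',
    forall c, c \in s i -> r c ^+ (p ^ e i) = phi c.1.
  suff /choice[r rP] (c : R * 'X_{1..n}) :
    exists r, c \in s i -> r ^+ (p ^ e i) = phi c.1 by exists r.
  have [cs|] := boolP (c \in s i); last by exists 0.
  have [|r rE] := phiP (c.1, p ^ e i)%N; last by exists r.
  by apply/flatten_mapP; exists i; rewrite ?mem_enum //; apply: map_f.
exists R', phi; split=> //.
have [g [mapK gK]] := rmorphism_inverse (@split_map_inj R' phi rt rtE) (@split_map_surj R' phi rt rtE).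
exists (g \o to_nonzero (split_nonzero phi)); split=> [|a].
  by exists (split_map rtE); [exact: gK|exact: mapK].
by apply: (can_inj mapK); rewrite split_mapC [LHS]gK.
Qed.

End Splitting.

(** * From normal forms to splittings of the localizations *)

Section LocalSplitting.
Variables (p : nat) (p_pr : prime p).
Variables (R S : comNzRingType) (g : {rmorphism R -> S}) (Q : prime_idealr R).
Hypothesis charR : p \in [pchar R].
Local Notation I := (Q : {pred R}).
Local Notation RQ := (localization (idfun : {rmorphism R -> R}) Q).
Local Notation SQ := (localization g Q).
Local Notation inR := (loc_in (idfun : {rmorphism R -> R}) Q).
Local Notation inS := (loc_in g Q).

(** [normal_form] for a ring map R -> S itself, with coefficients in R rather than in a subset of
    C. *)
Definition local_normal_form : Prop :=
  exists n (x : 'I_n -> S) (e : 'I_n -> nat),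
  [/\ forall i, (0 < e i)%N,
      forall y, exists2 s, s \notin I & exists a : red_index (fun i => p ^ e i)%N -> R,
        g s * y = \sum_j g (a j) * monom x 1 (red_mon j),
      forall i, exists2 s, s \notin I &
        mspan (fun y => exists r, g r = y) x (p ^ e i)
          (fun m => forall j, (p ^ e i * m j < p ^ e j)%N) (g s * x i ^+ (p ^ e i))
    & forall a : red_index (fun i => p ^ e i)%N -> R,
        \sum_j g (a j) * monom x 1 (red_mon j) = 0 ->
        exists2 s, s \notin I & forall j, s * a j = 0].

Lemma loc_map_inR a : loc_map g Q (inR a) = inS (g a).
Proof. exact: loc_map_in. Qed.

Let locM a b : loc_map g Q (a * b) = loc_map g Q a * loc_map g Q b.
Proof. exact: rmorphM. Qed.

Let inRM a b : inR (a * b) = inR a * inR b.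
Proof. exact: rmorphM. Qed.

Let inSM a b : inS (a * b) = inS a * inS b.
Proof. exact: rmorphM. Qed.

Let inS_sum (J : Type) (r : seq J) (E : J -> S) :
  inS (\sum_(j <- r) E j) = \sum_(j <- r) inS (E j).
Proof. exact: rmorph_sum. Qed.

Lemma loc_nonzero : (1 : RQ) != 0.
Proof.
apply/eqP => /mk_frac_inj[u uI /=]; rewrite !mulr1 mulr0 => u0.
by move: uI; rewrite u0 idealr0.
Qed.

Lemma loc_unit s (sI : s \notin I) : inR s * mk_frac idfun 1 sI = 1.
Proof. exact: loc_in_frac. Qed.

Lemma loc_frac c s (sI : s \notin I) :
  mk_frac g c sI = loc_map g Q (mk_frac idfun 1 sI) * inS c.
Proof.
rewrite loc_mapE -[RHS]/(loc_mul _ _) loc_mulE; apply: loc_eq.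
by rewrite rmorph1 mul1r mulr1.
Qed.

Lemma loc_common_denominator (J : finType) (a : J -> RQ) :
  exists t (c : J -> R), t \notin I /\ forall j, inR t * a j = inR (c j).
Proof.
have /choice[d dP] j : exists d : R * R, d.2 \notin I /\ inR d.2 * a j = inR d.1.
  have [c [s [sI ->]]] := mk_fracP (a j).
  by exists (c, s); split=> //=; exact: loc_in_frac.
exists (\prod_j (d j).2), (fun j => (d j).1 * \prod_(k | k != j) (d k).2); split.
  elim/big_rec: _ => [|j u _ uI]; first exact: prime_notin1.
  by apply: prime_notinM => //; have [] := dP j.
move=> j; have [_ dE] := dP j; rewrite (bigD1 j) //=; set r := \prod_(k | _) _.
by rewrite !inRM -dE mulrAC.
Qed.

Lemma mspan_seq n (x : 'I_n -> S) q (B : 'I_n -> nat) y :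
  mspan (fun y => exists r, g r = y) x q (fun m => forall j, (q * m j < B j)%N) y ->
  exists l : seq (R * 'X_{1..n}), (forall c, c \in l -> forall j, (q * c.2 j < B j)%N) /\
    y = \sum_(c <- l) g c.1 * monom x q c.2.
Proof.
elim=> [|_ v [_ [m [[r <-] lt_m ->]]] _ [l [l_lt ->]]].
  by exists [::]; split=> //; rewrite big_nil.
exists ((r, [multinom m i | i < n]) :: l); split=> [c|].
  by rewrite inE => /predU1P[-> j /=|/l_lt //]; rewrite mnmE.
rewrite big_cons; congr (_ * _ + _); apply: eq_bigr => i _.
by rewrite mnmE.
Qed.

(** Denominators become invertible in the localization, so the reduced monomials are an actual basis
    there and [splitting_extension] applies. *)
Theorem local_splitting : local_normal_form ->
  exists (A' : comNzRingType) (phi : {rmorphism RQ -> A'}),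
    faithfully_flat phi /\ truncated_over p_pr g phi.
Proof.
move=> [n [x [e [e_gt0 span xq ind]]]].
pose xS i := inS (x i).
have monomS q m : monom xS q m = inS (monom x q m).
  by rewrite rmorph_prod; apply: eq_bigr => i _; rewrite rmorphXn.
pose RN : comNzRingType := nonzero_ring loc_nonzero.
pose h : {rmorphism RN -> SQ} := loc_map g Q.
have hE (a : RQ) : h a = loc_map g Q a by [].
have p0 : p%:R = 0 :> RN.
  have -> : p%:R = inR p%:R :> RQ by rewrite (rmorph_nat inR).
  by rewrite (pcharf0 charR) (rmorph0 inR).
have span_h z : exists a : red_index (fun i => p ^ e i)%N -> RN,
    z = \sum_j h (a j) * monom xS 1 (red_mon j).
  have [y [t [tI ->]]] := mk_fracP z; have [s sI [a aE]] := span y.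
  exists (fun j => mk_frac idfun 1 tI * (mk_frac idfun 1 sI * inR (a j)) : RQ).
  under eq_bigr => j _ do rewrite monomS hE !locM loc_map_inR -!mulrA -inSM.
  rewrite -!mulr_sumr -inS_sum -aE inSM -loc_map_inR (mulrA (loc_map g Q (mk_frac idfun 1 sI))) -locM.
  by rewrite [_ * inR s]mulrC loc_unit (rmorph1 (loc_map g Q)) mul1r loc_frac.
have free_h (a : red_index (fun i => p ^ e i)%N -> RN) :
    \sum_j h (a j) * monom xS 1 (red_mon j) = 0 -> forall j, a j = 0.
  move=> a0; have [t [c [tI cE]]] := loc_common_denominator a.
  have : inS (\sum_j g (c j) * monom x 1 (red_mon j)) = 0.
    rewrite inS_sum -[RHS](mulr0 (loc_map g Q (inR t))) -[X in _ = _ * X]a0 mulr_sumr.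
    apply: eq_bigr => j _.
    by rewrite inSM monomS mulrA hE -locM cE loc_map_inR.
  move=> /loc_in_eq0[u uI u0].
  have [|s sI sc] := ind (fun j => u * c j).
    by rewrite -[RHS]u0 mulr_sumr; apply: eq_bigr => j _; rewrite rmorphM mulrA.
  move=> j; have rI := prime_notinM sI (prime_notinM uI tI).
  have : inR (s * (u * t)) * a j = 0 :> RQ.
    by rewrite !inRM -!mulrA cE -!inRM sc (rmorph0 inR).
  move=> /(congr1 (fun z : RQ => mk_frac idfun 1 rI * z)).
  by rewrite mulrA [_ * inR _]mulrC loc_unit mul1r mulr0.
have /choice[l lP] i : exists l : seq (RN * 'X_{1..n}),
    (forall c, c \in l -> forall j, (p ^ e i * c.2 j < p ^ e j)%N) /\
    xS i ^+ (p ^ e i) = \sum_(c <- l) h c.1 * monom xS (p ^ e i) c.2.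
  have [s sI /mspan_seq[l [l_lt lE]]] := xq i.
  exists [seq ((mk_frac idfun 1 sI * inR c.1 : RQ) : RN, c.2) | c <- l]; split.
    by move=> _ /mapP[c cl ->] /=; exact: l_lt.
  rewrite big_map /=.
  under eq_bigr => c _ do rewrite monomS !locM loc_map_inR -!mulrA -inSM.
  rewrite -!mulr_sumr -inS_sum -lE inSM -loc_map_inR mulrA -locM.
  by rewrite [_ * inR s]mulrC loc_unit (rmorph1 (loc_map g Q)) mul1r (rmorphXn inS).
have [R' [phi [phi_free [psi [psi_bij psiE]]]]] := @splitting_extension p p_pr RN SQ h p0
  n xS e span_h free_h l (fun i => proj1 (lP i)) (fun i => proj2 (lP i)).
exists R', (phi : {rmorphism RQ -> R'}); split.
  exact: (finite_free_faithfully_flat phi_free).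
by exists n, e, psi.
Qed.

End LocalSplitting.

(** As P is the preimage of Q, denominators outside P map outside Q. So a normal form at a prime of
    A also serves at primes of B. *)
Lemma normal_form_local (p : nat) (A R S C : comNzRingType)
    (u : {rmorphism A -> R}) (g : {rmorphism R -> S}) (k : {rmorphism S -> C})
    (f : {rmorphism A -> C}) (P : prime_idealr A) (Q : prime_idealr R)
    (G T : C -> Prop) :
  (forall a, f a = k (g (u a))) -> injective g -> injective k ->
  (forall a, (a \in (P : {pred A})) = (u a \in (Q : {pred R}))) ->
  (forall c, G c <-> exists r, k (g r) = c) -> (forall c, T c <-> exists y, k y = c) ->
  normal_form p f P G T -> local_normal_form p g Q.
Proof.
move=> fE g_inj k_inj PQ GE TE [n [x0 [e [Tx span xq ind]]]].
have /choice[x xE] i : exists y, k y = x0 i by apply/TE; case: (Tx i).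
have monomE q m : monom x0 q m = k (monom x q m).
  by rewrite rmorph_prod; apply: eq_bigr => i _; rewrite rmorphXn xE.
have notQ s : s \notin (P : {pred A}) -> u s \notin (Q : {pred R}) by rewrite PQ.
exists n, x, e; split=> [i|y|i|a a0]; first by case: (Tx i).
- have [|s sP [b [Gb bE]]] := span (k y); first by apply/TE; exists y.
  have /choice[a aE] j : exists r, k (g r) = b j by exact/GE.
  exists (u s); first exact: notQ.
  exists a; apply: k_inj; rewrite rmorphM -fE bE rmorph_sum.
  by apply: eq_bigr => j _; rewrite rmorphM aE monomE.
- have [s sP H] := xq i; exists (u s); first exact: notQ.
  have : exists y, k y = f s * x0 i ^+ (p ^ e i) /\
      mspan (fun y => exists r, g r = y) x (p ^ e i)
        (fun m => forall j, (p ^ e i * m j < p ^ e j)%N) y.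
    elim: H => [|_ v [_ [m [/GE[r <-] Qm ->]]] _ [y [<- yP]]].
      by exists 0; rewrite rmorph0; split=> //; exact: addcl0.
    exists (g r * monom x (p ^ e i) m + y); rewrite rmorphD rmorphM monomE; split=> //.
    by apply: addclD => //; apply: addcl_gen; exists (g r), m; split=> //; exists r.
  move=> [y [yE yP]]; suff -> : g (u s) * x i ^+ (p ^ e i) = y by [].
  by apply: k_inj; rewrite yE rmorphM -fE rmorphXn xE.
have [||s sP s0] := ind (fun j => k (g (a j))).
- by move=> j; apply/GE; exists (a j).
- rewrite -[RHS](rmorph0 k) -a0 rmorph_sum; apply: eq_bigr => j _.
  by rewrite rmorphM monomE.
exists (u s); first exact: notQ.
move=> j; apply: g_inj; apply: k_inj.
by rewrite !rmorphM -fE s0 !rmorph0.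
Qed.

(** * Dual bases and projectivity *)

Lemma linear_pack (R : pzRingType) (U V : lmodType R) (k : U -> V) : linear k ->
  exists k' : {linear U -> V}, forall x, k' x = k x.
Proof.
move=> lin_k; pose kl := GRing.isLinear.Build R U V *:%R k lin_k.
by exists (HB.pack_for {linear U -> V} k kl).
Qed.

Definition dual_basis (R S : comPzRingType) (f : {rmorphism R -> S}) : Prop :=
  exists n (c : 'I_n -> S) (l : 'I_n -> S -> R),
  [/\ forall i x y, l i (x + y) = l i x + l i y,
      forall i a x, l i (f a * x) = a * l i x
    & forall x, x = \sum_i f (l i x) * c i].

Lemma projective_dual_basis (R S : comPzRingType) (f : {rmorphism R -> S}) :
  fin_generated (restr_scalars f) -> projective (restr_scalars f) -> dual_basis f.
Proof.
move=> [n [c cP]] proj_f.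
have [|g gE] := @linear_pack _ 'rV[R]_n (restr_scalars f) (fun v => \sum_i v 0 i *: c i).
  move=> a u v; rewrite scaler_sumr -big_split; apply: eq_bigr => i _.
  by rewrite !mxE scalerDl scalerA.
have [|k kE] := proj_f _ _ g idfun.
  move=> y; have [a ->] := cP y; exists (\row_i a i); rewrite gE.
  by apply: eq_bigr => i _; rewrite mxE.
exists n, c, (fun i x => k x 0 i); split=> [i x y|i a x|x].
- by rewrite linearD mxE.
- by rewrite [k _](linearZ_LR k a x) mxE.
by rewrite -[LHS](kE x) gE.
Qed.

Lemma dual_basis_projective (R S : comPzRingType) (f : {rmorphism R -> S}) :
  dual_basis f -> projective (restr_scalars f).
Proof.
move=> [n [c [l [lD lM lE]]]] M N g h g_surj.
have /choice[x xE] i := g_surj (h (c i)).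
have [|k kE] := @linear_pack _ (restr_scalars f) M (fun y => \sum_i l i y *: x i).
  move=> a u v; rewrite scaler_sumr -big_split; apply: eq_bigr => i _.
  by rewrite lD [l i (a *: u)]lM scalerDl scalerA.
exists k => y; rewrite kE {2}[y]lE [h _](linear_sum h) linear_sum; apply: eq_bigr => i _.
by rewrite linearZ xE; exact: (esym (linearZ_LR h (l i y) (c i))).
Qed.

Lemma dual_basis_image (R R' S : comNzRingType) (f : {rmorphism R -> S})
    (f' : {rmorphism R' -> S}) :
  injective f -> (forall r', exists r, f r = f' r') -> (forall r, exists r', f' r' = f r) ->
  dual_basis f' -> dual_basis f.
Proof.
move=> f_inj /choice[u uE] /choice[v vE] [n [c [l [lD lM lE]]]].
exists n, c, (fun i x => u (l i x)); split=> [i x y|i a x|x].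
- by apply: f_inj; rewrite rmorphD !uE lD rmorphD.
- by apply: f_inj; rewrite rmorphM !uE -vE lM rmorphM.
by rewrite {1}[x]lE; apply: eq_bigr => i _; rewrite uE.
Qed.

Lemma dual_basis_proj (R S C : comNzRingType) (f : {rmorphism R -> S})
    (k : {rmorphism S -> C}) : injective k -> dual_basis f ->
  proj (fun c => exists r, k (f r) = c) (fun c => exists y, k y = c).
Proof.
move=> k_inj [n [c [l [lD lM lE]]]].
have /choice[v vE] (t : C) : exists y, (exists y, k y = t) -> k y = t.
  by have [[y yt]|nt] := pselect (exists y, k y = t); [exists y|exists 0].
have vK y : v (k y) = y by apply: k_inj; apply: vE; exists y.
exists 'I_n, (fun i => k (c i)), (fun i t => k (f (l i (v t)))); split.
- by move=> i; exists (c i).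
- by move=> i t _; exists (l i (v t)).
- by move=> i _ _ [a <-] [b <-]; rewrite -rmorphD !vK lD !rmorphD.
- by move=> i _ _ [r <-] [y <-]; rewrite -rmorphM !vK lM !rmorphM.
move=> _ [y <-]; rewrite vK {1}[y]lE rmorph_sum; apply: eq_bigr => i _.
by rewrite rmorphM.
Qed.

Lemma F_extension_dual_basis p (R S : comNzRingType) (f : {rmorphism R -> S}) e :
  F_extension p f -> dual_basis (frob_incl f p e).
Proof.
move=> [_ [n [c cP]] _ /(_ e)]; apply: projective_dual_basis.
exists n, c => x; have [a aE] := cP x; exists (fun i => frob_base f p e (a i)).
by rewrite aE.
Qed.

(** When e is an exponent of S over R, the subring R[S^(p^e)] is the image of R. *)
Lemma F_extension_projective p (R S : comNzRingType) (f : {rmorphism R -> S}) :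
  F_extension p f -> projective (restr_scalars f).
Proof.
move=> Ff; have [f_inj _ [e he] _] := Ff; apply: dual_basis_projective.
apply: dual_basis_image f_inj _ _ (F_extension_dual_basis e Ff) => [[x xP]|r].
  have /asboolP : x \in [pred x | `[< exists r, f r = x >]].
    move/frob_predP: xP; apply.
    - split=> [|y z /asboolP[a <-] /asboolP[b <-]|y z /asboolP[a <-] /asboolP[b <-]].
      + by apply/asboolP; exists 1; rewrite rmorph1.
      + by apply/asboolP; exists (a - b); rewrite rmorphB.
      + by apply/asboolP; exists (a * b); rewrite rmorphM.
    - by move=> a; apply/asboolP; exists a.
    by move=> y; apply/asboolP; have [a <-] := he y; exists a.
  by [].
by exists (frob_base f p e r).
Qed.

(** * Contraction of primes and translation of the hypotheses into C *)

Section Preimage.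
Variables (A R : comNzRingType) (u : {rmorphism A -> R}) (Q : prime_idealr R).

Definition preimage_pred : {pred A} := fun a => u a \in (Q : {pred R}).

Lemma in_preimage a : (a \in preimage_pred) = (u a \in (Q : {pred R})).
Proof. by []. Qed.

Lemma preimage_idealr_closed : idealr_closed preimage_pred.
Proof.
split=> [||a x y]; rewrite !in_preimage.
- by rewrite rmorph0 idealr0.
- by rewrite rmorph1 idealr1.
by move=> xQ yQ; rewrite rmorphD rmorphM; apply: rpredD; rewrite ?idealMr.
Qed.

Lemma preimage_prime_closed : prime_idealr_closed preimage_pred.
Proof. by move=> x y; rewrite !in_preimage rmorphM prime_idealrM. Qed.

HB.instance Definition _ := isIdealr.Build A preimage_pred preimage_idealr_closed.
HB.instance Definition _ := isPrimeIdealrClosed.Build A preimage_pred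
  preimage_prime_closed.

Definition preimage_prime : prime_idealr A := preimage_pred.

End Preimage.

Section RangeAlgebra.
Variables (A C : comNzRingType) (f : {rmorphism A -> C}).

(** Identifies the Frobenius subalgebra defined as an intersection of subrings with the additive
    span used in the arguments. *)
Lemma frob_pred_image p (R S : comNzRingType) (g : {rmorphism R -> S})
    (k : {rmorphism S -> C}) (G T : intalg f) e c :
  (forall c, G c <-> exists r, k (g r) = c) -> (forall c, T c <-> exists y, k y = c) ->
  (exists y : frob_alg g p e, k (frob_incl g p e y) = c) <-> cfrob p G T e c.
Proof.
move=> GE TE; split=> [[[y yP] <-]|].
  have /asboolP : y \in [pred y | `[< cfrob p G T e (k y) >]]; last by [].
  move/frob_predP: yP; apply.
  - split=> [|x z /asboolP Hx /asboolP Hz|x z /asboolP Hx /asboolP Hz]; apply/asboolP.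
    + by rewrite rmorph1; exact: ia1.
    + by rewrite rmorphB; apply: iaD => //; exact: iaN.
    + by rewrite rmorphM; exact: iaM.
  - by move=> r; apply/asboolP; apply: cfrob_base; apply/GE; exists r.
  by move=> z; apply/asboolP; rewrite rmorphXn; apply: cfrob_exp; apply/TE; exists z.
have sub x (xP : x \in frob_pred g p e) :
    exists y : frob_alg g p e, k (frob_incl g p e y) = k x by exists (FrobAlg xP).
apply: (@cfrob_least p A C f G T e (fun c => exists y : frob_alg g p e,
  k (frob_incl g p e y) = c)) => [|_ _ [y <-] [z <-]|_ _ [y <-] [z <-]|s /GE[r <-]|t /TE[z <-]].
- by exists 0; rewrite !rmorph0.
- by exists (y + z); rewrite !rmorphD.
- by exists (y * z); rewrite !rmorphM.
- by apply: sub; exact: frob_pred_base.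
by rewrite -rmorphXn; apply: sub; apply/frob_predP => U _ _; apply.
Qed.

Lemma F_extension_proj p (R S : comNzRingType) (g : {rmorphism R -> S})
    (k : {rmorphism S -> C}) (G T : intalg f) e : injective k -> F_extension p g ->
  (forall c, G c <-> exists r, k (g r) = c) -> (forall c, T c <-> exists y, k y = c) ->
  proj (cfrob p G T e) T.
Proof.
move=> k_inj Fg GE TE; have := dual_basis_proj k_inj (F_extension_dual_basis e Fg).
apply: eq_proj => c; last by symmetry; exact: TE.
exact: frob_pred_image.
Qed.

End RangeAlgebra.

Lemma eq_cfrob p (A C : comNzRingType) (f : {rmorphism A -> C}) (G T T' : intalg f) e :
  (forall c, T c <-> T' c) -> forall c, cfrob p G T e c <-> cfrob p G T' e c.
Proof.
move=> TT c; split; apply: addcl_mono => _ [s [t [Gs Tt ->]]];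
  by exists s, t; split=> //; exact/TT.
Qed.

Theorem theorem3 (p : nat) (p_pr : prime p) (A B C : comNzRingType)
    (charA : p \in [pchar A])
    (iAB : {rmorphism A -> B}) (iBC : {rmorphism B -> C})
    (iAB_inj : injective iAB) (iBC_inj : injective iBC)
    (AC_pi : purely_inseparable p_pr (iBC \o iAB))
    (AB_F : F_extension p iAB) (BC_F : F_extension p iBC)
    (AF_F : forall e : nat, (1 <= e < ext_exponent p iBC)%N ->
       F_extension p (frob_base iBC p e \o iAB)) :
  purely_inseparable_tower p_pr iAB iBC.
Proof.
pose f : {rmorphism A -> C} := iBC \o iAB.
have fE a : f a = iBC (iAB a) by [].
pose D e := cfrob p (ia_image fE) (ia_whole f) e.
have [_ [E expE] [[n [c cP]] _] ff] := AC_pi.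
have finC : exists (n : nat) (g : 'I_n -> C),
    forall c, exists a : 'I_n -> A, c = \sum_i f (a i) * g i by exists n, c.
have projAB e : proj (cfrob p (ia_range f) (ia_image fE) e) (ia_image fE).
  exact: F_extension_proj iBC_inj AB_F _ _.
have wholeE (y : C) : ia_whole f y <-> exists z, idfun z = y by split=> // _; exists y.
have projBC e : proj (D e) (ia_whole f).
  exact: (@F_extension_proj _ _ f p _ _ iBC idfun _ _ e _ BC_F).
(* Below exp(C/B) this is hypothesis (2); from exp(C/B) on, B[C^(p^e)] is B and the claim is about A
   < B. *)
have projA e j : (0 < e)%N -> proj (cfrob p (ia_range f) (D e) j) (D e).
  move=> e_gt0; have [lt_e|le_e] := ltnP e (ext_exponent p iBC).
    apply: (@F_extension_proj _ _ f p _ _ _ (frob_incl iBC p e) _ _ j val_inj).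
    - by apply: AF_F; rewrite e_gt0.
    - by move=> y; exact: iff_refl.
    move=> y; apply: iff_sym.
    exact: (@frob_pred_image _ _ f p _ _ iBC idfun (ia_image fE) (ia_whole f) e y).
  have DB y : ia_image fE y <-> D e y.
    split=> [By|]; first exact: cfrob_base.
    apply: cfrob_least => [||||t _]; [exact: ia0|exact: iaD|exact: iaM|by []|].
    have [_ _ fin_exp _] := BC_F; have [has_e _] := ext_exponentP fin_exp.
    have [b bE] := has_e t.
    exists (b ^+ (p ^ (e - ext_exponent p iBC))).
    by rewrite rmorphXn bE -exprM -expnD subnKC.
  apply: eq_proj (projAB j) => y; last exact: DB.
  exact: eq_cfrob.
have nf P : normal_form p f P (ia_range f) (ia_image fE) /\
    normal_form p f P (ia_image fE) (ia_whole f).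
  have [A' [phi [ff_phi tr]]] := ff P.
  exact: (tower_normal_form charA expE finC projAB projBC projA ff_phi tr).
have [_ finAB expAB _] := AB_F; have [_ finBC expBC _] := BC_F.
split=> //; split=> //.
- by split=> //; exact: F_extension_projective AB_F.
- move=> Q; apply: local_splitting => //; have [H _] := nf Q.
  by apply: (normal_form_local (u := idfun) fE iAB_inj iBC_inj _ _ _ H).
- by split=> //; exact: F_extension_projective BC_F.
move=> Q; apply: local_splitting; first exact: (rmorph_pchar iAB charA).
(* A prime of B is treated through its contraction to A. *)
have [_ H] := nf (preimage_prime iAB Q).
by apply: (normal_form_local (k := idfun) fE iBC_inj _ _ _ wholeE H).
Qed.
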